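(* Let $0<L,W<\infty$, $\tau=iW/L$, $N\in\mathbb{N}$ (with $N\ge2$ when $R_N=D_N$), $R_N\in\{A_{N-1},B_N,B_N^\vee,C_N,C_N^\vee,BC_N,D_N\}$, $\Lambda=[0,L)\times i[0,W)$. Consider the point process $\Xi^{R_N}$ on $\mathbb{C}$ which is doubly periodic with periods $(L,iW)$ and whose restriction to $\Lambda$ consists of $N$ unlabeled points with law $\mathbf{P}^{R_N}$ having density $\mathbf{p}^{R_N}(\mathbf{z})=Q^{R_N}(\mathbf{z})/Z^{R_N}$ with respect to $\frac{1}{N!}d\mathbf{z}$ on $\Lambda^N$ (here $Z^{R_N}=\frac1{N!}\int_{\Lambda^N}Q^{R_N}(\mathbf{z})d\mathbf{z}$). For $1\le N'\le N$ and $\mathbf{z}_{N'}=(z_1,\dots,z_{N'})\in\mathbb{C}^{N'}$ define the correlation function $\rho^{R_N}(\mathbf{z}_{N'})=\frac{1}{(N-N')!}\int_{\Lambda^{N-N'}}\mathbf{p}^{R_N}(z_1,\dots,z_N)\prod_{j=N'+1}^Ndz_j$. Then this process is determinantal: for all $1\le N'\le N$ and $\mathbf{z}_{N'}\in\mathbb{C}^{N'}$, $$\rho^{R_N}(\mathbf{z}_{N'})=\det_{1\le j,k\le N'}[K^{R_N}(z_j,z_k)],\qquad K^{R_N}(z,z')=e^{-\pi\mathcal{N}(y^2+y'^2)/(LW)}\sum_{n=1}^N\frac{1}{h^{R_N}_n}M^{R_N}_n(z)\overline{M^{R_N}_n(z')},$$ where $y=\Im z$, $y'=\Im z'$; and these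 correlation functions are doubly periodic with periods $(L,iW)$ in each variable.
   Context: Jacobi theta functions ($\Im\tau>0$, $q_0=e^{\pi i\tau}$): $\vartheta_0(v;\tau)=\sum_{n\in\mathbb{Z}}(-1)^nq_0^{n^2}e^{2\pi inv}$, $\vartheta_1(v;\tau)=i\sum_n(-1)^nq_0^{(n-1/2)^2}e^{(2n-1)\pi iv}$, $\vartheta_2(v;\tau)=\sum_nq_0^{(n-1/2)^2}e^{(2n-1)\pi iv}$, $\vartheta_3(v;\tau)=\sum_nq_0^{n^2}e^{2\pi inv}$. $\mathcal{N}=\mathcal{N}^{R_N}$: $N$ for $A_{N-1}$; $2N-1$ for $B_N$; $2N$ for $B_N^\vee,C_N^\vee$; $2(N+1)$ for $C_N$; $2N+1$ for $BC_N$; $2(N-1)$ for $D_N$. $J(j)$: $j-1/2$ for $A_{N-1},C_N^\vee$; $j-1$ for $B_N,B_N^\vee,D_N$; $j$ for $C_N,BC_N$. $s(N)=0$ ($N$ even), $3$ ($N$ odd). Macdonald denominators with $P(\boldsymbol\xi)=\prod_{1\le j<k\le N}\vartheta_1(\xi_k-\xi_j;\tau)\vartheta_1(\xi_k+\xi_j;\tau)$: $W^{A_{N-1}}=\prod_{j<k}\vartheta_1(\xi_k-\xi_j;\tau)$; $W^{B_N}=\prod_\ell\vartheta_1(\xi_\ell;\tau)P$; $W^{B_N^\vee}=\prod_\ell\vartheta_1(2\xi_\ell;2\tau)P$; $W^{C_N}=\prod_\ell\vartheta_1(2\xi_\ell;\tau)P$; $W^{C_N^\vee}=\prod_\ell\vartheta_1(\xi_\ell;\tau/2)P$;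 $W^{BC_N}=\prod_\ell\vartheta_1(\xi_\ell;\tau)\vartheta_0(2\xi_\ell;2\tau)P$; $W^{D_N}=P$. $Q^{A_{N-1}}(\mathbf{z})=\exp(-\frac{2\pi\mathcal{N}}{LW}\sum_jy_j^2)|\vartheta_{s(N)}(\sum_kz_k/L;\tau)|^2|W^{A_{N-1}}(\mathbf{z}/L;\tau)|^2$, and for other types $Q^{R_N}(\mathbf{z})=\exp(-\frac{2\pi\mathcal{N}}{LW}\sum_jy_j^2)|W^{R_N}(\mathbf{z}/L;\tau)|^2$ ($y_j=\Im z_j$). Functions $M_j=M^{R_N}_j$: for $A_{N-1}$, $M_j(z)=e^{2\pi iJ(j)z/L}\vartheta_2(J(j)\tau+\mathcal{N}z/L;\mathcal{N}\tau)$; for $B_N,B_N^\vee$, $M_j(z)=e^{2\pi iJ(j)z/L}\vartheta_1(J(j)\tau+\mathcal{N}z/L;\mathcal{N}\tau)-e^{-2\pi iJ(j)z/L}\vartheta_1(J(j)\tau-\mathcal{N}z/L;\mathcal{N}\tau)$; for $C_N,C_N^\vee,BC_N$ the same with $\vartheta_2$; for $D_N$, $e^{2\pi iJ(j)z/L}\vartheta_2(J(j)\tau+\mathcal{N}z/L;\mathcal{N}\tau)+e^{-2\pi iJ(j)z/L}\vartheta_2(J(j)\tau-\mathcal{N}z/L;\mathcal{N}\tau)$. Constants $h_j=h^{R_N}_j$, with $e_j=e^{-2\tau\pi iJ(j)^2/\mathcal{N}}$, $c=LW/\sqrt{2\mathcal{N}\Im\tau}$: $A_{N-1}$: $h_j=c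 e_j$; $C_N,C_N^\vee,BC_N$: $h_j=2ce_j$; $B_N,B_N^\vee$: $h_1=4ce_1$, $h_j=2ce_j$ ($j\ge2$); $D_N$: $h_j=4ce_j$ for $j\in\{1,N\}$, $2ce_j$ otherwise. *)

(* Defs.v *)
From HB Require Import structures.
From mathcomp Require Import all_boot all_order all_algebra.
From mathcomp Require Import all_classical all_reals all_analysis.
From mathcomp.real_closed Require Import complex.
Set Implicit Arguments. Unset Strict Implicit. Unset Printing Implicit Defensive.
Import Order.TTheory GRing.Theory Num.Theory.
Import numFieldNormedType.Exports.
Local Open Scope ring_scope.
Local Open Scope complex_scope.

(* The seven root systems; [A] at parameter N stands for A_{N-1}. *)
Inductive rsys := RA | RB | RBv | RC | RCv | RBC | RD.

Section Defs.
Variable R : realType.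
Local Notation C := (R[i]).

Definition cexp (z : C) : C :=
  (expR (complex.Re z))%:C * (cos (complex.Im z) +i* sin (complex.Im z)).

Definition cabs2 (w : C) : R := complex.Re w ^+ 2 + complex.Im w ^+ 2.

Definition rseries (u : nat -> R) : R := limn (series u).

Definition zsum (f : int -> C) : C :=
  let g k := f (Posz k.+1) + f (- Posz k.+1)%R in
  f 0 + ((rseries (fun k => complex.Re (g k))) +i* (rseries (fun k => complex.Im (g k)))).

Definition PI : C := (pi : R)%:C.
Definition iC : C := 'i.

Definition theta0 (v tau : C) : C :=
  zsum (fun n => (-1) ^ n * cexp (PI * iC * tau * (n%:~R) ^+ 2 + 2%:R * PI * iC * n%:~R * v)).
Definition theta1 (v tau : C) : C :=
  iC * zsum (fun n => (-1) ^ n *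
    cexp (PI * iC * tau * (n%:~R - 2%:R^-1) ^+ 2 + (2%:R * n%:~R - 1) * PI * iC * v)).
Definition theta2 (v tau : C) : C :=
  zsum (fun n =>
    cexp (PI * iC * tau * (n%:~R - 2%:R^-1) ^+ 2 + (2%:R * n%:~R - 1) * PI * iC * v)).
Definition theta3 (v tau : C) : C :=
  zsum (fun n => cexp (PI * iC * tau * (n%:~R) ^+ 2 + 2%:R * PI * iC * n%:~R * v)).

Definition calN (r : rsys) (N : nat) : nat :=
  match r with
  | RA => N | RB => (2 * N - 1)%N | RBv => (2 * N)%N | RC => (2 * (N + 1))%N
  | RCv => (2 * N)%N | RBC => (2 * N + 1)%N | RD => (2 * (N - 1))%N
  end.

(* J(j), j being the paper's 1-based index *)
Definition Jf (r : rsys) (j : nat) : R :=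
  match r with
  | RA | RCv => j%:R - 2^-1
  | RB | RBv | RD => j%:R - 1
  | RC | RBC => j%:R
  end.

Definition theta_s (N : nat) : C -> C -> C := if odd N then theta3 else theta0.

(* Macdonald denominators; xi : nat -> C, only xi 0, ..., xi (N-1) matter
   (paper's xi_1, ..., xi_N) *)
Definition Pden (N : nat) (xi : nat -> C) (tau : C) : C :=
  \prod_(j < N) \prod_(k < N | (j < k)%N)
     (theta1 (xi k - xi j) tau * theta1 (xi k + xi j) tau).

Definition Wden (r : rsys) (N : nat) (xi : nat -> C) (tau : C) : C :=
  match r with
  | RA => \prod_(j < N) \prod_(k < N | (j < k)%N) theta1 (xi k - xi j) tau
  | RB => (\prod_(l < N) theta1 (xi l) tau) * Pden N xi tau
  | RBv => (\prod_(l < N) theta1 (2%:R * xi l) (2%:R * tau)) * Pden N xi tau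
  | RC => (\prod_(l < N) theta1 (2%:R * xi l) tau) * Pden N xi tau
  | RCv => (\prod_(l < N) theta1 (xi l) (tau / 2%:R)) * Pden N xi tau
  | RBC => (\prod_(l < N) (theta1 (xi l) tau * theta0 (2%:R * xi l) (2%:R * tau)))
             * Pden N xi tau
  | RD => Pden N xi tau
  end.

Definition tauLW (L W : R) : C := (0 +i* (W / L)).

Definition Qf (r : rsys) (N : nat) (L W : R) (z : nat -> C) : R :=
  let tau := tauLW L W in
  let zL := fun j => z j / L%:C in
  expR (- (2 * pi * (calN r N)%:R / (L * W)) * \sum_(j < N) complex.Im (z j) ^+ 2) *
  match r with
  | RA => cabs2 (theta_s N (\sum_(k < N) z k / L%:C) tau) * cabs2 (Wden RA N zL tau)
  | _ => cabs2 (Wden r N zL tau)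
  end.

Definition upd (z : nat -> C) (m : nat) (c : C) : nat -> C :=
  fun i => if i == m then c else z i.

(* Iterated Lebesgue integral over Lambda = [0,L) x i[0,W) in the variables
   at positions m, m+1, ..., m+k-1 of the configuration z, i.e.
   int_{Lambda^k} F(z) dz_m ... dz_{m+k-1}, with dz = dx dy. *)
Fixpoint intLam (L W : R) (k m : nat) (F : (nat -> C) -> R) (z : nat -> C) : R :=
  match k with
  | 0 => F z
  | k'.+1 =>
      (\int[@lebesgue_measure R]_(x in `[0, L[) 
         (\int[@lebesgue_measure R]_(y in `[0, W[)
             intLam L W k' m.+1 F (upd z m (x +i* y))))%R
  end.

Definition Zf (r : rsys) (N : nat) (L W : R) : R :=
  (N`!%:R)^-1 * intLam L W N 0 (Qf r N L W) (fun _ => 0).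

Definition pf (r : rsys) (N : nat) (L W : R) (z : nat -> C) : R :=
  Qf r N L W z / Zf r N L W.

Definition extz (N' : nat) (z : 'I_N' -> C) : nat -> C :=
  fun i => match insub i with Some j => z j | None => 0 end.

Definition rho (r : rsys) (N : nat) (L W : R) (N' : nat) (z : 'I_N' -> C) : R :=
  ((N - N')`!%:R)^-1 * intLam L W (N - N') N' (pf r N L W) (extz z).

(* M_j, j being the paper's 1-based index *)
Definition Mf (r : rsys) (N : nat) (L W : R) (j : nat) (z : C) : C :=
  let tau := tauLW L W in
  let n := (calN r N)%:R : C in
  let J := (Jf r j)%:C in
  let ep := cexp (2%:R * PI * iC * J * z / L%:C) in
  let em := cexp (- (2%:R * PI * iC * J * z / L%:C)) in
  match r with
  | RA => ep * theta2 (J * tau + n * z / L%:C) (n * tau)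
  | RB | RBv => ep * theta1 (J * tau + n * z / L%:C) (n * tau)
               - em * theta1 (J * tau - n * z / L%:C) (n * tau)
  | RC | RCv | RBC => ep * theta2 (J * tau + n * z / L%:C) (n * tau)
               - em * theta2 (J * tau - n * z / L%:C) (n * tau)
  | RD => ep * theta2 (J * tau + n * z / L%:C) (n * tau)
               + em * theta2 (J * tau - n * z / L%:C) (n * tau)
  end.

Definition hf (r : rsys) (N : nat) (L W : R) (j : nat) : C :=
  let tau := tauLW L W in
  let n := (calN r N)%:R : R in
  let e := cexp (- (2%:R * tau * PI * iC * ((Jf r j) ^+ 2)%:C / n%:C)) in
  let c := (L * W / Num.sqrt (2 * n * complex.Im tau))%:C in
  let f : C := match r with
    | RA => 1
    | RC | RCv | RBC => 2%:R
    | RB | RBv => if j == 1%N then 4%:R else 2%:R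
    | RD => if (j == 1%N) || (j == N) then 4%:R else 2%:R
    end in
  f * c * e.

Definition Kf (r : rsys) (N : nat) (L W : R) (z z' : C) : C :=
  (expR (- pi * (calN r N)%:R * (complex.Im z ^+ 2 + complex.Im z' ^+ 2) / (L * W)))%:C *
  \sum_(1 <= n < N.+1) ((hf r N L W n)^-1 * Mf r N L W n z * conjc (Mf r N L W n z')).

End Defs.

(* Main.v *)
Require Import Defs.
From HB Require Import structures.
From mathcomp Require Import all_boot all_order all_fingroup all_algebra.
From mathcomp Require Import all_classical all_reals all_analysis measurable_realfun.
From mathcomp.real_closed Require Import complex.
From mathcomp Require Import ring lra zify.
Import Order.TTheory GRing.Theory Num.Theory.
Import numFieldNormedType.Exports.
Local Open Scope ring_scope.
Local Open Scope complex_scope.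

Set Implicit Arguments.
Unset Strict Implicit.
Unset Printing Implicit Defensive.

(** Write W for the Macdonald denominator (multiplied, in type A, by the theta function
    of the sum of the variables). As a function of any one variable W is a theta function
    whose level, quasi-periods and parity are those of the M_j; comparing Fourier
    coefficients, such functions are spanned by M_1, ..., M_N. As W is moreover
    antisymmetric, it is a constant multiple of det M_j(z_k), and the constant is nonzero
    because W is not identically zero. The Fourier modes of the M_j are orthogonal on a
    fundamental domain for the Gaussian weight: integration in x kills distinct
    frequencies, and the quasi-periods in y unfold the sum of the remaining integrals into
    one Gaussian integral over the line. Hence the M_j are orthogonal with squared norms
    h_j, the density is the determinant of the projection kernel K, and integrating out
    one variable lowers the size of that determinant. Periodicity holds because a
    translation by a period multiplies all the weighted M_j by a common phase. *)

(** No zeros of theta functions are counted; everything rests on unordered summation of Fourier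
    series. The relation between a(k + 2p) and a(k) leaves 2p free coefficients, products become
    convolutions, and parity cuts 2p down to N. The values of [calN], J and s(N) are those for which
    this count closes: the levels of the factors of W in one variable add up to [calN], their
    multipliers combine to that of the M_j, and the admissible frequencies, folded by x -> -x
    outside type A and freed of those whose symmetrised series vanishes, are the 2J(j) - [calN].
    Before W can be compared with det M_j(z_k), that determinant must be known not to vanish
    identically. This follows from orthogonality alone, whereas W is nonzero by a power series
    argument on the real line. The constant Z needs no closed form: Q is a multiple of the kernel
    determinant and the factor cancels in Q/Z. Integrals are iterated one-dimensional ones, carried
    together with their integrability and passed to the limit by uniform convergence, so no order of
    integration is exchanged. *)

Section Norm.
Context {R : realType}.
Implicit Types z w : R[i].

(** The norm of [R[i]] takes values in [R[i]]; its real part gives access to the order of [R] and to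
    [lra]. *)
Definition nm z : R := complex.Re `|z|.

Lemma nmE z : `|z| = (nm z)%:C.
Proof. by rewrite /nm normc_def. Qed.

Lemma nm_ge0 z : 0 <= nm z.
Proof. by rewrite -ler0c -nmE. Qed.

Lemma nm_eq0 z : (nm z == 0) = (z == 0).
Proof. by rewrite -(inj_eq (@complexI R)) -nmE normr_eq0. Qed.

Lemma nm0 : nm 0 = 0.
Proof. by apply/eqP; rewrite nm_eq0. Qed.

Lemma nmD z w : nm (z + w) <= nm z + nm w.
Proof. by rewrite -lecR rmorphD/= -!nmE ler_normD. Qed.

Lemma nmN z : nm (- z) = nm z.
Proof. by rewrite /nm normrN. Qed.

Lemma nm_distC z w : nm (z - w) = nm (w - z).
Proof. by rewrite /nm distrC. Qed.

Lemma nm_triangle w z z' : nm (z - z') <= nm (z - w) + nm (w - z').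
Proof. by rewrite -lecR rmorphD/= -!nmE ler_distD. Qed.

Lemma nmM z w : nm (z * w) = nm z * nm w.
Proof. by apply: (@complexI R); rewrite rmorphM/= -!nmE normrM. Qed.

Lemma nmX z n : nm (z ^+ n) = nm z ^+ n.
Proof. by apply: (@complexI R); rewrite rmorphXn/= -!nmE normrX. Qed.

Lemma nmV z : nm (z^-1) = (nm z)^-1.
Proof. by apply: (@complexI R); rewrite fmorphV/= -!nmE normfV. Qed.

Lemma nm_real (x : R) : nm x%:C = `|x|.
Proof. by rewrite /nm normc_def/= expr0n/= addr0 sqrtr_sqr. Qed.

Lemma nm1 : nm 1 = 1.
Proof. by rewrite -[1]/((1 : R)%:C) nm_real normr1. Qed.

Lemma nm_conj z : nm z^* = nm z.
Proof. by rewrite /nm normcJ. Qed.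

Lemma nm_sum (I : Type) (s : seq I) (P : pred I) (f : I -> R[i]) :
  nm (\sum_(i <- s | P i) f i) <= \sum_(i <- s | P i) nm (f i).
Proof.
elim/big_ind2 : _ => // [|a b c d h1 h2]; first by rewrite nm0.
by apply: (le_trans (nmD _ _)); apply: lerD.
Qed.

Lemma nm_Re z : `|complex.Re z| <= nm z.
Proof. by rewrite -lecR -nmE normc_ge_Re. Qed.

Lemma nm_Im z : `|complex.Im z| <= nm z.
Proof.
have := nm_Re (- 'i * z); rewrite nmM nmN.
have -> : nm ('i : R[i]) = 1.
  by rewrite /nm normc_def/= expr0n/= add0r expr1n sqrtr1.
by case: z => a b /=; rewrite ?mulNr ?mul1r ?mul0r ?oppr0 ?subr0 ?sub0r ?opprK ?normrN.
Qed.

End Norm.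

(** * Unordered summation *)

Section Sums.
Context {R : realType}.
Local Notation C := (R[i]).

(** Convergence along the net of finite duplicate-free lists. No enumeration enters, so reindexing
    and summation by fibres work for every index type. *)
Definition hasSum (I : eqType) (f : I -> C) (s : C) :=
  forall e : R, 0 < e -> exists A : seq I, forall B : seq I,
    uniq B -> {subset A <= B} -> nm (\sum_(i <- B) f i - s) < e.

Definition asum (I : eqType) (f : I -> C) :=
  exists M : R, forall B : seq I, uniq B -> \sum_(i <- B) nm (f i) <= M.

Lemma small_eq (z w : C) : (forall e : R, 0 < e -> nm (z - w) < e) -> z = w.
Proof.
move=> h; apply/eqP; rewrite -subr_eq0 -nm_eq0 eq_le nm_ge0 andbT leNgt.
by apply/negP => /h; rewrite ltxx.
Qed.

Lemma hasSum_unique (I : eqType) (f : I -> C) s s' :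
  hasSum f s -> hasSum f s' -> s = s'.
Proof.
move=> h h'; apply: small_eq => e e0.
have e2 : 0 < e / 2 by rewrite divr_gt0.
have [A hA] := h _ e2; have [A' hA'] := h' _ e2.
pose B := undup (A ++ A').
have uB : uniq B by exact: undup_uniq.
have := hA B uB; have := hA' B uB.
move=> /(_ _)/wrap[|h2]; first by move=> x xA; rewrite mem_undup mem_cat xA orbT.
move=> /(_ _)/wrap[|h1]; first by move=> x xA; rewrite mem_undup mem_cat xA.
apply: (le_lt_trans (nm_triangle (\sum_(i <- B) f i) _ _)).
rewrite nm_distC; lra.
Qed.

Lemma eq_hasSum (I : eqType) (f g : I -> C) s : f =1 g -> hasSum f s -> hasSum g s.
Proof.
move=> fg h e e0; have [A hA] := h e e0; exists A => B uB AB.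
by rewrite -(eq_bigr _ (fun i _ => fg i)) hA.
Qed.

Lemma eq_asum (I : eqType) (f g : I -> C) : f =1 g -> asum f -> asum g.
Proof. by move=> /funext ->. Qed.

Lemma hasSumD (I : eqType) (f g : I -> C) s s' :
  hasSum f s -> hasSum g s' -> hasSum (fun i => f i + g i) (s + s').
Proof.
move=> h h' e e0.
have e2 : 0 < e / 2 by rewrite divr_gt0.
have [A hA] := h _ e2; have [A' hA'] := h' _ e2.
exists (A ++ A') => B uB AB.
have /(hA B uB) h1 : {subset A <= B} by move=> x xA; apply: AB; rewrite mem_cat xA.
have /(hA' B uB) h2 : {subset A' <= B}.
  by move=> x xA; apply: AB; rewrite mem_cat xA orbT.
rewrite big_split/= opprD addrACA.
apply: (le_lt_trans (nmD _ _)); lra.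
Qed.

Lemma hasSumZ (I : eqType) (f : I -> C) c s :
  hasSum f s -> hasSum (fun i => c * f i) (c * s).
Proof.
move=> h e e0; have c1 : 0 < nm c + 1 by rewrite ltr_wpDl ?nm_ge0.
have [|A hA] := h (e / (nm c + 1)); first by rewrite divr_gt0.
exists A => B uB AB; rewrite -mulr_sumr -mulrBr nmM.
have := hA B uB AB; rewrite ltr_pdivlMr// => hh.
apply: le_lt_trans hh; rewrite mulrC ler_wpM2l ?nm_ge0//; lra.
Qed.

Lemma hasSum_reindex (I J : eqType) (h : J -> I) (f : I -> C) s :
  injective h -> (forall i, f i != 0 -> exists j, h j = i) ->
  hasSum (f \o h) s -> hasSum f s.
Proof.
move=> hi hs H e e0; have [A hA] := H e e0; exists (map h A) => B uB AB.
pose g (i : I) : option J :=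
  if pselect (exists j, h j = i) is left p then Some (projT1 (cid p)) else None.
have gK : ocancel g h.
  by move=> i; rewrite /g; case: pselect => //= p; case: cid.
have gh j : g (h j) = Some j.
  rewrite /g; case: pselect => [p|[]]; last by exists j.
  by case: cid => j' /= /hi ->.
have uB' : uniq (pmap g B) by exact: (pmap_uniq gK).
have -> : \sum_(i <- B) f i = \sum_(j <- pmap g B) f (h j).
  elim: B {uB AB uB'} => [|i B ih]; first by rewrite !big_nil.
  rewrite big_cons ih /=; case Egi : (g i) => [j|] /=.
    by rewrite big_cons; have := gK i; rewrite Egi /= => ->.
  have [-> |fi] := eqVneq (f i) 0; first by rewrite add0r.
  by have [j hj] := hs _ fi; rewrite -hj gh in Egi.
apply: hA => // j jA; rewrite mem_pmap -gh.
by apply: map_f; apply: AB; exact: map_f.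
Qed.

Lemma sum_subset (I : eqType) (u : I -> R) (B D : seq I) :
  (forall i, 0 <= u i) -> uniq B -> uniq D -> {subset B <= D} ->
  \sum_(i <- B) u i <= \sum_(i <- D) u i.
Proof.
move=> u0 uB uD BD; rewrite [X in _ <= X](bigID (mem B))/= -[X in X <= _]addr0.
apply: lerD; last by exact: sumr_ge0.
rewrite -[X in _ <= X]big_filter (perm_big [seq i <- D | i \in B])//=.
apply: uniq_perm; rewrite ?filter_uniq// => i; rewrite mem_filter.
by case: (boolP (i \in B)) => //= /BD ->.
Qed.

Lemma hasSum_nonneg (I : eqType) (u : I -> R) (M : R) :
  (forall i, 0 <= u i) -> (forall B, uniq B -> \sum_(i <- B) u i <= M) ->
  exists s, hasSum (fun i => (u i)%:C) s.
Proof.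
move=> u0 uM; pose E : set R := [set x | exists2 B : seq I, uniq B & x = \sum_(i <- B) u i]%classic.
have hE : has_sup E.
  split; first by exists 0, [::] => //; rewrite big_nil.
  by exists M => _ [B uB ->]; exact: uM.
exists (sup E)%:C => e e0.
have [_ [A uA ->] hA] := sup_adherent e0 hE.
exists A => B uB AB.
have h1 : \sum_(i <- B) u i <= sup E by apply: ub_le_sup; [exact: hE.2|exists B].
have h2 := sum_subset u0 uA uB AB.
rewrite -rmorph_sum -rmorphB nm_real distrC ger0_norm ?subr_ge0//=.
rewrite ltrBlDr; rewrite ltrBlDr in hA; apply: (lt_le_trans hA); rewrite addrC; lra.
Qed.

(** Real and imaginary parts are split into positive and negative parts, each of which converges to
    the supremum of its finite sums. *)
Lemma asum_hasSum (I : eqType) (f : I -> C) : asum f -> exists s, hasSum f s.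
Proof.
move=> [M hM].
have H (v : I -> R) : (forall i, `|v i| <= nm (f i)) ->
    exists s, hasSum (fun i => (v i)%:C) s.
  move=> hv.
  have bnd (w : I -> R) : (forall i, w i <= nm (f i)) ->
      forall B, uniq B -> \sum_(i <- B) w i <= M.
    by move=> wf B uB; apply: le_trans (hM B uB); exact: ler_sum.
  have [s1 h1] : exists s, hasSum (fun i => (Num.max (v i) 0)%:C) s.
    apply: (hasSum_nonneg (M := M)) => [i|]; first by rewrite le_max lexx orbT.
    by apply: bnd => i; rewrite ge_max nm_ge0 (le_trans (ler_norm _)).
  have [s2 h2] : exists s, hasSum (fun i => (Num.max (- v i) 0)%:C) s.
    apply: (hasSum_nonneg (M := M)) => [i|]; first by rewrite le_max lexx orbT.
    apply: bnd => i; rewrite ge_max nm_ge0 (le_trans (ler_norm _))//.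
    by rewrite normrN.
  exists (s1 + -1 * s2); have := hasSumD h1 (hasSumZ (-1) h2).
  apply: eq_hasSum => i; rewrite mulN1r -rmorphB/=; congr (_%:C).
  by case: (leP (v i) 0) => h; case: (leP (- v i) 0) => h'; lra.
have [s1 h1] := H (fun i => complex.Re (f i)) (fun i => nm_Re _).
have [s2 h2] := H (fun i => complex.Im (f i)) (fun i => nm_Im _).
exists (s1 + 'i * s2); have := hasSumD h1 (hasSumZ 'i h2).
by apply: eq_hasSum => i; rewrite [RHS]complexE.
Qed.

(** Fubini for unordered sums. Over a finite list [B] every fibre is truncated with the tolerance
    [d], so that all truncation errors together stay below e/2. *)
Lemma hasSum_fiber (I J : eqType) (F : I * J -> C) (G : I -> C) s :
  hasSum F s -> (forall i, hasSum (fun j => F (i, j)) (G i)) -> hasSum G s.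
Proof.
move=> hF hG e e0; have e2 : 0 < e / 2 by rewrite divr_gt0.
have [A hA] := hF _ e2; exists (undup (map fst A)) => B uB AB.
pose d := e / 2 / (size B).+1%:R; have d0 : 0 < d by rewrite divr_gt0.
have /choice [Jf hJ] : forall i, exists D : seq J, forall D', uniq D' ->
    {subset D <= D'} -> nm (\sum_(j <- D') F (i, j) - G i) < d.
  by move=> i; exact: hG.
pose K i := undup (Jf i ++ map snd A).
pose B2 := [seq (i, j) | i <- B, j <- K i].
have uB2 : uniq B2.
  by apply: allpairs_uniq_dep => // [i _|[i j] [i' j'] _ _ /= [-> ->]//]; exact: undup_uniq.
have AB2 : {subset A <= B2}.
  move=> [i j] ijA; apply/allpairsPdep; exists i, j; split => //.
    by apply: AB; rewrite mem_undup; apply/mapP; exists (i, j).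
  by rewrite mem_undup mem_cat; apply/orP; right; apply/mapP; exists (i, j).
have := hA B2 uB2 AB2; rewrite big_allpairs_dep => h.
apply: (le_lt_trans (nm_triangle (\sum_(i <- B) \sum_(j <- K i) F (i, j)) _ _)).
suff : nm (\sum_(i <- B) G i - \sum_(i <- B) \sum_(j <- K i) F (i, j)) <= e / 2 by lra.
rewrite -sumrB; apply: (le_trans (nm_sum _ _ _)).
have : \sum_(i <- B) nm (G i - \sum_(j <- K i) F (i, j)) <= \sum_(i <- B) d.
  apply: ler_sum => i _; rewrite nm_distC ltW// hJ ?undup_uniq// => j jJ.
  by rewrite mem_undup mem_cat jJ.
move=> /le_trans; apply; rewrite big_const_seq count_predT iter_addr_0.
rewrite -[X in X <= _]mulr_natr /d -[X in X <= _]mulrA.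
apply: ler_piMr; first by rewrite divr_ge0// ltW.
by rewrite mulrC ler_pdivrMr// mul1r ler_nat leqnSn.
Qed.

Lemma asum_prod (I J : eqType) (f : I -> C) (g : J -> C) :
  asum f -> asum g -> asum (fun p : I * J => f p.1 * g p.2).
Proof.
move=> [M hM] [M' hM']; exists (M * M') => B uB.
pose B1 := undup (map fst B); pose B2 := undup (map snd B).
have : \sum_(i <- B) nm (f i.1 * g i.2) <=
    \sum_(i <- [seq (x, y) | x <- B1, y <- B2]) nm (f i.1 * g i.2).
  apply: sum_subset => // [i||[x y] xyB]; first exact: nm_ge0.
    by apply: allpairs_uniq; rewrite ?undup_uniq// => -[? ?] [? ?] _ _ /= [-> ->].
  apply/allpairsP; exists (x, y) => /=; rewrite !mem_undup; split => //.
    by apply/mapP; exists (x, y).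
  by apply/mapP; exists (x, y).
move=> /le_trans; apply; rewrite big_allpairs_dep/=.
under eq_bigr do under eq_bigr do rewrite nmM.
under eq_bigr do rewrite -mulr_sumr.
rewrite -mulr_suml; apply: ler_pM; rewrite ?sumr_ge0 ?hM ?hM' ?undup_uniq// => *; exact: nm_ge0.
Qed.

Lemma hasSum_prod (I J : eqType) (f : I -> C) (g : J -> C) s s' :
  asum f -> asum g -> hasSum f s -> hasSum g s' ->
  hasSum (fun p : I * J => f p.1 * g p.2) (s * s').
Proof.
move=> af ag hf hg; have [S hS] := asum_hasSum (asum_prod af ag).
suff -> : s * s' = S by [].
rewrite mulrC; apply: (@hasSum_unique _ (fun i => s' * f i)); first exact: hasSumZ.
apply: (hasSum_fiber hS) => i /=; rewrite mulrC.
exact: hasSumZ.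
Qed.

Lemma hasSum_fin (I : finType) (f : I -> C) : hasSum f (\sum_i f i).
Proof.
move=> e e0; exists (enum I) => B uB AB.
rewrite (perm_big (enum I)) ?big_enum/= ?subrr ?nm0//.
by apply: uniq_perm; rewrite ?enum_uniq// => i; rewrite mem_enum AB ?mem_enum.
Qed.

Lemma asum_reindex (I J : eqType) (h : J -> I) (f : I -> C) :
  injective h -> asum f -> asum (f \o h).
Proof.
move=> hi [M hM]; exists M => B uB; rewrite -(map_inj_uniq hi) in uB.
by have := hM _ uB; rewrite big_map.
Qed.

Lemma hasSum_ge0 (I : eqType) (f : I -> C) s (u : I -> R) i0 :
  (forall i, f i = (u i)%:C) -> (forall i, 0 <= u i) -> hasSum f s ->
  u i0 <= complex.Re s.
Proof.
move=> fu u0 h; rewrite leNgt; apply/negP => lt.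
have [|A hA] := h (u i0 - complex.Re s); first by rewrite subr_gt0.
have := hA (undup (i0 :: A)) (undup_uniq _).
move=> /(_ _)/wrap[x xA|]; first by rewrite mem_undup inE xA orbT.
move=> /(le_lt_trans (nm_Re _)); rewrite raddfB/= => hh.
have := le_lt_trans (ler_norm _) hh; rewrite ltrD2r ltNge => /negP; apply.
rewrite (eq_bigr _ (fun i _ => fu i)) -rmorph_sum/=.
have <- : \sum_(i <- [:: i0]) u i = u i0 by rewrite big_seq1.
apply: sum_subset => //; first exact: (undup_uniq (i0 :: A)).
by move=> x; rewrite inE => /eqP ->; rewrite -[X in _ \in X]/(undup (i0 :: A)) mem_undup inE eqxx.
Qed.

(** Weierstrass test: the tails of the majorant [b] control those of every [f x]. Two errors e/4
    bound the majorant outside [B] by e/2, and another e/4 serves to reach [s x]. *)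
Lemma hasSum_uniform (T : Type) (D : T -> Prop) (I : eqType) (f : T -> I -> C) (s : T -> C) (b : I -> C) :
  asum b -> (forall x, D x -> forall i, nm (f x i) <= nm (b i)) ->
  (forall x, D x -> hasSum (f x) (s x)) ->
  forall e : R, 0 < e -> exists A : seq I, forall B : seq I,
    uniq B -> {subset A <= B} -> forall x, D x -> nm (\sum_(i <- B) f x i - s x) <= e.
Proof.
move=> [M hM] fb hs e e0.
have [S hS] : exists s, hasSum (fun i => (nm (b i))%:C) s.
  by apply: (hasSum_nonneg (M := M)) => // i; exact: nm_ge0.
have e2 : 0 < e / 4 by rewrite divr_gt0.
have [A hA] := hS _ e2; exists A => B uB AB x Dx.
have [A' hA'] := hs x Dx _ e2.
pose B' := undup (B ++ A').
have uB' : uniq B' := undup_uniq _.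
have BB' : {subset B <= B'} by move=> i iB; rewrite mem_undup mem_cat iB.
have AB' : {subset A' <= B'} by move=> i iB; rewrite mem_undup mem_cat iB orbT.
have h1 := hA' B' uB' AB'.
have h2 := hA B uB AB.
have h3 := hA B' uB' (fun i h => BB' i (AB i h)).
have split_sum (V : zmodType) (u : I -> V) :
    \sum_(i <- B') u i = \sum_(i <- B) u i + \sum_(i <- B' | i \notin B) u i.
  rewrite (bigID (mem B) predT)/=; congr (_ + _).
  rewrite -big_filter; apply: perm_big; apply: uniq_perm; rewrite ?filter_uniq// => i.
  by rewrite mem_filter; case: (boolP (i \in B)) => //= /BB' ->.
have h4 : nm (\sum_(i <- B') f x i - \sum_(i <- B) f x i) <= e / 2.
  rewrite split_sum addrAC subrr add0r.
  apply: (le_trans (nm_sum _ _ _)).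
  apply: (@le_trans _ _ (\sum_(i <- B' | i \notin B) nm (b i))).
    by apply: ler_sum => i _; exact: fb.
  have E := split_sum _ (fun i => nm (b i)).
  move: h2 h3; rewrite -!rmorph_sum => h2 h3.
  have := nm_triangle S (\sum_(i <- B') nm (b i))%:C (\sum_(i <- B) nm (b i))%:C.
  rewrite -rmorphB nm_real /= (nm_distC S) => h5.
  have := ler_norm (\sum_(i <- B') nm (b i) - \sum_(i <- B) nm (b i)).
  rewrite E [X in X - _]addrC addrK in h5 *; move: h5 h2 h3.
  rewrite -E /=; lra.
apply: (le_trans (nm_triangle (\sum_(i <- B') f x i) _ _)).
rewrite nm_distC; lra.
Qed.

End Sums.

(** * The complex exponential *)

Section Cexp.
Context {R : realType}.
Implicit Types z w : R[i].

(* A locked copy of [cexp]: the latter is a product that unification unfolds. *)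
Definition expC : R[i] -> R[i] := locked (@cexp R).

Lemma cexpE z : cexp z = expC z.
Proof. by rewrite /expC -lock. Qed.

Lemma expCD z w : expC (z + w) = expC z * expC w.
Proof.
case: z w => [a b] [c d]; rewrite -!cexpE /cexp /= expRD cosD sinD.
by apply/eqP; rewrite eq_complex /=; apply/andP; split; apply/eqP; ring.
Qed.

Lemma expC_real (x : R) : expC x%:C = (expR x)%:C.
Proof. by rewrite -cexpE /cexp /= cos0 sin0; apply/eqP; rewrite eq_complex /= !mulr0 !mulr1 ?mul0r ?subr0 ?addr0 !eqxx. Qed.

Lemma expC0 : expC (0 : R[i]) = 1.
Proof. by rewrite -[0]/((0 : R)%:C) expC_real expR0. Qed.

Lemma nm_expC z : nm (expC z) = expR (complex.Re z).
Proof.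
rewrite -cexpE nmM nm_real ger0_norm ?expR_ge0//.
by rewrite /nm normc_def/= cos2Dsin2 sqrtr1 mulr1.
Qed.

Lemma expC_neq0 z : expC z != 0.
Proof. by rewrite -nm_eq0 nm_expC gt_eqF// expR_gt0. Qed.

Lemma expCN z : expC (- z) = (expC z)^-1.
Proof.
apply: (mulfI (expC_neq0 z)); rewrite -expCD subrr expC0 divff//.
exact: expC_neq0.
Qed.

Lemma expC_conj z : (expC z)^* = expC z^*.
Proof.
case: z => a b; rewrite -!cexpE /cexp /= cosN sinN.
by apply/eqP; rewrite eq_complex /= !mul0r ?subr0 ?addr0 ?mulrN !eqxx.
Qed.

Lemma piiE : PI R * iC R = 0 +i* pi.
Proof.
by rewrite /PI /iC; apply/eqP; rewrite eq_complex /= !mulr0 !mul0r !mulr1 ?subr0 ?add0r ?addr0 !eqxx.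
Qed.

Lemma expC_pii : expC (PI R * iC R) = -1.
Proof.
rewrite piiE -cexpE /cexp /= expR0 cospi sinpi.
by apply/eqP; rewrite eq_complex /= !mul1r ?mul0r ?subr0 ?mulr0 ?add0r ?addr0 ?oppr0 !eqxx.
Qed.

Lemma expCMn z (n : nat) : expC (n%:R * z) = expC z ^+ n.
Proof.
elim: n => [|n ih]; first by rewrite mul0r expC0 expr0.
by rewrite -natr1 mulrDl mul1r expCD ih exprSr.
Qed.

Lemma expCMz z (n : int) : expC (n%:~R * z) = expC z ^ n.
Proof.
case: n => n; first exact: expCMn.
by rewrite NegzE mulrNz mulNr expCN -exprnN -expCMn.
Qed.

Lemma signz_expC (n : int) : (-1) ^ n = expC (n%:~R * (PI R * iC R)).
Proof. by rewrite expCMz expC_pii. Qed.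

End Cexp.

(** * Sums over the integers and Gaussian decay *)

Section IntSums.
Context {R : realType}.
Local Notation C := (R[i]).

(** The integers from -n to n, listed so that k and -k are adjacent as in [zsum]; sums over it are
    the partial sums of that definition. *)
Definition zrange (n : nat) : seq int :=
  0 :: flatten [seq [:: Posz k.+1; - Posz k.+1] | k <- iota 0 n].

Lemma mem_zrange n (z : int) : (z \in zrange n) = (absz z <= n)%N.
Proof.
rewrite inE; apply/idP/idP => [/orP[/eqP -> //|]|].
  move=> /flatten_mapP [k]; rewrite mem_iota !inE => kn /orP[] /eqP ->; lia.
move=> h; case: eqP => //= z0; apply/flatten_mapP; exists (absz z).-1.
  rewrite mem_iota; lia.
by case: z z0 {h} => [[|m]|m] //= _; rewrite !inE ?NegzE eqxx ?orbT.
Qed.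

Lemma zrange_uniq n : uniq (zrange n).
Proof.
have zS k : zrange k.+1 = zrange k ++ [:: Posz k.+1; - Posz k.+1].
  by rewrite /zrange -[X in iota 0 X]addn1 iotaD map_cat add0n flatten_cat.
elim: n => // n ih; rewrite zS cat_uniq ih (has_cat _ [:: _]) !has_seq1 !mem_zrange /=; rewrite ?inE; lia.
Qed.

Lemma big_zrange (V : nmodType) (f : int -> V) n :
  \sum_(i <- zrange n) f i = f 0 + \sum_(k < n) (f (Posz k.+1) + f (- Posz k.+1)).
Proof.
rewrite big_cons big_flatten /= big_map -(big_mkord xpredT (fun k => f (Posz k.+1) + f (- Posz k.+1))).
rewrite /index_iota subn0; congr (_ + _); apply: eq_bigr => k _.
by rewrite big_cons big_seq1.
Qed.

Lemma sub_zrange (B : seq int) : exists n, {subset B <= zrange n}.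
Proof.
exists (\sum_(z <- B) absz z)%N => z zB; rewrite mem_zrange.
elim: B zB => // a B ih; rewrite inE big_cons => /orP[/eqP ->|/ih]; lia.
Qed.

Lemma zrangeS m n : (m <= n)%N -> {subset zrange m <= zrange n}.
Proof. by move=> mn z; rewrite !mem_zrange => /leq_trans; exact. Qed.

(** The symmetric partial sums defining [zsum] are cofinal in the net of finite lists, since every
    list lies in some [zrange n]. *)
Lemma hasSum_zsum (f : int -> C) s : hasSum f s -> zsum f = s.
Proof.
move=> hf; rewrite /zsum.
set g := fun k : nat => f (Posz k.+1) + f (- Posz k.+1).
have cv (e : R) : 0 < e -> \forall n \near eventually, nm (\sum_(k < n) g k - (s - f 0)) < e.
  move=> e0; have [A hA] := hf e e0; have [n0 hn0] := sub_zrange A.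
  exists n0 => // n /= nn.
  have := hA (zrange n) (zrange_uniq n) (fun i h => zrangeS nn (hn0 i h)).
  by rewrite big_zrange -/g opprB addrA [\sum_(k < n) _ + _]addrC.
have cvRI (P : C -> R) (Padd : {morph P : x y / x + y}) (P0 : P 0 = 0)
    (PB : {morph P : x y / x - y}) (Ple : forall z, `|P z| <= nm z) :
    rseries (fun k => P (g k)) = P (s - f 0).
  rewrite /rseries; apply/cvg_lim => //; apply/cvgrPdist_lt => e e0.
  have := cv e e0; apply: filterS => n hn.
  have -> : series (fun k => P (g k)) n = P (\sum_(k < n) g k).
    by rewrite seriesEord (big_morph P Padd P0).
  by rewrite -PB; apply: (le_lt_trans (Ple _)); rewrite nm_distC.
rewrite (cvRI (@complex.Re R)) ?(cvRI (@complex.Im R)) //.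
- rewrite -[RHS](subrK (f 0)) addrC; congr (_ + _).
  by case: (s - f 0).
- by move=> x y; rewrite raddfD.
- by move=> x y; rewrite raddfB.
- exact: nm_Im.
- by move=> x y; rewrite raddfD.
- by move=> x y; rewrite raddfB.
- exact: nm_Re.
Qed.

Lemma asum_geom (f : int -> C) (c r : R) : 0 <= c -> 0 <= r < 1 ->
  (forall n, nm (f n) <= c * r ^+ absz n) -> asum f.
Proof.
move=> c0 /andP[r0 r1] hf; exists (c * (1 + 2 * (1 - r)^-1)) => B uB.
have [n hn] := sub_zrange B.
have h1 : \sum_(i <- B) nm (f i) <= \sum_(i <- zrange n) nm (f i).
  by apply: sum_subset => //; [move=> i; exact: nm_ge0|exact: zrange_uniq].
apply: (le_trans h1).
apply: (@le_trans _ _ (\sum_(i <- zrange n) c * r ^+ absz i)); first exact: ler_sum.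
rewrite -mulr_sumr ler_wpM2l// big_zrange expr0 lerD2l.
under eq_bigr do rewrite abszN -mulr2n -mulr_natl.
rewrite -mulr_sumr ler_wpM2l//.
under eq_bigr do rewrite exprS.
rewrite -mulr_sumr.
have := subrX1 r n => /(congr1 (fun x => - x)); rewrite opprB -mulNr opprB => E.
have r1' : 0 < 1 - r by rewrite subr_gt0.
rewrite -[X in _ <= X]mul1r ler_pdivlMr// -mulrA [_ * (1 - r)]mulrC -E.
apply: mulr_ile1 => //; [|exact: ltW|by rewrite gerBl exprn_ge0].
by rewrite subr_ge0 exprn_ile1// ltW.
Qed.

(** With b = |be| and y = |n|, completing the square bounds -al y^2 + b y + y by (b + 1)^2 / (4 al),
    so the Gaussian lies below a geometric series of ratio 1/e. *)
Lemma asum_gauss (f : int -> C) (c al be : R) : 0 < al -> 0 <= c ->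
  (forall n, nm (f n) <= c * expR (- al * n%:~R ^+ 2 + be * n%:~R)) -> asum f.
Proof.
move=> al0 c0 hf.
apply: (@asum_geom _ (c * expR ((`|be| + 1) ^+ 2 / (4 * al))) (expR (-1))).
- by rewrite mulr_ge0// expR_ge0.
- by rewrite expR_ge0 -[X in _ < X]expR0 ltr_expR ltrN10.
move=> n; apply: (le_trans (hf n)); rewrite -mulrA ler_wpM2l//.
rewrite -expRM_natl -expRD ler_expR.
have -> : ((absz n)%:R : R) = `|n%:~R|.
  by rewrite -intr_norm -natr_absz.
set x : R := n%:~R.
have h1 : be * x <= `|be| * `|x| by rewrite -normrM ler_norm.
have -> : x ^+ 2 = `|x| ^+ 2 by rewrite real_normK ?num_real.
set y := `|x| in h1 *; set b := `|be| in h1 *.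
suff : - al * y ^+ 2 + b * y + y <= (b + 1) ^+ 2 / (4 * al) by lra.
rewrite ler_pdivlMr ?mulr_gt0//.
have : 0 <= (2 * al * y - (b + 1)) ^+ 2 by exact: sqr_ge0.
nra.
Qed.

Lemma asum_finpair (I : finType) (J : eqType) (F : I * J -> C) :
  (forall i, asum (fun j => F (i, j))) -> asum F.
Proof.
move=> /choice[M hM]; exists (\sum_i M i) => B uB.
have : \sum_(p <- B) nm (F p) <=
    \sum_(p <- [seq (i, j) | i <- enum I, j <- undup (map snd B)]) nm (F p).
  apply: sum_subset => // [p||[i j] ijB]; first exact: nm_ge0.
    apply: allpairs_uniq; rewrite ?enum_uniq ?undup_uniq//.
    by move=> [? ?] [? ?] _ _ /= [-> ->].
  apply/allpairsP; exists (i, j); rewrite mem_enum mem_undup; split => //.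
  by apply/mapP; exists (i, j).
move=> /le_trans; apply; rewrite big_allpairs_dep big_enum/=.
by apply: ler_sum => i _; exact/hM/undup_uniq.
Qed.

End IntSums.

(** * Theta functions of level p *)

Section ThetaClass.
Context {R : realType}.
Local Notation C := (R[i]).
Implicit Types (t : R) (m x : C) (k n r : int).

Definition ee k x : C := expC (k%:~R * (PI R * iC R) * x).

(* [expC (lq t)] is the nome q_0 at tau = i t. *)
Definition lq t : C := (- (pi * t))%:C.

(* The entire functions f with f(x + 2) = f(x) and
   f(x + tau) = e^{-m} q_0^{-p} e^{-2 pi i p x} f(x), tau = i t, in terms of their
   Fourier coefficients; they form a space of dimension 2p. *)
Definition thcl t (p : nat) m (f : C -> C) := exists a : int -> C,
  (forall k, a (k + (2 * p)%:Z) = expC (m + lq t * (k + p%:Z)%:~R) * a k) /\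
  (forall x, hasSum (fun k => a k * ee k x) (f x)).

Lemma eeD k k' x : ee (k + k') x = ee k x * ee k' x.
Proof. by rewrite -expCD; congr expC; rewrite intrD; ring. Qed.

(** The exponent telescopes along a residue class: (r + 2pn) + p is the difference of consecutive
    values of nr + pn^2. Hence the coefficients are Gaussian in n. *)
Lemma rec_solve t p m (a : int -> C) :
  (forall k, a (k + (2 * p)%:Z) = expC (m + lq t * (k + p%:Z)%:~R) * a k) ->
  forall r n, a (r + (2 * p)%:Z * n) =
    expC (n%:~R * m + lq t * (n * r + p%:Z * n ^+ 2)%:~R) * a r.
Proof.
move=> ha r; apply: int_rect => [|n ih|n ih].
- rewrite mulr0 addr0 [X in expC X](_ : _ = 0) ?expC0 ?mul1r//; ring.
- have -> : r + (2 * p)%:Z * n.+1 = (r + (2 * p)%:Z * n) + (2 * p)%:Z by lia.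
  rewrite ha ih [LHS]mulrA -expCD; congr (expC _ * _).
  have -> : n.+1%:Z = n%:Z + 1 by lia.
  have -> : (2 * p)%:Z = 2 * p%:Z by lia.
  rewrite !(intrD, intrM, rmorphXn)/=; ring.
- apply: (mulfI (expC_neq0 (m + lq t * (r + (2 * p)%:Z * - n.+1%:Z + p%:Z)%:~R))).
  rewrite -ha.
  have -> : r + (2 * p)%:Z * - n.+1%:Z + (2 * p)%:Z = r + (2 * p)%:Z * - n%:Z by lia.
  rewrite ih [RHS]mulrA -expCD; congr (expC _ * _).
  have -> : n.+1%:Z = n%:Z + 1 by lia.
  have -> : (2 * p)%:Z = 2 * p%:Z by lia.
  rewrite !(intrD, intrM, rmorphXn, mulrNz)/=; ring.
Qed.

Lemma Re_intM k (z : C) : complex.Re (k%:~R * z) = k%:~R * complex.Re z.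
Proof.
rewrite mulrzl raddfMz/= mulrzl//.
Qed.

Lemma Re_lqM t k : complex.Re (lq t * k%:~R) = - (pi * t) * k%:~R.
Proof. by rewrite mulrC Re_intM mulrC. Qed.

Lemma gauss_asum t p m (r : int) x (f : int -> C) (c : C) : 0 < t -> (0 < p)%N ->
  (forall n, nm (f n) <= nm (c * expC (n%:~R * m + lq t * (n * r + p%:Z * n ^+ 2)%:~R) * ee (r + (2 * p)%:Z * n) x)) -> asum f.
Proof.
move=> t0 p0 hf.
pose P := complex.Re (PI R * iC R * x).
apply: (@asum_gauss _ f (nm c * expR (r%:~R * P)) (pi * t * p%:R)
  (complex.Re m - pi * t * r%:~R + (2 * p)%:R * P)).
- by rewrite !mulr_gt0 ?pi_gt0// ltr0n.
- by rewrite mulr_ge0 ?nm_ge0 ?expR_ge0.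
have eeP k : complex.Re (k%:~R * (PI R * iC R) * x) = k%:~R * P.
  by rewrite -mulrA Re_intM.
move=> n; apply: (le_trans (hf n)); rewrite /ee !nmM !nm_expC.
rewrite -[X in X <= _]mulrA -[X in _ <= X]mulrA ler_wpM2l ?nm_ge0//.
rewrite -!expRD ler_expR eeP raddfD/= Re_lqM Re_intM.
rewrite !(intrD, intrM, rmorphXn)/= le_eqVlt; apply/orP; left; apply/eqP.
have -> : ((2 * p)%:Z)%:~R = 2 * p%:R :> R by rewrite -natrM.
have -> : (p%:Z)%:~R = p%:R :> R by [].
rewrite natrM; ring.
Qed.

Lemma int_div_inj p : (0 < p)%N -> injective (fun k : int => ((inord (absz (k %% p)%Z) : 'I_p.-1.+1), (k %/ p)%Z)).
Proof.
move=> p0 k k' [h1 h2]; have p0' : p%:Z != 0 by lia.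
rewrite (divz_eq k p) (divz_eq k' p) h2; congr (_ + _).
have b z : (absz (z %% p)%Z < p)%N.
  have := modz_ge0 z p0'; have := ltz_mod z p0'; lia.
have := congr1 (@nat_of_ord _) h1; rewrite !inordK ?prednK// => h.
have := modz_ge0 k p0'; have := modz_ge0 k' p0'; lia.
Qed.

(** Each of the 2p residue classes carries a Gaussian series, and there are finitely many
    classes. *)
Lemma rec_asum t p m (a : int -> C) x : 0 < t -> (0 < p)%N ->
  (forall k, a (k + (2 * p)%:Z) = expC (m + lq t * (k + p%:Z)%:~R) * a k) ->
  asum (fun k => a k * ee k x).
Proof.
move=> t0 p0 ha; have q0 : (0 < 2 * p)%N by lia.
pose h := (fun k : int => ((inord (absz (k %% (2 * p)%N)%Z) : 'I_(2 * p).-1.+1), (k %/ (2 * p)%N)%Z)).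
pose F := fun ij : 'I_(2 * p).-1.+1 * int => let k := ij.1%:Z + (2 * p)%:Z * ij.2 in a k * ee k x.
apply: (@eq_asum _ _ (F \o h)).
  move=> k /=; have qn : (2 * p)%:Z != 0 by lia.
  rewrite /F/h/= inordK; last first.
    rewrite prednK//; have := modz_ge0 k qn; have := ltz_mod k qn; lia.
  have -> : (absz (k %% (2 * p)%N)%Z)%:Z + (2 * p)%:Z * (k %/ (2 * p)%N)%Z = k; last by [].
  have := divz_eq k (2 * p)%N; have := modz_ge0 k qn; lia.
apply: asum_reindex; first exact: int_div_inj.
apply: asum_finpair => r.
apply: (@gauss_asum t p m r x _ (a r)) => // n.
by rewrite /F/= (rec_solve ha) [a r * _]mulrC.
Qed.

Lemma thcl_eqm t p m m' (f : C -> C) : expC m = expC m' -> thcl t p m f -> thcl t p m' f.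
Proof.
by move=> mm [a [ha hf]]; exists a; split => // k; rewrite ha !expCD mm.
Qed.

Lemma thcl_ext t p m (f g : C -> C) : f =1 g -> thcl t p m f -> thcl t p m g.
Proof. by move=> /funext ->. Qed.

Lemma thclZ t p m c (f : C -> C) : thcl t p m f -> thcl t p m (fun x => c * f x).
Proof.
move=> [a [ha hf]]; exists (fun k => c * a k); split => [k|x].
  by rewrite ha mulrCA.
by apply: eq_hasSum (hasSumZ c (hf x)) => k; rewrite mulrA.
Qed.

(** The coefficients of the product are convolutions of a and b. Replacing k by k + 2p + 2p' and n
    by n + 2p multiplies the term a(n) b(k - n) by a factor in which n cancels, and this factor is
    that of level p + p'. *)
Lemma thclM t p p' m m' (f g : C -> C) : 0 < t -> (0 < p)%N -> (0 < p')%N ->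
  thcl t p m f -> thcl t p' m' g -> thcl t (p + p') (m + m') (fun x => f x * g x).
Proof.
move=> t0 p0 p0' [a [ha hf]] [b [hb hg]].
have aa x : asum (fun k => a k * ee k x) := rec_asum x t0 p0 ha.
have ab x : asum (fun k => b k * ee k x) := rec_asum x t0 p0' hb.
(* Pairs of frequencies are indexed by their total k first, so that the fibres of the double series
   are the convolution sums. *)
pose h := fun kn : int * int => (kn.2, kn.1 - kn.2).
have hK : cancel (fun ij : int * int => (ij.1 + ij.2, ij.1)) h.
  by move=> [i j] /=; rewrite /h/=; congr (_, _); ring.
have hi : injective h by move=> [i j] [i' j'] [-> /addIr ->].
pose F x (ij : int * int) := a ij.1 * ee ij.1 x * (b ij.2 * ee ij.2 x).
have aF x : asum (F x \o h).
  exact (asum_reindex hi (asum_prod (aa x) (ab x))).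
have hF x : hasSum (F x \o h) (f x * g x).
  have [S hS] := asum_hasSum (aF x).
  have hS' : hasSum (F x) S.
    by refine (@hasSum_reindex _ _ _ h _ _ hi _ hS) => -[i j] _; exists (i + j, i); rewrite (hK (i, j)).
  by rewrite (hasSum_unique (hasSum_prod (aa x) (ab x) (hf x) (hg x)) hS').
have ee0 k : ee k 0 = 1 by rewrite /ee mulr0 expC0.
have /choice[c hc] : forall k, exists s, hasSum (fun n => a n * b (k - n)) s.
  move=> k; apply: asum_hasSum.
  have ik : injective (fun n => (k, n) : int * int) by move=> ? ? [].
  apply: eq_asum (asum_reindex ik (aF 0)) => n.
  by rewrite /F/= !ee0 !mulr1.
exists c; split => [k|x].
  apply: (hasSum_unique (hc _)).
  have ip : injective (fun n : int => n + (2 * p)%:Z) by move=> ? ? /addIr.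
  apply: (hasSum_reindex ip) => [n _|].
    by exists (n - (2 * p)%:Z); rewrite subrK.
  apply: eq_hasSum (hasSumZ _ (hc k)) => n /=.
  rewrite ha.
  have -> : k + (2 * (p + p'))%:Z - (n + (2 * p)%:Z) = (k - n) + (2 * p')%:Z by lia.
  rewrite hb mulrACA -expCD; congr (expC _ * _).
  have -> : (p + p')%:Z = p%:Z + p'%:Z by lia.
  rewrite !(intrD, mulrNz); ring.
apply: (hasSum_fiber (hF x)) => k /=.
rewrite mulrC; apply: eq_hasSum (hasSumZ _ (hc k)) => n /=.
rewrite /F/= mulrACA [RHS]mulrC -eeD.
by have -> : n + (k - n) = k by ring.
Qed.

End ThetaClass.

(** * Theta series supported on one residue class, and the four Jacobi functions *)

Section Theta.
Context {R : realType}.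
Local Notation C := (R[i]).
Implicit Types (t : R) (m x b : C) (k n r kap : int).
Local Notation pii := (PI R * iC R).

Lemma eeN k x : ee k (- x) = ee (- k) x.
Proof. by rewrite /ee; congr expC; rewrite mulrNz; ring. Qed.

Lemma ee_addx k x b : ee k (x + b) = ee k x * ee k b.
Proof. by rewrite /ee -expCD; congr expC; ring. Qed.

(** The solution of the recurrence supported on kap + 2pZ, normalised so that the frequency k
    carries the power k^2/(4p) of the nome. *)
Definition Thterm t (p : nat) m kap x n : C :=
  expC (n%:~R * m + lq t * (kap + (2 * p)%:Z * n)%:~R ^+ 2 / (4 * p)%:R)
  * ee (kap + (2 * p)%:Z * n) x.

Definition Th t (p : nat) m kap x : C := zsum (Thterm t p m kap x).

Lemma Thterm_rec t p m kap x n : (0 < p)%N -> Thterm t p m kap x n =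
  expC (lq t * kap%:~R ^+ 2 / (4 * p)%:R) *
  expC (n%:~R * m + lq t * (n * kap + p%:Z * n ^+ 2)%:~R) * ee (kap + (2 * p)%:Z * n) x.
Proof.
move=> p0; rewrite /Thterm -expCD; congr (expC _ * _).
have p0' : p%:R != 0 :> C by rewrite pnatr_eq0 -lt0n.
have -> : (2 * p)%:Z = 2 * p%:Z by lia.
rewrite !(intrD, intrM, rmorphXn)/= natrM; field.
by rewrite p0'.
Qed.

Lemma asum_Th t p m kap x : 0 < t -> (0 < p)%N -> asum (Thterm t p m kap x).
Proof.
move=> t0 p0; apply: (@gauss_asum _ t p m kap x _ (expC (lq t * kap%:~R ^+ 2 / (4 * p)%:R))) => // n.
by rewrite Thterm_rec.
Qed.

Lemma hasSum_Th t p m kap x : 0 < t -> (0 < p)%N -> hasSum (Thterm t p m kap x) (Th t p m kap x).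
Proof.
move=> t0 p0; have [s hs] := asum_hasSum (asum_Th m kap x t0 p0).
by rewrite /Th (hasSum_zsum hs).
Qed.

(** Reflection sends n to -n and thus e^{nm} to e^{-nm}; the condition on [m], met by 0 and by pi i,
    makes the two equal. *)
Lemma Th_neg t p m kap x : 0 < t -> (0 < p)%N -> expC m = expC (- m) ->
  Th t p m kap (- x) = Th t p m (- kap) x.
Proof.
move=> t0 p0 hm; apply: hasSum_unique (hasSum_Th m (- kap) x t0 p0).
apply: (@hasSum_reindex _ _ _ (fun n : int => - n)) => [? ? /oppr_inj//|n _|].
  by exists (- n); rewrite opprK.
apply: eq_hasSum (hasSum_Th m kap (- x) t0 p0) => n.
rewrite /Thterm/= eeN.
have -> : - kap + (2 * p)%:Z * - n = - (kap + (2 * p)%:Z * n) by ring.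
rewrite !mulrNz sqrrN; congr (_ * _); rewrite !expCD; congr (_ * _).
by rewrite mulNr -mulrN !expCMz hm.
Qed.

Lemma Th_shift t p m kap x : 0 < t -> (0 < p)%N ->
  Th t p m (kap + (2 * p)%:Z) x = expC (- m) * Th t p m kap x.
Proof.
move=> t0 p0; apply: hasSum_unique (hasSumZ _ (hasSum_Th m kap x t0 p0)).
apply: (@hasSum_reindex _ _ _ (fun n : int => n + 1)) => [? ? /addIr//|n _|].
  by exists (n - 1); rewrite subrK.
apply: eq_hasSum (hasSum_Th m _ x t0 p0) => n.
rewrite /Thterm/= mulrA -expCD.
have -> : kap + (2 * p)%:Z + (2 * p)%:Z * n = kap + (2 * p)%:Z * (n + 1) by ring.
congr (expC _ * _); rewrite (intrD _ n); ring.
Qed.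

Lemma Th_add1 t p m kap x : 0 < t -> (0 < p)%N ->
  Th t p m kap (x + 1) = (-1) ^ kap * Th t p m kap x.
Proof.
move=> t0 p0; apply: hasSum_unique (hasSumZ _ (hasSum_Th m kap x t0 p0)).
apply: eq_hasSum (hasSum_Th m _ _ t0 p0) => n.
rewrite /Thterm/= [RHS]mulrCA; congr (_ * _); rewrite ee_addx mulrC; congr (_ * _).
rewrite /ee mulr1 -signz_expC expfzDr ?oppr_eq0 ?oner_eq0//.
by rewrite PoszM -mulrA -exprz_exp -[X in X ^ (p%:Z * n)]/((-1) ^+ 2) sqrrN expr1n exp1rz mulr1.
Qed.

Lemma Thterm_1 t m kap x n : Thterm t 1 m kap x n =
  expC (n%:~R * m + lq t * ((kap%:~R / 2 + n%:~R) ^+ 2) + (kap%:~R + 2 * n%:~R) * pii * x).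
Proof.
rewrite /Thterm /ee -expCD; congr expC; rewrite !(intrD, intrM)/=.
have -> : (4 * 1)%N = 4%N by []. 
field; rewrite ?pnatr_eq0 //.
Qed.

Lemma lqE t : PI R * iC R * (0 +i* t) = lq t.
Proof.
rewrite piiE /lq; apply/eqP; rewrite eq_complex /=.
by rewrite !mul0r !mulr0 ?sub0r ?add0r ?addr0 !eqxx.
Qed.

(** All four Jacobi functions are level one series: [m] is pi i when the signs alternate and 0
    otherwise, [kap] is -1 for half-integral indices and 0 for integral ones. *)
Lemma theta0E v t : theta0 v (0 +i* t) = Th t 1 pii 0 v.
Proof.
rewrite /theta0 /Th; congr zsum; apply/funext => n.
rewrite Thterm_1 cexpE signz_expC -expCD lqE; congr expC; ring.
Qed.

Lemma theta1E v t : theta1 v (0 +i* t) = iC R * Th t 1 pii (- 1) v.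
Proof.
rewrite /theta1 /Th; congr (_ * zsum _); apply/funext => n.
rewrite Thterm_1 cexpE signz_expC -expCD lqE; congr expC; rewrite mulrNz; field; rewrite ?pnatr_eq0 //.
Qed.

Lemma theta2E v t : theta2 v (0 +i* t) = Th t 1 0 (- 1) v.
Proof.
rewrite /theta2 /Th; congr (zsum _); apply/funext => n.
rewrite Thterm_1 cexpE lqE; congr expC; rewrite mulrNz; field; rewrite ?pnatr_eq0 //.
Qed.

Lemma theta3E v t : theta3 v (0 +i* t) = Th t 1 0 0 v.
Proof.
rewrite /theta3 /Th; congr zsum; apply/funext => n.
rewrite Thterm_1 cexpE lqE; congr expC; ring.
Qed.

Lemma expC_piiN : expC pii = expC (- pii).
Proof. by rewrite expCN expC_pii invrN invr1. Qed.

Lemma theta1_odd v t : 0 < t -> theta1 (- v) (0 +i* t) = - theta1 v (0 +i* t).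
Proof.
move=> t0; rewrite !theta1E Th_neg//; last exact: expC_piiN.
have -> : - (-1) = -1 + (2 * 1)%:Z by [].
by rewrite Th_shift// -expC_piiN expC_pii mulN1r mulrN.
Qed.

Lemma theta1_add1 v t : 0 < t -> theta1 (v + 1) (0 +i* t) = - theta1 v (0 +i* t).
Proof. by move=> t0; rewrite !theta1E Th_add1// mulrCA -exprz_inv invrN invr1 expr1z mulN1r. Qed.

Lemma theta0_even v t : 0 < t -> theta0 (- v) (0 +i* t) = theta0 v (0 +i* t).
Proof. by move=> t0; rewrite !theta0E Th_neg ?oppr0//; exact: expC_piiN. Qed.

Lemma theta0_add1 v t : 0 < t -> theta0 (v + 1) (0 +i* t) = theta0 v (0 +i* t).
Proof. by move=> t0; rewrite !theta0E Th_add1// expr0z mul1r. Qed.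

Lemma theta3_add1 v t : 0 < t -> theta3 (v + 1) (0 +i* t) = theta3 v (0 +i* t).
Proof. by move=> t0; rewrite !theta3E Th_add1// expr0z mul1r. Qed.

(** The dilation multiplies frequencies by c, so the step n -> n + s moves them by 2cs; the relation
    between t and t' makes the change of the coefficients under this step the recurrence of level cs
    at t. *)
Lemma thcl_Th t t' m kap b (c s : nat) : 0 < t -> 0 < t' -> (0 < c)%N -> (0 < s)%N ->
  t' * s%:R = t * c%:R ->
  thcl t (c * s) (s%:R * m + (2 * s)%:R * pii * b) (fun x => Th t' 1 m kap (c%:R * x + b)).
Proof.
move=> t0 t0' c0 s0 tts.
pose A n := expC (n%:~R * m + lq t' * ((kap%:~R / 2 + n%:~R) ^+ 2) + (kap%:~R + 2 * n%:~R) * pii * b).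
pose h n : int := c%:Z * (kap + 2 * n).
have h_inj : injective h by rewrite /h => n n' /= hh; nia.
pose P k := pselect (exists n, h n = k).
pose a k : C := if P k is left p then A (projT1 (cid p)) else 0.
have aA n : a (h n) = A n.
  rewrite /a; case: (P _) => [p|[]]; last by exists n.
  by case: cid => /= n' /h_inj ->.
have aN k : ~ (exists n, h n = k) -> a k = 0.
  by rewrite /a; case: (P k).
have hs n : h n + (2 * (c * s))%:Z = h (n + s%:Z) by rewrite /h; lia.
have ha k : a (k + (2 * (c * s))%:Z) =
    expC (s%:R * m + (2 * s)%:R * pii * b + lq t * (k + (c * s)%:Z)%:~R) * a k.
  have [[n <-]|hk] := pselect (exists n, h n = k); last first.
    rewrite (aN k)// aN ?mulr0// => -[n hn]; apply: hk; exists (n - s%:Z).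
    by apply: (addIr (2 * (c * s))%:Z); rewrite hs -hn subrK.
  rewrite hs !aA /A -expCD; congr expC.
  have e1 : lq t' * s%:R = lq t * c%:R.
    rewrite /lq -!(rmorph_nat (real_complex R)) -!rmorphM/=; congr (_%:C).
    by rewrite !mulNr -!mulrA tts.
  rewrite /h !(intrD, intrM)/=.
  have -> : ((c * s)%:Z)%:~R = c%:R * s%:R :> C by rewrite -natrM.
  have -> : (s%:Z)%:~R = s%:R :> C by [].
  have -> : (c%:Z)%:~R = c%:R :> C by [].
  have e2 (y : C) : lq t * (c%:R * y + c%:R * s%:R) = lq t' * s%:R * (y + s%:R).
    by rewrite e1; ring.
  rewrite e2 natrM; field; rewrite ?pnatr_eq0 //.
have hf x : hasSum (fun k => a k * ee k x) (Th t' 1 m kap (c%:R * x + b)).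
  apply: (hasSum_reindex h_inj) => [k|].
    have [//|hk] := pselect (exists n, h n = k).
    by rewrite aN// mul0r eqxx.
  apply: eq_hasSum (hasSum_Th m kap (c%:R * x + b) t0' (ltn0Sn 0)) => n /=.
  rewrite aA Thterm_1 /A /ee -expCD; congr expC.
  rewrite /h !(intrD, intrM)/=.
  have -> : (c%:Z)%:~R = c%:R :> C by [].
  ring.
by exists a.
Qed.

(** The coefficients at 0, ..., 2p - 1 determine all others, and each residue class reproduces one
    [Th] up to the normalising power of the nome. *)
Lemma thcl_decomp t p m (f : C -> C) : 0 < t -> (0 < p)%N -> thcl t p m f ->
  exists c : 'I_(2 * p).-1.+1 -> C, forall x,
    f x = \sum_r c r * Th t p m (r : nat)%:Z x.
Proof.
move=> t0 p0 [a [ha hf]]; have q0 : (0 < 2 * p)%N by lia.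
exists (fun r : 'I_(2 * p).-1.+1 => a (r : nat)%:Z * expC (- (lq t * (r : nat)%:Z%:~R ^+ 2 / (4 * p)%:R))) => x.
pose h := (fun k : int => ((inord (absz (k %% (2 * p)%N)%Z) : 'I_(2 * p).-1.+1), (k %/ (2 * p)%N)%Z)).
pose F := fun ij : 'I_(2 * p).-1.+1 * int => let k := (ij.1 : nat)%:Z + (2 * p)%:Z * ij.2 in a k * ee k x.
have qn : (2 * p)%:Z != 0 by lia.
have hF : hasSum F (f x).
  apply: (@hasSum_reindex _ _ _ h).
  - exact: int_div_inj.
  - move=> [r n] _; exists ((r : nat)%:Z + (2 * p)%:Z * n); rewrite /h.
    have rl : (r < 2 * p)%N by rewrite -[X in (_ < X)%N](prednK q0).
    rewrite [X in (X %% _)%Z]addrC [X in (X %/ _)%Z]addrC [(2 * p)%:Z * n]mulrC.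
    rewrite divzMDl// modzMDl divz_small; last by rewrite /=; lia.
    rewrite addr0 modz_small/=; last by rewrite /=; lia.
    by rewrite inord_val.
  apply: eq_hasSum (hf x) => k /=.
  rewrite /F/h/= inordK; last first.
    rewrite prednK//; have := modz_ge0 k qn; have := ltz_mod k qn; lia.
  have -> : (absz (k %% (2 * p)%N)%Z)%:Z + (2 * p)%:Z * (k %/ (2 * p)%N)%Z = k; last by [].
  have := divz_eq k (2 * p)%N; have := modz_ge0 k qn; lia.
apply: (hasSum_unique _ (hasSum_fin _)).
apply: (hasSum_fiber hF) => r.
apply: eq_hasSum (hasSumZ _ (hasSum_Th m (r : nat)%:Z x t0 p0)) => n.
rewrite /F/= (rec_solve ha) Thterm_rec//.
have cancel4 (u e1 e2 e3 w : C) : e1 * e2 = 1 -> u * e1 * (e2 * e3 * w) = e3 * u * w.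
  by move=> e12; rewrite -[RHS]mul1r -e12; ring.
by apply: cancel4; rewrite -expCD addNr expC0.
Qed.

End Theta.

(** * The functions M_j and the space they span *)

Section RootData.
Context {R : realType}.
Local Notation C := (R[i]).
Implicit Types (t : R) (x : C) (r : rsys) (N : nat).
Local Notation pii := (PI R * iC R).

(** The multiplier exponent of the class containing the M_j: e^m = -1 for the two types whose M_j
    are made of theta_1. *)
Definition mR r : C := match r with RB | RBv => pii | _ => 0 end.

(** Parity under x -> -x; the value 0 switches off the reflected term in type A. *)
Definition sgR r : C := match r with RA => 0 | RD => 1 | _ => -1 end.

(* The frequencies [kapR r N j = 2 J(j+1) - calN r N] of the Fourier modes of [Mb]. *)
Definition kap0 r N : int := match r with
  | RA => 1 - N%:Z | RB => 1 - (2 * N)%:Z | RBv | RC => - (2 * N)%:Z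
  | RCv | RBC => 1 - (2 * N)%:Z | RD => 2 - (2 * N)%:Z end.

Definition kapR r N (j : nat) : int := kap0 r N + (2 * j)%:Z.

(* The paper's M_{j+1} (at x = z/L), up to the constant factor exhibited in [MfE]. *)
Definition Mb r N t (j : nat) x : C :=
  Th t (calN r N) (mR r) (kapR r N j) x + sgR r * Th t (calN r N) (mR r) (kapR r N j) (- x).

Definition valid r N := (0 < N)%N /\ (r = RD -> (1 < N)%N).

Lemma calN_gt0 r N : valid r N -> (0 < calN r N)%N.
Proof. by case: r => -[N0 ND] /=; try lia; have := ND erefl; lia. Qed.

Lemma mR_N r : expC (mR r) = expC (- mR r).
Proof. by case: r; rewrite /mR ?oppr0 //; exact: expC_piiN. Qed.

Lemma kapRE r N (j : nat) : valid r N ->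
  (kapR r N j)%:~R = 2 * (Jf R r j.+1)%:C - (calN r N)%:R :> C.
Proof.
case=> N0 ND; rewrite -(rmorph_int (real_complex R)) -(rmorph_nat (real_complex R) 2).
rewrite -(rmorph_nat (real_complex R) (calN r N)) -rmorphM -rmorphB/=; congr (_%:C).
rewrite /kapR /kap0 /Jf -natr1; case: r ND => ND; rewrite /calN !(intrD, mulrNz, PoszM)/=.
- by rewrite intrM/=; lra.
- rewrite natrB ?natrM; last lia. by rewrite !intrM/=; lra.
- by rewrite natrM !intrM/=; lra.
- by rewrite natrM natrD !intrM/=; lra.
- by rewrite natrM !intrM/=; lra.
- by rewrite natrD natrM !intrM/=; lra.
- rewrite natrM natrB; last exact: N0. by rewrite !intrM/=; lra.
Qed.

(** The prefactor shifts the frequencies p(2n - 1) by 2J, which gives 2pn + (2J - p); completing the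
    square in the exponent of the nome leaves the constant q_0^{-J^2/p}. *)
Lemma Mpart (t J : R) (p : nat) m kap x : 0 < t -> (0 < p)%N ->
  kap%:~R = 2 * J%:C - p%:R :> C ->
  expC (2 * pii * J%:C * x) * Th (p%:R * t) 1 m (- 1) (J%:C * (0 +i* t) + p%:R * x) =
  expC (- (lq t * J%:C ^+ 2 / p%:R)) * Th t p m kap x.
Proof.
move=> t0 p0 hk.
have pt0 : 0 < p%:R * t by rewrite mulr_gt0// ltr0n.
apply: (hasSum_unique (hasSumZ _ (hasSum_Th m (- 1) _ pt0 (ltn0Sn 0)))).
apply: eq_hasSum (hasSumZ _ (hasSum_Th m kap x t0 p0)) => n.
rewrite Thterm_1 /Thterm /ee mulrA -!expCD; congr expC.
have -> : lq (p%:R * t) = p%:R * lq t.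
  by rewrite /lq -(rmorph_nat (real_complex R)) -rmorphM/=; congr (_%:C); ring.
have pn0 : p%:R != 0 :> C by rewrite pnatr_eq0 -lt0n.
have -> : (2 * p)%:Z = 2%:Z * p%:Z by lia.
rewrite intrD hk !intrM natrM mulrNz/= -lqE.
by field; rewrite pn0.
Qed.

Lemma tau_mul t (p : nat) : p%:R * (0 +i* t) = 0 +i* (p%:R * t) :> C.
Proof.
rewrite -(rmorph_nat (real_complex R)); apply/eqP; rewrite eq_complex /=.
by rewrite mulr0 !mul0r subr0 addr0 !eqxx.
Qed.

Definition cM r : C := match r with RB | RBv => iC R | _ => 1 end.

Lemma MfE r N (L W : R) (j : nat) (z : C) : 0 < L -> 0 < W -> valid r N ->
  Mf r N L W j.+1 z = cM r * expC (- (lq (W / L) * (Jf R r j.+1)%:C ^+ 2 / (calN r N)%:R))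
    * Mb r N (W / L) j (z / L%:C).
Proof.
move=> L0 W0 v; have t0 : 0 < W / L by rewrite divr_gt0.
have p0 := calN_gt0 v; have hk := kapRE j v.
have MP m x := Mpart m x t0 p0 hk.
rewrite /Mf /tauLW tau_mul /Mb !cexpE.
set J := (Jf R r j.+1)%:C in hk MP *.
have E1 : 2 * PI R * iC R * J * z / L%:C = 2 * pii * J * (z / L%:C) by ring.
have E2 : - (2 * PI R * iC R * J * z / L%:C) = 2 * pii * J * (- (z / L%:C)) by ring.
have E3 : (calN r N)%:R * z / L%:C = (calN r N)%:R * (z / L%:C) by rewrite mulrA.
have E4 : - ((calN r N)%:R * z / L%:C) = (calN r N)%:R * (- (z / L%:C)) by rewrite mulrN mulrA.
rewrite E2 E1 E4 E3.
clearbody J; case: r v p0 hk MP E1 E2 E3 E4 => v p0 hk MP _ _ _ _;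
  rewrite ?theta1E ?theta2E ?(mulrCA (expC _) (iC R)) !MP /cM /sgR /mR; ring.
Qed.

Definition inspan r N t (f : C -> C) :=
  exists c : 'I_N -> C, forall x, f x = \sum_j c j * Mb r N t j x.

Lemma inspanD r N t f g : inspan r N t f -> inspan r N t g ->
  inspan r N t (fun x => f x + g x).
Proof.
move=> [c hc] [d hd]; exists (fun j => c j + d j) => x.
by rewrite hc hd -big_split; apply: eq_bigr => j _; rewrite mulrDl.
Qed.

Lemma inspanZ r N t a f : inspan r N t f -> inspan r N t (fun x => a * f x).
Proof.
move=> [c hc]; exists (fun j => a * c j) => x.
by rewrite hc mulr_sumr; apply: eq_bigr => j _; rewrite mulrA.
Qed.

Lemma inspan0 r N t : inspan r N t (fun=> 0).
Proof. by exists (fun=> 0) => x; rewrite big1// => j _; rewrite mul0r. Qed.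

Lemma inspan_sum r N t (I : Type) (s : seq I) (F : I -> C -> C) :
  (forall i, inspan r N t (F i)) -> inspan r N t (fun x => \sum_(i <- s) F i x).
Proof.
move=> hF; elim: s => [|i s ih].
  by under [X in inspan _ _ _ X]funext => x do rewrite big_nil; exact: inspan0.
under [X in inspan _ _ _ X]funext => x do rewrite big_cons.
exact: inspanD.
Qed.

Definition Sk r N t (kap : int) x : C :=
  Th t (calN r N) (mR r) kap x + sgR r * Th t (calN r N) (mR r) kap (- x).

Lemma inspan_Sk_base r N t (u : int) : 0 <= u < N%:Z ->
  inspan r N t (Sk r N t (kap0 r N + 2 * u)).
Proof.
move=> /andP[u0 uN]; have uN' : (absz u < N)%N by lia.
exists (fun j => (j == Ordinal uN')%:R) => x.
rewrite (bigD1 (Ordinal uN'))//= big1 ?addr0 => [|j /negPf ->]; last by rewrite mul0r.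
rewrite eqxx mul1r /Mb /Sk /kapR/=.
by have -> : kap0 r N + (2 * absz u)%N = kap0 r N + 2 * u by lia.
Qed.

(** A shift by 2p and, outside type A, a change of sign alter [Sk] only by a factor, so the
    frequency folds into [-p, 0]. The values of the right parity there that [kapR] misses are 0 for
    B_N^vee and C_N, and -p for C_N and BC_N; odd symmetrisation kills both. In type A one shift by
    2p already reaches the window from 1 - N to N - 1. *)
Lemma inspan_Sk r N t (n : nat) (u : int) : 0 < t -> valid r N ->
  (n < 2 * calN r N)%N -> n%:Z = kap0 r N + 2 * u -> inspan r N t (Sk r N t n%:Z).
Proof.
move=> t0 v nN nu; have p0 := calN_gt0 v.
have shiftE (kap : int) : inspan r N t (Sk r N t kap) ->
    inspan r N t (Sk r N t (kap + (2 * calN r N)%:Z)).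
  move=> /(inspanZ (expC (- mR r))) [c hc]; exists c => x; rewrite -hc /Sk.
  by rewrite !Th_shift//; ring.
have negE (kap : int) : r <> RA -> inspan r N t (Sk r N t kap) ->
    inspan r N t (Sk r N t (- kap)).
  move=> rA /(inspanZ (sgR r)) [c hc]; exists c => x; rewrite -hc /Sk.
  have s2 : sgR r * sgR r = 1 by case: r rA {v nN nu p0 shiftE c hc} => //= _; rewrite ?mul1r ?mulrNN ?mul1r.
  have e1 y : Th t (calN r N) (mR r) (- kap) y = Th t (calN r N) (mR r) kap (- y).
    by rewrite Th_neg//; exact: mR_N.
  by rewrite !e1 opprK [RHS]mulrDr (mulrA (sgR r) (sgR r)) s2 mul1r addrC.
have Sk0 : sgR r = -1 -> inspan r N t (Sk r N t 0).
  move=> s1; have [c hc] := inspan0 r N t; exists c => x; rewrite -hc /Sk s1.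
  rewrite Th_neg ?oppr0//; last exact: mR_N.
  by rewrite mulN1r subrr.
have SkN : sgR r = -1 -> mR r = 0 -> inspan r N t (Sk r N t (- (calN r N)%:Z)).
  move=> s1 m0; have [c hc] := inspan0 r N t; exists c => x; rewrite -hc /Sk s1.
  rewrite Th_neg//; last exact: mR_N.
  have -> : - - (calN r N)%:Z = - (calN r N)%:Z + (2 * calN r N)%:Z by lia.
  by rewrite Th_shift// m0 oppr0 expC0 mul1r mulN1r subrr.
have [rA|rA] := pselect (r = RA).
  have [nle|nle] := leqP n N.-1.
    rewrite nu; apply: inspan_Sk_base; subst r; rewrite /= in nu nN v *; case: v => v _; lia.
  have -> : n%:Z = (kap0 r N + 2 * (u - (calN r N)%:Z)) + (2 * calN r N)%:Z by rewrite nu; lia.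
  apply: shiftE; apply: inspan_Sk_base; subst r; rewrite /= in nu nN v *; case: v => v _; lia.
have Sneg (kap : int) (w : int) : - (calN r N)%:Z <= kap <= 0 -> kap = kap0 r N + 2 * w ->
    inspan r N t (Sk r N t kap).
  move=> kb kw; have [h|h] := boolP (0 <= w < N%:Z).
    by rewrite kw; exact: inspan_Sk_base.
  case: v => N0 ND; case: r rA ND nN nu p0 shiftE negE Sk0 SkN kb kw h => //= rA ND nN nu p0 shiftE negE Sk0 SkN kb kw h.
  - exfalso; lia.
  - have -> : kap = 0 by lia. exact: Sk0.
  - have [->|->] : kap = 0 \/ kap = - (2 * (N + 1))%N%:Z by lia.
      exact: Sk0.
    exact: SkN.
  - exfalso; lia.
  - have -> : kap = - (2 * N + 1)%N%:Z by lia. exact: SkN.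
  - have := ND erefl; exfalso; lia.
have kpar : exists w : int, - n%:Z = kap0 r N + 2 * w.
  exists (- (u + kap0 r N)); lia.
have [nle|nle] := leqP n (calN r N).
  have [w hw] := kpar; rewrite -[n%:Z]opprK; apply: negE => //.
  apply: (Sneg _ w) => //; lia.
have -> : n%:Z = (n%:Z - (2 * calN r N)%:Z) + (2 * calN r N)%:Z by lia.
apply: shiftE; apply: (Sneg _ (u - (calN r N)%:Z)); lia.
Qed.

(** Averaging f over x -> x + 1 with the sign removes the frequencies of the wrong parity; averaging
    over x -> -x turns each remaining [Th] into half of an [Sk]. *)
Lemma span_main r N t (f : C -> C) : 0 < t -> valid r N ->
  thcl t (calN r N) (mR r) f ->
  (forall x, f (x + 1) = (-1) ^ (kap0 r N) * f x) ->
  (r <> RA -> forall x, f (- x) = sgR r * f x) -> inspan r N t f.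
Proof.
move=> t0 v hf f1 fN; have p0 := calN_gt0 v.
have [c hc] := thcl_decomp t0 p0 hf.
(* Type A has no reflection average, hence no factor 1/2. *)
pose d : C := if r is RA then 1 else 2^-1.
have fE x : f x = \sum_n d * (c n * ((1 + (-1) ^ (kap0 r N) * (-1) ^ (n : nat)%:Z) / 2)) * Sk r N t (n : nat)%:Z x.
  have sgn2 (k : int) : (-1) ^ k * (-1) ^ k = 1 :> C.
    by rewrite -expfzMl mulrNN mulr1 exp1rz.
  have h1 y : f y = \sum_n (c n * ((1 + (-1) ^ (kap0 r N) * (-1) ^ (n : nat)%:Z) / 2)) * Th t (calN r N) (mR r) (n : nat)%:Z y.
    have -> : f y = (f y + (-1) ^ (kap0 r N) * f (y + 1)) / 2.
      by rewrite f1 mulrA sgn2 mul1r; field.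
    rewrite !hc mulr_sumr -big_split/= mulr_suml; apply: eq_bigr => n _.
    by rewrite Th_add1//; ring.
  have [rA|rA] := pselect (r = RA).
    rewrite h1; apply: eq_bigr => n _; subst r.
    by rewrite /d /Sk /= mul1r mul0r addr0.
  have -> : f x = d * (f x + sgR r * f (- x)).
    rewrite fN// mulrA; have -> : sgR r * sgR r = 1.
      by case: r rA {v hf f1 fN p0 c hc d h1} => //= _; rewrite ?mul1r ?mulrNN ?mul1r.
    by case: r rA @d {v hf f1 fN p0 c hc h1} => //= _; field.
  rewrite !h1 mulr_sumr -big_split/= mulr_sumr; apply: eq_bigr => n _.
  by rewrite /Sk; ring.
suff : inspan r N t (fun x => \sum_n d * (c n * ((1 + (-1) ^ (kap0 r N) * (-1) ^ (n : nat)%:Z) / 2)) * Sk r N t (n : nat)%:Z x).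
  by move=> [c' hc']; exists c' => x; rewrite fE hc'.
apply: inspan_sum => n.
have q0 : (0 < 2 * calN r N)%N by lia.
have nl : (n < 2 * calN r N)%N by rewrite -[X in (_ < X)%N](prednK q0).
pose w := (((n : nat)%:Z - kap0 r N) %/ 2)%Z.
have [hw|hw] : (n : nat)%:Z = kap0 r N + 2 * w \/ (n : nat)%:Z = kap0 r N + 2 * w + 1.
  have := divz_eq ((n : nat)%:Z - kap0 r N) 2; rewrite -/w.
  have := @modz_ge0 ((n : nat)%:Z - kap0 r N) 2 isT.
  have := @ltz_mod ((n : nat)%:Z - kap0 r N) 2 isT.
  lia.
  by apply: inspanZ; exact: (inspan_Sk t0 v nl hw).
have [c' hc'] := inspan0 r N t; exists c' => x; rewrite -hc'.
rewrite hw !expfzDr ?oppr_eq0 ?oner_eq0// -exprz_exp.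
rewrite -[(-1) ^ 2]/((-1) ^+ 2) sqrrN expr1n exp1rz mulr1 expr1z mulrN1 mulrN.
by rewrite -expfzMl mulrNN mulr1 exp1rz subrr mul0r mulr0 mulr0 mul0r.
Qed.

End RootData.

(** * Macdonald denominators as determinants *)

Section Denominators.
Context {R : realType}.
Local Notation C := (R[i]).
Implicit Types (t : R) (x b : C) (r : rsys) (N : nat) (xi : nat -> C).
Local Notation pii := (PI R * iC R).

(** The function whose squared modulus stands in [Qf]; in type A this includes the theta function of
    the sum. *)
Definition Wq r N xi (tau : C) : C :=
  match r with
  | RA => theta_s N (\sum_(k < N) xi k) tau * Wden RA N xi tau
  | _ => Wden r N xi tau
  end.

Lemma prod_lt_last n (f : nat -> nat -> C) :
  \prod_(j < n.+1) \prod_(k < n.+1 | (j < k)%N) f j k =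
  \prod_(j < n) \prod_(k < n | (j < k)%N) f j k * \prod_(j < n) f j n.
Proof.
rewrite big_ord_recr /= [X in _ * X]big_pred0 ?mulr1; last first.
  by move=> k; rewrite ltnNge -ltnS ltn_ord.
rewrite -big_split/=; apply: eq_bigr => j _.
by rewrite big_mkcond big_ord_recr/= -big_mkcond/= ltn_ord.
Qed.

Lemma upd_same xi n x : upd xi n x n = x.
Proof. by rewrite /upd eqxx. Qed.

Lemma upd_lt xi n x (j : nat) : (j < n)%N -> upd xi n x j = xi j.
Proof. by move=> jn; rewrite /upd ltn_eqF. Qed.

Lemma prod_lt_upd n xi x (f : C -> C -> C) :
  \prod_(j < n.+1) \prod_(k < n.+1 | (j < k)%N) f (upd xi n x j) (upd xi n x k) =
  \prod_(j < n) \prod_(k < n | (j < k)%N) f (xi j) (xi k) * \prod_(j < n) f (xi j) x.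
Proof.
rewrite (prod_lt_last n (fun j k => f (upd xi n x j) (upd xi n x k))) upd_same.
congr (_ * _); last by apply: eq_bigr => j _; rewrite upd_lt.
by apply: eq_bigr => j _; apply: eq_bigr => k _; rewrite !upd_lt.
Qed.

Lemma prod_upd n xi x (g : C -> C) :
  \prod_(l < n.+1) g (upd xi n x l) = \prod_(l < n) g (xi l) * g x.
Proof.
rewrite big_ord_recr/= upd_same; congr (_ * _).
by apply: eq_bigr => l _; rewrite upd_lt.
Qed.

Definition pairs (tau : C) (n : nat) xi x :=
  \prod_(j < n) (theta1 (x - xi j) tau * theta1 (x + xi j) tau).

Definition extra r (tau : C) x : C := match r with
  | RA | RD => 1
  | RB => theta1 x tau
  | RBv => theta1 (2%:R * x) (2%:R * tau)
  | RC => theta1 (2%:R * x) tau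
  | RCv => theta1 x (tau / 2%:R)
  | RBC => theta1 x tau * theta0 (2%:R * x) (2%:R * tau)
  end.

Lemma Wden_last r n xi x tau : r <> RA ->
  Wden r n.+1 (upd xi n x) tau = Wden r n xi tau * (extra r tau x * pairs tau n xi x).
Proof.
move=> rA; rewrite /Wden /Pden.
case: r rA => // _;
rewrite (prod_lt_upd n xi x (fun u v => theta1 (v - u) tau * theta1 (v + u) tau)).
- rewrite (prod_upd n xi x (fun u => theta1 u tau)) /extra /pairs; ring.
- rewrite (prod_upd n xi x (fun u => theta1 (2%:R * u) (2%:R * tau))) /extra /pairs; ring.
- rewrite (prod_upd n xi x (fun u => theta1 (2%:R * u) tau)) /extra /pairs; ring.
- rewrite (prod_upd n xi x (fun u => theta1 u (tau / 2%:R))) /extra /pairs; ring.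
- rewrite (prod_upd n xi x (fun u => theta1 u tau * theta0 (2%:R * u) (2%:R * tau))) /extra /pairs; ring.
- rewrite /extra /pairs; ring.
Qed.

Lemma tau2 t : 2%:R * (0 +i* t) = 0 +i* (2 * t) :> C.
Proof. exact: tau_mul. Qed.

Lemma tau_half t : (0 +i* t) / 2%:R = 0 +i* (t / 2) :> C.
Proof.
have n2 : 2%:R != 0 :> C by rewrite pnatr_eq0.
apply: (mulfI n2); rewrite tau2 mulrC divfK//; congr (_ +i* _); lra.
Qed.

Lemma theta1_thcl t b : 0 < t -> thcl t 1 (pii + 2 * pii * b) (fun x => theta1 (x + b) (0 +i* t)).
Proof.
move=> t0.
have := @thcl_Th _ t t pii (-1) b 1 1 t0 t0 isT isT erefl.
move=> /(thclZ (iC R)); rewrite !mul1r; apply: thcl_ext => x.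
by rewrite theta1E mul1r.
Qed.

(** The opposite shifts cancel in the multiplier and so do the two signs, so the class does not
    depend on b. *)
Lemma pair_thcl t b : 0 < t -> thcl t 2 0 (fun x => theta1 (x - b) (0 +i* t) * theta1 (x + b) (0 +i* t)).
Proof.
move=> t0; have := thclM t0 (ltn0Sn _) (ltn0Sn _) (theta1_thcl (- b) t0) (theta1_thcl b t0).
apply: thcl_eqm; have -> : pii + 2 * pii * - b + (pii + 2 * pii * b) = 2%:R * pii by ring.
by rewrite expCMn expC_pii sqrrN expr1n expC0.
Qed.

Lemma pairs_thcl t (p : nat) m (f : C -> C) n xi : 0 < t -> (0 < p)%N -> thcl t p m f ->
  thcl t (p + 2 * n) m (fun x => f x * pairs (0 +i* t) n xi x).
Proof.
move=> t0 p0; elim: n => [|n ih] hf.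
  by rewrite muln0 addn0; apply: thcl_ext hf => x; rewrite /pairs big_ord0 mulr1.
have -> : (p + 2 * n.+1 = (p + 2 * n) + 2)%N by lia.
rewrite -[m]addr0; have pn0 : (0 < p + 2 * n)%N by lia.
apply: thcl_ext (thclM t0 pn0 (ltn0Sn _) (ih hf) (pair_thcl (xi n) t0)) => x.
by rewrite /pairs big_ord_recr/= [RHS]mulrA.
Qed.

(** In type D_N no one-variable factor starts the induction; the first pair does, and it exists
    because N >= 2. *)
Lemma pairs_thcl0 t n xi : 0 < t -> (0 < n)%N ->
  thcl t (2 * n) 0 (fun x => pairs (0 +i* t) n xi x).
Proof.
move=> t0; case: n => // n _.
have := pairs_thcl n (fun j => xi j.+1) t0 (ltn0Sn _) (pair_thcl (xi 0) t0).
have -> : (2 + 2 * n = 2 * n.+1)%N by lia.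
by apply: thcl_ext => x; rewrite /pairs big_ord_recl.
Qed.

Lemma pairs_even t n xi x : 0 < t -> pairs (0 +i* t) n xi (- x) = pairs (0 +i* t) n xi x.
Proof.
move=> t0; apply: eq_bigr => j _.
have -> : - x - xi j = - (x + xi j) by ring.
have -> : - x + xi j = - (x - xi j) by ring.
by rewrite !theta1_odd// mulrNN mulrC.
Qed.

Lemma pairs_add1 t n xi x : 0 < t -> pairs (0 +i* t) n xi (x + 1) = pairs (0 +i* t) n xi x.
Proof.
move=> t0; apply: eq_bigr => j _; rewrite addrAC [x + 1 + _]addrAC.
by rewrite !theta1_add1// mulrNN.
Qed.

(** The level of [extra]. Outside type A it equals [calN r n.+1] minus 2n, as each of the n pairs
    has level 2. *)
Definition pex r : nat := match r with
  | RA | RD => 0 | RB => 1 | RBv | RCv => 2 | RC => 4 | RBC => 3 end.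

Lemma extra_thcl r t : 0 < t -> r <> RA -> r <> RD ->
  thcl t (pex r) (mR r) (extra r (0 +i* t)).
Proof.
move=> t0 rA rD.
have t2 : 0 < 2 * t by lra.
have th : 0 < t / 2 by lra.
have E (u : C) : u + 2 * pii * 0 = u by ring.
have h1 : thcl t 1 pii (fun x => theta1 x (0 +i* t)).
  have := theta1_thcl 0 t0; rewrite E; apply: thcl_ext => x; by rewrite addr0.
(* The pairs (c, s) are (2, 1) for 2x at 2 tau, (2, 2) for 2x at tau and (1, 2) for x at tau/2. *)
have scale (t' : R) (m : C) kap (c s : nat) : 0 < t' -> (0 < c)%N -> (0 < s)%N -> t' * s%:R = t * c%:R ->
    thcl t (c * s) (s%:R * m) (fun x => Th t' 1 m kap (c%:R * x)).
  move=> t0' c0 s0 hh; have := @thcl_Th _ t t' m kap 0 c s t0 t0' c0 s0 hh.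
  rewrite mulr0 addr0; apply: thcl_ext => x; by rewrite addr0.
case: r rA rD => // _ _; rewrite /pex /mR /extra ?tau2 ?tau_half.
- have hh : 2 * t * 1%:R = t * 2%:R by ring.
  have := scale (2 * t) pii (-1) 2%N 1%N t2 isT isT hh.
  rewrite mul1r => /(thclZ (iC R)); apply: thcl_ext => x; by rewrite theta1E.
- have := scale t pii (-1) 2%N 2%N t0 isT isT erefl.
  move=> /(thclZ (iC R)) h; apply: (@thcl_eqm _ _ _ (2%:R * pii)).
    by rewrite expCMn expC_pii sqrrN expr1n expC0.
  apply: thcl_ext h => x; by rewrite theta1E.
- have hh : t / 2 * 2%:R = t * 1%:R by lra.
  have := scale (t / 2) pii (-1) 1%N 2%N th isT isT hh.
  move=> /(thclZ (iC R)) h; apply: (@thcl_eqm _ _ _ (2%:R * pii)).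
    by rewrite expCMn expC_pii sqrrN expr1n expC0.
  apply: thcl_ext h => x; by rewrite theta1E mul1r.
- have hh : 2 * t * 1%:R = t * 2%:R by ring.
  have := scale (2 * t) pii 0 2%N 1%N t2 isT isT hh.
  rewrite mul1r => h2; apply: (@thcl_eqm _ _ _ (pii + pii)).
    by rewrite expCD expC_pii mulrNN mulr1 expC0.
  apply: thcl_ext (thclM t0 (ltn0Sn _) (ltn0Sn _) h1 h2) => x; by rewrite theta0E.
Qed.

Lemma extra_odd r t x : 0 < t -> r <> RA -> extra r (0 +i* t) (- x) = sgR r * extra r (0 +i* t) x.
Proof.
move=> t0 rA; have t2 : 0 < 2 * t by lra.
have th : 0 < t / 2 by lra.
case: r rA => // _; rewrite /extra /sgR ?mulrN ?tau2 ?tau_half ?theta1_odd ?theta0_even ?mul1r ?mulN1r//.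
by rewrite mulNr.
Qed.

Lemma extra_add1 r N t x : 0 < t -> r <> RA -> extra r (0 +i* t) (x + 1) = (-1) ^ (kap0 r N) * extra r (0 +i* t) x.
Proof.
move=> t0 rA; have t2 : 0 < 2 * t by lra.
have th : 0 < t / 2 by lra.
have ev (k : int) : (-1) ^ (2 * k) = 1 :> C.
  by rewrite -exprz_exp -[(-1) ^ 2]/((-1) ^+ 2) sqrrN expr1n exp1rz.
have od (k : int) : (-1) ^ (1 - 2 * k) = - 1 :> C.
  by rewrite expfzDr ?oppr_eq0 ?oner_eq0// -mulrN ev mulr1 expr1z.
have E : 2%:R * (x + 1) = 2%:R * x + 1 + 1 by ring.
case: r rA => // _; rewrite /extra /kap0 ?tau2 ?tau_half ?E ?theta1_add1 ?theta0_add1 ?opprK//.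
- by rewrite PoszM od mulN1r.
- by rewrite PoszM -mulrN ev mul1r.
- by rewrite PoszM -mulrN ev mul1r.
- by rewrite PoszM od mulN1r.
- by rewrite PoszM od mulN1r mulNr.
- have -> : 2 - (2 * N)%N%:Z = 2 * (1 - N%:Z) by lia.
  by rewrite ev mul1r.
Qed.

Lemma Wq_last_span r n t xi : 0 < t -> valid r n.+1 ->
  inspan r n.+1 t (fun x => Wq r n.+1 (upd xi n x) (0 +i* t)).
Proof.
move=> t0 v; have [rA|rA] := pselect (r = RA).
  subst r; pose b := \sum_(k < n) xi k.
  pose f x := theta_s n.+1 (x + b) (0 +i* t) * \prod_(j < n) theta1 (x - xi j) (0 +i* t).
  suff : inspan RA n.+1 t f.
    move=> /(inspanZ (\prod_(j < n) \prod_(k < n | (j < k)%N) theta1 (xi k - xi j) (0 +i* t))) [c hc].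
    exists c => x; rewrite -hc /Wq /Wden.
    rewrite (prod_lt_upd n xi x (fun u v => theta1 (v - u) (0 +i* t))).
    have -> : \sum_(k < n.+1) upd xi n x k = x + b.
      rewrite big_ord_recr/= upd_same addrC; congr (_ + _).
      by apply: eq_bigr => j _; rewrite upd_lt.
    by rewrite /f mulrCA.
  have prodh m0 p0 (g : C -> C) : (0 < p0)%N -> thcl t p0 m0 g -> forall k : nat,
      thcl t (p0 + k) (m0 + \sum_(j < k) (pii - 2 * pii * xi j))
       (fun x => g x * \prod_(j < k) theta1 (x - xi j) (0 +i* t)).
    move=> p00 hg; elim=> [|k ih].
      by rewrite big_ord0 addn0 addr0; apply: thcl_ext hg => x; rewrite big_ord0 mulr1.
    rewrite big_ord_recr/= addrA addnS -addn1.
    have pk : (0 < p0 + k)%N by lia.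
    have h := thclM t0 pk (ltn0Sn _) ih (theta1_thcl (- xi k) t0).
    have -> : pii - 2 * pii * xi k = pii + 2 * pii * - xi k by ring.
    by apply: thcl_ext h => x; rewrite big_ord_recr/= mulrA.
  have hs : thcl t 1 ((if odd n.+1 then 0 else pii) + 2 * pii * b)
      (fun x => theta_s n.+1 (x + b) (0 +i* t)).
    rewrite /theta_s; case: (odd _).
      have := @thcl_Th _ t t 0 0 b 1 1 t0 t0 isT isT erefl.
      by rewrite mul1r; apply: thcl_ext => x; rewrite theta3E mul1r.
    have := @thcl_Th _ t t pii 0 b 1 1 t0 t0 isT isT erefl.
    by rewrite mul1r; apply: thcl_ext => x; rewrite theta0E mul1r.
  apply: span_main => //.
    apply: (thcl_eqm _ (prodh _ _ _ (ltn0Sn _) hs n)).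
    (* The terms linear in the xi_j cancel because theta_s is taken at the sum of all variables. The
       rest counts alternating signs: n from the factors theta_1, and one more from theta_0 exactly
       when n + 1 is even. The total is always even, which is the reason for the choice of s(N). *)
    have -> : (if odd n.+1 then 0 else pii) + 2 * pii * b + \sum_(j < n) (pii - 2 * pii * xi j)
        = (n + ~~ odd n.+1)%:R * pii.
      rewrite sumrB sumr_const card_ord -mulr_sumr -/b natrD -(mulr_natl pii).
      by case: (odd n.+1) => /=; ring.
    rewrite expCMn expC_pii /mR expC0 -signr_odd oddD /=.
    by case: (odd n).
  move=> x; rewrite /f /kap0.
  have -> : x + 1 + b = (x + b) + 1 by ring.
  have -> : theta_s n.+1 (x + b + 1) (0 +i* t) = theta_s n.+1 (x + b) (0 +i* t).
    by rewrite /theta_s; case: (odd _); [exact: theta3_add1|exact: theta0_add1].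
  have -> : \prod_(j < n) theta1 (x + 1 - xi j) (0 +i* t) =
      (-1) ^+ n * \prod_(j < n) theta1 (x - xi j) (0 +i* t).
    transitivity (\prod_(j < n) (-1 * theta1 (x - xi j) (0 +i* t))).
      by apply: eq_bigr => j _; rewrite addrAC theta1_add1// mulN1r.
    by rewrite big_split/= prodr_const card_ord.
  have -> : 1 - n.+1%:Z = - n%:Z by lia.
  by rewrite mulrCA -exprz_inv invrN invr1.
have key : inspan r n.+1 t (fun x => extra r (0 +i* t) x * pairs (0 +i* t) n xi x).
  apply: span_main => //.
  - have [rD|rD] := pselect (r = RD).
      subst r; case: v => _ /(_ erefl) n0.
      rewrite /calN subSS subn0 /mR; apply: thcl_ext (pairs_thcl0 xi t0 n0) => x.
      by rewrite mul1r.
    have pp : (0 < pex r)%N by case: r rA rD {v} => //.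
    have -> : calN r n.+1 = (pex r + 2 * n)%N by case: r rA rD {v pp} => //= _ _; lia.
    by apply: pairs_thcl => //; exact: extra_thcl.
  - by move=> x; rewrite (extra_add1 n.+1)// pairs_add1// mulrA.
  - by move=> _ x; rewrite extra_odd// pairs_even// mulrA.
have [c hc] := inspanZ (Wden r n xi (0 +i* t)) key.
exists c => x; rewrite -hc -Wden_last// /Wq.
by case: r rA {v key c hc}.
Qed.

End Denominators.

(** * Alternating functions of several variables *)

Section Alternating.
Context {F : fieldType}.

Definition updo N (z : 'I_N -> F) (k : 'I_N) (x : F) : 'I_N -> F :=
  fun i => if i == k then x else z i.

(** A permutation permutes the two-element subsets; [h] sorts the image of a pair so that it
    represents a subset again. *)
Lemma prod_lt_sym (N : nat) (G : 'I_N -> 'I_N -> F) (s : 'S_N) :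
  (forall j k, G j k = G k j) ->
  \prod_(j < N) \prod_(k < N | (j < k)%N) G (s j) (s k) =
  \prod_(j < N) \prod_(k < N | (j < k)%N) G j k.
Proof.
move=> Gs; rewrite !pair_big_dep/=.
pose h (u : 'S_N) (p : 'I_N * 'I_N) :=
  if (u p.1 < u p.2)%N then (u p.1, u p.2) else (u p.2, u p.1).
have hK u (p : 'I_N * 'I_N) : (p.1 < p.2)%N -> h u (h (u^-1)%g p) = p.
  case: p => j k /= jk; rewrite {2}/h /=; case: ifP => _; rewrite /h/= !permKV.
    by rewrite jk.
  by rewrite ltnNge ltnW.
rewrite [RHS](reindex_onto (h s) (h (s^-1)%g))/=; last by move=> p; exact: hK.
apply: eq_big => [[j k]|[j k] /= jk]; last first.
  by rewrite /h/=; case: ifP => //= _; rewrite Gs.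
apply/idP/andP => /= [jk|[]].
  split; last by have := hK (s^-1)%g (j, k) jk; rewrite invgK => ->.
  rewrite /h/=; case: (ltngtP (s j) (s k)) => //= /ord_inj /perm_inj E.
  by rewrite E ltnn in jk.
case: (ltnP (s j) (s k)) => cmp; rewrite /h/= ?cmp ?(ltnNge (s j) (s k)) ?cmp /= !permK.
  by case: (ltnP j k) => // _ _ /eqP [E1 _]; rewrite E1 ltnn in cmp.
case: (ltngtP k j) => // [kj|E] lt; last first.
  by move: lt; rewrite (ord_inj E) ltnn.
by move=> /eqP [E1 _]; rewrite E1 ltnn in kj.
Qed.

(** Divided by the Vandermonde factors of the distinct points [a], the product has a symmetric pair
    factor; the sign is then that of a Vandermonde determinant whose columns are permuted. *)
Lemma prod_lt_antisym (N : nat) (a z : 'I_N -> F) (f : F -> F -> F) (s : 'S_N) :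
  injective a -> (forall u v, f v u = - f u v) ->
  \prod_(j < N) \prod_(k < N | (j < k)%N) f (z (s j)) (z (s k)) =
  (-1) ^+ s * \prod_(j < N) \prod_(k < N | (j < k)%N) f (z j) (z k).
Proof.
move=> ai fa.
pose V (b : 'I_N -> F) := \prod_(j < N) \prod_(k < N | (j < k)%N) (b k - b j).
have VE b : V b = \det (Vandermonde N (\row_j b j)).
  rewrite det_Vandermonde; apply: eq_bigr => j _; apply: eq_bigr => k _.
  by rewrite !mxE.
have Vs : V (a \o s) = (-1) ^+ s * V a.
  rewrite !VE.
  have -> : Vandermonde N (\row_j (a \o s) j) = col_perm s (Vandermonde N (\row_j a j)).
    by apply/matrixP => i j; rewrite !mxE.
  by rewrite col_permE det_mulmx det_perm odd_permV mulrC.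
pose G j k := f (z j) (z k) / (a k - a j).
have Gs j k : G j k = G k j.
  by rewrite /G fa -opprB invrN mulrNN.
have fG (u : 'I_N -> 'I_N) (ui : injective u) : \prod_(j < N) \prod_(k < N | (j < k)%N) f (z (u j)) (z (u k)) =
    \prod_(j < N) \prod_(k < N | (j < k)%N) G (u j) (u k) * V (a \o u).
  rewrite -big_split/=; apply: eq_bigr => j _.
  rewrite -big_split/=; apply: eq_bigr => k jk.
  rewrite /G divfK// subr_eq0; apply/eqP => /ai /ui E.
  by rewrite E ltnn in jk.
by rewrite (fG s perm_inj) (fG id (fun _ _ h => h)) Vs prod_lt_sym// mulrCA.
Qed.

(** Interpolation: the invertible matrix yields a Lagrange basis [l] at the nodes [x0], so in each
    variable H is determined by its values at the nodes. At configurations of nodes H vanishes, by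
    antisymmetry if a node repeats and by the value at [x0] otherwise. *)
Lemma alt_zero (N : nat) (phi : 'I_N -> F -> F) (x0 : 'I_N -> F) (H : ('I_N -> F) -> F) :
  2%:R != 0 :> F ->
  (\matrix_(i < N, j < N) phi j (x0 i)) \in unitmx ->
  (forall (s : 'S_N) z, H (z \o s) = (-1) ^+ s * H z) ->
  (forall z k, exists c : 'I_N -> F, forall x, H (updo z k x) = \sum_j c j * phi j x) ->
  H x0 = 0 -> forall z, H z = 0.
Proof.
move=> n2 uB Hs Hc H0.
set B := \matrix_(i, j) _ in uB.
pose l (i : 'I_N) x := \sum_j phi j x * (invmx B) j i.
have phiE j x : phi j x = \sum_i phi j (x0 i) * l i x.
  pose v := \row_j phi j x.
  have : v = v *m invmx B *m B by rewrite mulmxKV.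
  move=> /matrixP/(_ 0 j); rewrite !mxE => ->; apply: eq_bigr => i _.
  by rewrite !mxE mulrC; congr (_ * _); apply: eq_bigr => k _; rewrite !mxE.
have HE z k x : H (updo z k x) = \sum_i H (updo z k (x0 i)) * l i x.
  have [c hc] := Hc z k; rewrite hc.
  under [RHS]eq_bigr do rewrite hc mulr_suml.
  rewrite exchange_big/=; apply: eq_bigr => j _.
  rewrite [in LHS]phiE mulr_sumr; apply: eq_bigr => i _; by rewrite mulrA.
have H00 (s : 'I_N -> 'I_N) : H (x0 \o s) = 0.
  have [si|] := pselect (injective s).
    have -> : x0 \o s = x0 \o perm si by apply/funext => i /=; rewrite permE.
    by rewrite Hs H0 mulr0.
  move=> /injectiveP/injectivePn [i [j ij sij]].
  have : H ((x0 \o s) \o tperm i j) = - H (x0 \o s).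
    by rewrite Hs odd_tperm ij expr1 mulN1r.
  have -> : (x0 \o s) \o tperm i j = x0 \o s.
    by apply/funext => k /=; case: tpermP => [->|->|//]; rewrite sij.
  move=> /eqP; rewrite -subr_eq0 opprK -mulr2n -mulr_natr mulf_eq0 (negPf n2) orbF.
  by move=> /eqP.
(* Induction on the number m of leading variables that are still arbitrary. *)
have key m : (m <= N)%N -> forall z, (forall k : 'I_N, (m <= k)%N -> exists i, z k = x0 i) -> H z = 0.
  elim: m => [_ z hz|m ih mN z hz].
    have /choice[s hs] : forall k, exists i, z k = x0 i by move=> k; exact: hz.
    have -> : z = x0 \o s by apply/funext => k; rewrite hs.
    exact: H00.
  pose k0 := Ordinal mN.
  have -> : z = updo z k0 (z k0).
    by apply/funext => i; rewrite /updo; case: eqP => [->|].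
  rewrite HE big1// => i _; rewrite ih ?mul0r//; first exact: ltnW.
  move=> k mk; rewrite /updo; case: eqP => [_|/eqP kk0]; first by exists i.
  apply: hz; rewrite ltn_neqAle mk andbT; apply: contra kk0 => /eqP E.
  by apply/eqP/ord_inj.
move=> z; apply: (key N) => // k; by rewrite leqNgt ltn_ord.
Qed.

(** The combination W(z) D(x0) - W(x0) D(z) satisfies [alt_zero]; cofactor expansion along a row
    puts D in the span of the [phi j] in each variable. *)
Lemma alt_det (N : nat) (phi : 'I_N -> F -> F) (x0 : 'I_N -> F) (W : ('I_N -> F) -> F) :
  2%:R != 0 :> F ->
  \det (\matrix_(i < N, j < N) phi j (x0 i)) != 0 ->
  (forall (s : 'S_N) z, W (z \o s) = (-1) ^+ s * W z) ->
  (forall z k, exists c : 'I_N -> F, forall x, W (updo z k x) = \sum_j c j * phi j x) ->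
  exists c, forall z, W z = c * \det (\matrix_(i < N, j < N) phi j (z i)).
Proof.
move=> n2 d0 Ws Wc.
pose D z := \det (\matrix_(i < N, j < N) phi j (z i)).
exists (W x0 / D x0) => z; rewrite -/(D z).
pose H z := W z * D x0 - W x0 * D z.
have Ds (s : 'S_N) u : D (u \o s) = (-1) ^+ s * D u.
  rewrite /D -det_perm -det_mulmx -row_permE; congr (\det _).
  by apply/matrixP => i j; rewrite !mxE.
have Dc u k : exists c : 'I_N -> F, forall x, D (updo u k x) = \sum_j c j * phi j x.
  exists (fun j => cofactor (\matrix_(i < N, j < N) phi j (u i)) k j) => x.
  rewrite /D (expand_det_row _ k); apply: eq_bigr => j _.
  rewrite mxE /updo eqxx mulrC; congr (_ * _).
  rewrite /cofactor; congr (_ * \det _); apply/matrixP => i j'.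
  by rewrite !mxE eq_sym (negPf (neq_lift k i)).
have D0 : D x0 != 0 by [].
clearbody D.
suff : H z = 0.
  by rewrite /H => /subr0_eq E; rewrite mulrAC -E mulfK.
apply: (@alt_zero _ phi x0) => //.
- by rewrite unitmxE unitfE.
- by move=> s u; rewrite /H Ws Ds mulrBr -mulrA; congr (_ - _); rewrite mulrCA.
- move=> u k; have [c hc] := Wc u k; have [d hd] := Dc u k.
  exists (fun j => c j * D x0 - W x0 * d j) => x.
  rewrite /H hc hd mulr_suml mulr_sumr -sumrB; apply: eq_bigr => j _; ring.
- by rewrite /H mulrC subrr.
Qed.

End Alternating.

(** * Proportionality of the denominator and det M_j(z_k) *)

Section WDet.
Context {R : realType}.
Local Notation C := (R[i]).
Implicit Types (t : R) (r : rsys) (N : nat) (tau : C).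

Lemma extzE N (z : 'I_N -> C) (j : 'I_N) : extz z j = z j.
Proof. by rewrite /extz valK. Qed.

(** The symmetric factor of the denominator; what remains is a product of antisymmetric pair factors
    [Wpair], the shape that [prod_lt_antisym] handles. *)
Definition Wsym r N (z : 'I_N -> C) tau : C := match r with
  | RA => theta_s N (\sum_k z k) tau
  | _ => \prod_l extra r tau (z l) end.

Definition Wpair r tau (u v : C) : C := match r with
  | RA => theta1 (v - u) tau
  | _ => theta1 (v - u) tau * theta1 (v + u) tau end.

Lemma WqE_nat r N (xi : nat -> C) tau : Wq r N xi tau =
  Wsym r (fun j : 'I_N => xi j) tau *
  \prod_(j < N) \prod_(k < N | (j < k)%N) Wpair r tau (xi j) (xi k).
Proof.
case: r; [reflexivity|reflexivity|reflexivity|reflexivity|reflexivity|reflexivity|].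
by rewrite /Wsym big1 ?mul1r.
Qed.

Lemma WqE r N (z : 'I_N -> C) tau : Wq r N (extz z) tau =
  Wsym r z tau * \prod_(j < N) \prod_(k < N | (j < k)%N) Wpair r tau (z j) (z k).
Proof.
rewrite WqE_nat.
have -> : (fun j : 'I_N => extz z j) = z by apply/funext => j; rewrite extzE.
congr (_ * _).
by apply: eq_bigr => j _; apply: eq_bigr => k _; rewrite !extzE.
Qed.

Lemma Wq_extz r N (xi : nat -> C) tau :
  Wq r N xi tau = Wq r N (extz (fun j : 'I_N => xi j)) tau.
Proof. by rewrite WqE WqE_nat. Qed.

Lemma Wq_antisym r N t (z : 'I_N -> C) (s : 'S_N) : 0 < t ->
  Wq r N (extz (z \o s)) (0 +i* t) = (-1) ^+ s * Wq r N (extz z) (0 +i* t).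
Proof.
move=> t0; rewrite !WqE.
have ni : injective (fun j : 'I_N => (j : nat)%:R : C).
  by move=> j k /eqP; rewrite eqr_nat => /eqP /ord_inj.
have fa u v : Wpair r (0 +i* t) v u = - Wpair r (0 +i* t) u v.
  rewrite /Wpair; have -> : u - v = - (v - u) by rewrite opprB.
  by case: r; rewrite theta1_odd// (addrC u v) mulNr.
have tr (a b c d e : C) : a = c -> d = e * b -> a * d = e * (c * b).
  by move=> -> ->; rewrite mulrCA.
apply: tr; last exact: (prod_lt_antisym z s ni fa).
rewrite /Wsym; have E (f : C -> C) : \prod_l f ((z \o s) l) = \prod_l f (z l).
  by rewrite [RHS](reindex_inj (@perm_inj _ s)).
case: r {fa}; rewrite ?E//; congr (theta_s _ _ _).
by rewrite [RHS](reindex_inj (@perm_inj _ s)).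
Qed.

(** A transposition brings the variable k to the last place at the cost of a sign, where
    [Wq_last_span] applies. *)
Lemma Wq_span r N t (z : 'I_N -> C) (k : 'I_N) : 0 < t -> valid r N ->
  inspan r N t (fun x => Wq r N (extz (updo z k x)) (0 +i* t)).
Proof.
move=> t0; case: N z k => [|n] z k v; first by case: k.
pose s : 'S_n.+1 := tperm k ord_max; pose z' := z \o s.
have [c hc] := inspanZ ((-1) ^+ s) (Wq_last_span (extz z') t0 v).
exists c => x; rewrite -hc.
have -> : updo z k x = updo z' ord_max x \o s.
  apply/funext => i; rewrite /updo /z' /s /=.
  rewrite tpermK; congr (if _ then _ else _).
  by rewrite -[X in _ = (_ == X)](tpermL k ord_max) (inj_eq perm_inj).
rewrite Wq_antisym//.
have -> // : extz (updo z' ord_max x) = upd (extz z') n x.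
apply/funext => i; rewrite /upd /extz; case: insubP => /= [j jn ji|].
  rewrite -ji /updo -[X in (j == X :> nat)]/(nat_of_ord (@ord_max n)) val_eqE.
  by case: ifP => // _; rewrite valK.
by rewrite -leqNgt => ni; rewrite gtn_eqF//.
Qed.

Lemma Wq_det r N t (x0 : 'I_N -> C) : 0 < t -> valid r N ->
  \det (\matrix_(i < N, j < N) Mb r N t j (x0 i)) != 0 ->
  exists c, forall z : 'I_N -> C, Wq r N (extz z) (0 +i* t) =
    c * \det (\matrix_(i < N, j < N) Mb r N t j (z i)).
Proof.
move=> t0 v d0.
apply: (@alt_det _ N (fun j => Mb r N t j) x0 (fun z => Wq r N (extz z) (0 +i* t))) => //.
- by move=> s z; exact: Wq_antisym.
- by move=> z k; exact: Wq_span.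
Qed.

End WDet.

(** * Nonvanishing of the denominators *)

Section Nonvanishing.
Context {R : realType}.
Local Notation C := (R[i]).

Lemma exp_term_sum (x : R) (B : seq nat) : 0 <= x -> uniq B ->
  \sum_(j <- B) x ^+ j / j`!%:R <= expR x.
Proof.
move=> x0 uB; have u0 (j : nat) : 0 <= x ^+ j / j`!%:R by rewrite divr_ge0// exprn_ge0.
pose n := (\sum_(j <- B) j).+1.
have hB : {subset B <= index_iota 0 n}.
  move=> j jB; rewrite mem_index_iota /= /n ltnS.
  elim: B jB {uB n} => // a B ih; rewrite inE big_cons => /orP[/eqP ->|/ih]; lia.
apply: (le_trans (sum_subset u0 uB (iota_uniq _ _) hB)).
have : series (exp_coeff x) n <= limn (series (exp_coeff x)).
  apply: nondecreasing_cvgn_le; last exact: is_cvg_series_exp_coeff.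
  by apply: nondecreasing_series => j _ _; exact: u0.
by [].
Qed.

Lemma Re_mulr (z : C) (x : R) : complex.Re (z * x%:C) = complex.Re z * x.
Proof. by case: z => a b /=; rewrite mulr0 subr0. Qed.

Lemma Im_mulr (z : C) (x : R) : complex.Im (z * x%:C) = complex.Im z * x.
Proof. by case: z => a b /=; rewrite mulr0 add0r. Qed.

Lemma Re_sum (n : nat) (g : 'I_n -> C) :
  complex.Re (\sum_j g j) = \sum_j complex.Re (g j).
Proof. by rewrite raddf_sum. Qed.

Lemma Im_sum (n : nat) (g : 'I_n -> C) :
  complex.Im (\sum_j g j) = \sum_j complex.Im (g j).
Proof. by rewrite raddf_sum. Qed.

Lemma iX_Re (n : nat) : complex.Re (iC R ^+ n) = (~~ odd n)%:R * (-1) ^+ n./2.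
Proof.
rewrite -{1}(odd_double_half n) exprD -mul2n exprM sqr_i.
rewrite -(rmorphN1 (real_complex R)) -rmorphXn; case: (odd n) => /=.
  by rewrite ?expr1 /= !mul0r mul1r subr0.
by rewrite ?expr0 !mul1r mul0r subr0.
Qed.

Lemma iX_Im (n : nat) : complex.Im (iC R ^+ n) = (odd n)%:R * (-1) ^+ n.-1./2.
Proof.
rewrite -{1}(odd_double_half n) exprD -mul2n exprM sqr_i.
rewrite -(rmorphN1 (real_complex R)) -rmorphXn; case: (boolP (odd n)) => /= on.
  rewrite ?expr1 /= mul0r add0r !mul1r; congr (_ ^+ _); lia.
by rewrite ?expr0 !mul0r mulr0 add0r.
Qed.

(** [cexp] is built from [cos] and [sin], so the sum of the series is identified by comparing its
    real and imaginary parts with the series that define these two. *)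
Lemma expC_series (th : R) :
  hasSum (fun j : nat => (iC R * th%:C) ^+ j / j`!%:R) (expC (iC R * th%:C)).
Proof.
have tE (j : nat) : (iC R * th%:C) ^+ j / j`!%:R = iC R ^+ j * (th ^+ j / j`!%:R)%:C.
  by rewrite exprMn -mulrA rmorphM/= rmorphXn fmorphV rmorph_nat.
have [s hs] : exists s, hasSum (fun j : nat => (iC R * th%:C) ^+ j / j`!%:R) s.
  apply: asum_hasSum; exists (expR `|th|) => B uB.
  apply: le_trans (exp_term_sum (normr_ge0 th) uB); apply: ler_sum => j _.
  rewrite tE nmM nmX nm_real normrM normrX normfV normr_nat.
  have -> : nm (iC R) = 1 by rewrite /nm normc_def/= expr0n/= add0r expr1n sqrtr1.
  by rewrite expr1n mul1r.
suff -> : expC (iC R * th%:C) = s by [].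
have cvs (e : R) : 0 < e -> \forall n \near eventually,
    nm (\sum_(j < n) (iC R * th%:C) ^+ j / j`!%:R - s) < e.
  move=> e0; have [A hA] := hs e e0; exists (\sum_(j <- A) j).+1 => // n /= nn.
  rewrite -(big_mkord xpredT (fun j => (iC R * th%:C) ^+ j / j`!%:R)).
  apply: hA; first exact: iota_uniq.
  move=> j jA; rewrite mem_index_iota /=; apply: leq_trans nn; rewrite ltnS.
  elim: A jA => // a A ih; rewrite inE big_cons => /orP[/eqP ->|/ih]; lia.
have ReE : complex.Re s = cos th.
  rewrite unlock; apply/esym/cvg_lim => //; apply/cvgrPdist_lt => e e0.
  have := cvs e e0; apply: filterS => n; apply: le_lt_trans.
  have -> : series (cos_coeff th) n = complex.Re (\sum_(j < n) (iC R * th%:C) ^+ j / j`!%:R).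
    rewrite Re_sum seriesEord; apply: eq_bigr => j _.
    by rewrite tE Re_mulr iX_Re /cos_coeff /= !mulrA.
  by rewrite distrC -raddfB nm_Re.
have ImE : complex.Im s = sin th.
  rewrite unlock; apply/esym/cvg_lim => //; apply/cvgrPdist_lt => e e0.
  have := cvs e e0; apply: filterS => n; apply: le_lt_trans.
  have -> : series (sin_coeff th) n = complex.Im (\sum_(j < n) (iC R * th%:C) ^+ j / j`!%:R).
    rewrite Im_sum seriesEord; apply: eq_bigr => j _.
    by rewrite tE Im_mulr iX_Im /sin_coeff /= !mulrA.
  by rewrite distrC -raddfB nm_Im.
rewrite -cexpE /cexp; have -> : iC R * th%:C = 0 +i* th.
  by apply/eqP; rewrite eq_complex /= !mul0r !mulr0 subrr mul1r add0r !eqxx.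
rewrite /= expR0 mul1r -ReE -ImE; by case: (s).
Qed.

(** Expanding every exponential and exchanging the sums turns f into a power series in x with
    absolutely summable coefficients [c]. Not all of them vanish, because f is nonzero at [x1], and
    the first nonzero one dominates near 0. *)
Lemma nonvanishing (a : int -> C) (lam : int -> R) (f : R -> C) :
  (forall rho, 0 <= rho -> asum (fun n => a n * (expR (rho * `|lam n|))%:C)) ->
  (forall x, hasSum (fun n => a n * expC (iC R * (lam n * x)%:C)) (f x)) ->
  forall x1, f x1 != 0 -> exists2 d : R, 0 < d & forall x, 0 < `|x| < d -> f x != 0.
Proof.
move=> ha hf x1 fx1.
pose F x (p : nat * int) := a p.2 * ((iC R * (lam p.2 * x)%:C) ^+ p.1 / p.1`!%:R).
have nmF x j n : nm (F x (j, n)) = nm (a n) * ((`|lam n| * `|x|) ^+ j / j`!%:R).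
  rewrite /F/= !nmM nmX nmM nm_real normrM.
  have -> : nm (iC R) = 1 by rewrite /nm normc_def/= expr0n/= add0r expr1n sqrtr1.
  by rewrite mul1r nmV -(rmorph_nat (real_complex R)) nm_real normr_nat.
have aF x : asum (F x).
  have [M hM] := ha `|x| (normr_ge0 x); exists M => B uB.
  pose B1 := undup (map fst B); pose B2 := undup (map snd B).
  apply: (@le_trans _ _ (\sum_(p <- [seq (j, n) | j <- B1, n <- B2]) nm (F x p))).
    apply: sum_subset => // [p||[j n] jnB]; first exact: nm_ge0.
      by apply: allpairs_uniq; rewrite ?undup_uniq// => -[? ?] [? ?] _ _ /= [-> ->].
    apply/allpairsP; exists (j, n); rewrite !mem_undup; split => //.
      by apply/mapP; exists (j, n).
    by apply/mapP; exists (j, n).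
  apply: le_trans (hM B2 (undup_uniq _)).
  rewrite big_allpairs_dep exchange_big/=; apply: ler_sum => n _.
  under eq_bigr do rewrite nmF.
  rewrite -mulr_sumr nmM nm_real (ger0_norm (expR_ge0 _)) ler_wpM2l ?nm_ge0//.
  rewrite [`|x| * _]mulrC; apply: exp_term_sum; last exact: undup_uniq.
  by rewrite mulr_ge0.
have hF x : hasSum (F x) (f x).
  have [s hs] := asum_hasSum (aF x); suff -> : f x = s by [].
  pose sw := fun p : int * nat => (p.2, p.1).
  have swi : injective sw by move=> [? ?] [? ?] [-> ->].
  have [s' hs'] := asum_hasSum (asum_reindex swi (aF x)).
  have hs2 : hasSum (F x) s'.
    by apply: (hasSum_reindex swi) hs' => -[j n] _; exists (n, j).
  rewrite (hasSum_unique hs hs2); apply: (hasSum_unique (hf x)).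
  apply: (hasSum_fiber hs') => n.
  by apply: eq_hasSum (hasSumZ (a n) (expC_series (lam n * x))) => j.
have FX x j n : F x (j, n) = x%:C ^+ j * F 1 (j, n).
  have E : iC R * (lam n * x)%:C = x%:C * (iC R * (lam n)%:C) by rewrite rmorphM/=; ring.
  by rewrite /F/= mulr1 E exprMn -(mulrA (x%:C ^+ j)) mulrCA.
have /choice[c hc] : forall j, exists s, hasSum (fun n => F 1 (j, n)) s.
  move=> j; apply: asum_hasSum.
  have ji : injective (fun n : int => (j, n)) by move=> ? ? [].
  exact: (asum_reindex ji (aF 1)).
have hG x : hasSum (fun j => x%:C ^+ j * c j) (f x).
  apply: (hasSum_fiber (hF x)) => j; apply: eq_hasSum (hasSumZ _ (hc j)) => n.
  by rewrite (FX x).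
have [M hM] : asum c.
  have [M hM] := aF 1; exists M => B uB.
  apply/ler_addgt0Pr => e e0.
  pose d := e / (size B).+1%:R; have d0 : 0 < d by rewrite divr_gt0.
  have /choice[A hA] : forall j, exists A : seq int, forall D, uniq D ->
      {subset A <= D} -> nm (\sum_(n <- D) F 1 (j, n) - c j) < d.
    by move=> j; exact: hc.
  pose K j := undup (A j).
  apply: (@le_trans _ _ (\sum_(j <- B) (\sum_(n <- K j) nm (F 1 (j, n)) + d))).
    apply: ler_sum => j _.
    have := hA j (K j) (undup_uniq _).
    move=> /(_ _)/wrap[n nA|h]; first by rewrite mem_undup.
    have := nm_triangle (\sum_(n <- K j) F 1 (j, n)) (c j) 0; rewrite !subr0 nm_distC.
    move=> /le_trans; apply; rewrite addrC; apply: lerD; last exact: ltW.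
    exact: nm_sum.
  rewrite big_split/=; apply: lerD.
    have := hM [seq (j, n) | j <- B, n <- K j].
    rewrite big_allpairs_dep; apply.
    apply: allpairs_uniq_dep => // [j _|[? ?] [? ?] _ _ /= [-> ->]//].
    exact: undup_uniq.
  rewrite big_const_seq count_predT iter_addr_0 -[X in X <= _]mulr_natr /d -[X in X <= _]mulrA.
  apply: ler_piMr; first exact: ltW.
  by rewrite mulrC ler_pdivrMr// mul1r ler_nat leqnSn.
have M0 : 0 <= M by have := hM [::] isT; rewrite big_nil.
have [k ck] : exists k, c k != 0.
  apply: contrapT => nc; move/negP: fx1; apply; apply/eqP.
  apply: (hasSum_unique (hG x1)) => e e0; exists [::] => B _ _.
  rewrite big1 ?subrr ?nm0// => j _; case: (eqVneq (c j) 0) => [->|h]; first by rewrite mulr0.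
  by exfalso; apply: nc; exists j.
have [k0 ck0 kmin] := ex_minnP (ex_intro (fun k => c k != 0) k ck).
have nk0 : 0 < nm (c k0) by rewrite lt_def nm_eq0 ck0 nm_ge0.
(* For |x| < 1 the terms beyond k0 add up to at most M |x|^(k0 + 1); the second bound makes this
   less than the term of order k0. *)
pose d := Num.min 1 (nm (c k0) / (M + 1)).
have d0 : 0 < d by rewrite lt_min ltr01 divr_gt0// ltr_wpDl.
exists d => // x /andP[x0]; rewrite lt_min => /andP[xl1]; rewrite ltr_pdivlMr ?ltr_wpDl// => xl2.
apply/eqP => fx0.
have e0 : 0 < `|x| ^+ k0 * (nm (c k0) - `|x| * M).
  by rewrite mulr_gt0 ?exprn_gt0//; have := x0; nra.
have [A hA] := hG x _ e0; pose B := undup (k0 :: A).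
have uB : uniq B := undup_uniq _.
have k0B : k0 \in B by rewrite mem_undup mem_head.
have := hA B uB; move=> /(_ _)/wrap[j jA|]; first by rewrite mem_undup inE jA orbT.
rewrite fx0 subr0 (bigD1_seq k0)//= ltNge => /negP; apply.
set S := \sum_(i <- B | _) _.
have hS : nm S <= `|x| ^+ k0.+1 * M.
  apply: (le_trans (nm_sum _ _ _)).
  apply: (@le_trans _ _ (\sum_(j <- B | j != k0) `|x| ^+ k0.+1 * nm (c j))).
    apply: ler_sum => j jk; rewrite nmM nmX nm_real.
    have [jl|jl] := ltnP j k0.
      have -> : c j = 0.
        by apply: contraTeq jl => /kmin; rewrite -leqNgt.
      by rewrite nm0 !mulr0.
    rewrite ler_wpM2r ?nm_ge0// ler_wiXn2l ?ltW// ltn_neqAle eq_sym jk//.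
  rewrite -mulr_sumr ler_wpM2l ?exprn_ge0//.
  apply: le_trans (hM B uB); rewrite [X in _ <= X](bigD1_seq k0)//= lerDr nm_ge0//.
have := nm_triangle (- S) (x%:C ^+ k0 * c k0) 0.
rewrite !subr0 opprK nmN nmM nmX nm_real => h.
have := le_trans h (lerD (lexx _) hS); rewrite exprSr -lerBlDr -mulrA -mulrBr.
by [].
Qed.

End Nonvanishing.

(** At the points e, 2e, ..., Ne the theta factors have as arguments integer multiples of e; [K]
    exceeds all these integers, including the sum 1 + ... + N, which is at most N^2. *)
Lemma node_bounds (N : nat) : (0 < N)%N -> let K := (4 * (N * N) + 1)%N in
  [/\ forall l, (l < N)%N -> (0 < l.+1 < K)%N, forall l, (l < N)%N -> (0 < 2 * l.+1 < K)%N,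
   forall j k, (j < k < N)%N -> (0 < k - j < K)%N,
   forall j k, (j < k < N)%N -> (0 < k.+1 + j.+1 < K)%N &
   forall s, (0 < s <= N * N)%N -> (0 < s < K)%N].
Proof.
move=> N0 /=; have := leq_pmulr N N0; set M := (N * N)%N => hM.
by split => *; lia.
Qed.

(** * Theta functions near the origin of the real line *)

Section WNonzero.
Context {R : realType}.
Local Notation C := (R[i]).
Implicit Types (t : R) (r : rsys) (N : nat).
Local Notation pii := (PI R * iC R).

Definition punct (g : C -> C) :=
  exists2 d : R, 0 < d & forall x : R, 0 < `|x| < d -> g x%:C != 0.

(** Where the factors other than the Gaussian ones agree for all n, the series is a nonzero constant
    times a sum of positive numbers. *)
Lemma Th_pos t m (kap : int) (x c : C) : 0 < t ->
  (forall n : int, expC c * expC (n%:~R * m + (kap%:~R + 2 * n%:~R) * pii * x) = 1) ->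
  Th t 1 m kap x != 0.
Proof.
move=> t0 hc; pose u (n : int) : R := expR (- (pi * t) * (kap%:~R / 2 + n%:~R) ^+ 2).
have hs := hasSumZ (expC c) (hasSum_Th m kap x t0 (ltn0Sn 0)).
have E (n : int) : expC c * Thterm t 1 m kap x n = (u n)%:C.
  rewrite Thterm_1.
  have -> : n%:~R * m + lq t * (kap%:~R / 2 + n%:~R) ^+ 2 + (kap%:~R + 2 * n%:~R) * pii * x
     = (n%:~R * m + (kap%:~R + 2 * n%:~R) * pii * x) + lq t * (kap%:~R / 2 + n%:~R) ^+ 2.
    ring.
  rewrite expCD mulrA hc mul1r /u -expC_real; congr expC.
  rewrite rmorphM rmorphXn rmorphD/= rmorphM fmorphV/= !rmorph_int.
  by rewrite -(rmorph_nat (real_complex R) 2).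
have := hasSum_ge0 0 E (fun n => expR_ge0 _) hs.
move=> h; apply/eqP => Th0; move: h; rewrite Th0 mulr0 /= leNgt.
by rewrite expR_gt0.
Qed.

Lemma Th_punct t m (kap : int) (x1 : R) : 0 < t -> Th t 1 m kap x1%:C != 0 ->
  punct (Th t 1 m kap).
Proof.
move=> t0 h1.
pose a (n : int) : C := expC (n%:~R * m + lq t * (kap + (2 * 1)%:Z * n)%:~R ^+ 2 / (4 * 1)%:R).
pose lam (n : int) : R := pi * (kap + (2 * 1)%:Z * n)%:~R.
have eeE (k : int) (x : R) : ee k x%:C = expC (iC R * (pi * k%:~R * x)%:C).
  rewrite /ee; congr expC; rewrite !rmorphM/= rmorph_int /PI; ring.
apply: (@nonvanishing _ a lam (fun x => Th t 1 m kap x%:C) _ _ x1) => //.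
- move=> rho rho0.
  (* The moduli of the terms at i rho and -i rho together majorise the weight e^{rho |lam|},
     whatever the sign of [lam n]. *)
  have [M1 hM1] := asum_Th m kap (0 +i* rho) t0 (ltn0Sn 0).
  have [M2 hM2] := asum_Th m kap (0 +i* (- rho)) t0 (ltn0Sn 0).
  exists (M1 + M2) => B uB; apply: le_trans (lerD (hM1 B uB) (hM2 B uB)).
  rewrite -big_split/=; apply: ler_sum => n _.
  have nmT (y : R) : nm (Thterm t 1 m kap (0 +i* y) n) = nm (a n) * expR (- lam n * y).
    rewrite /Thterm nmM -/(a n); congr (_ * _); rewrite /ee nm_expC; congr expR.
    rewrite -mulrA Re_intM piiE /= mul0r sub0r /lam; ring.
  rewrite !nmT -mulrDr nmM nm_real ger0_norm ?expR_ge0// ler_wpM2l ?nm_ge0//.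
  rewrite mulNr mulNr mulrN opprK (mulrC rho).
  case: (ger0P (lam n)) => _.
    by rewrite lerDr expR_ge0.
  by rewrite mulNr lerDl expR_ge0.
- move=> x; apply: eq_hasSum (hasSum_Th m kap x%:C t0 (ltn0Sn 0)) => n.
  by rewrite /Thterm -/(a n) eeE.
Qed.

Lemma expC_2pii (n : int) : expC (n%:~R * (2 * pii)) = 1.
Proof.
by rewrite expCMz -[2]/(2%:R) expCMn expC_pii sqrrN expr1n exp1rz.
Qed.

Lemma theta1_punct t : 0 < t -> punct (fun x => theta1 x (0 +i* t)).
Proof.
(* At 1/2 the alternating sign cancels the phase e^{(2n - 1) pi i/2} up to the constant e^{-pi
   i/2}. *)
move=> t0; have h : Th t 1 pii (-1) ((2^-1 : R)%:C) != 0.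
  apply: (@Th_pos _ _ _ _ (pii / 2)) => // n; rewrite -expCD -[RHS](expC_2pii n); congr expC.
  by rewrite fmorphV (rmorph_nat (real_complex R) 2) mulrNz; field.
have [d d0 hd] := Th_punct t0 h; exists d => // x hx.
rewrite theta1E mulf_neq0 ?hd//.
by rewrite /iC eq_complex /= negb_and oner_neq0 orbT.
Qed.

Lemma theta0_punct t : 0 < t -> punct (fun x => theta0 x (0 +i* t)).
Proof.
move=> t0; have h : Th t 1 pii 0 ((2^-1 : R)%:C) != 0.
  apply: (@Th_pos _ _ _ _ 0) => // n; rewrite -expCD -[RHS](expC_2pii n); congr expC.
  by rewrite fmorphV (rmorph_nat (real_complex R) 2); field.
by have [d d0 hd] := Th_punct t0 h; exists d => // x hx; rewrite theta0E hd.
Qed.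

Lemma theta3_punct t : 0 < t -> punct (fun x => theta3 x (0 +i* t)).
Proof.
move=> t0; have h : Th t 1 0 0 ((0 : R)%:C) != 0.
  apply: (@Th_pos _ _ _ _ 0) => // n; rewrite -expCD -[RHS]expC0; congr expC.
  rewrite -[(0:R)%:C]/(0 : C); ring.
by have [d d0 hd] := Th_punct t0 h; exists d => // x hx; rewrite theta3E hd.
Qed.

(* At the points (e, 2e, ..., Ne) with e small and real, each factor is a theta function
   at a nonzero multiple of e, and these have no zero in a punctured neighbourhood of 0. *)
Lemma Wq_neq0 r N t : 0 < t -> (0 < N)%N ->
  exists z : 'I_N -> C, Wq r N (extz z) (0 +i* t) != 0.
Proof.
move=> t0 N0; have t2 : 0 < 2 * t by lra.
have th : 0 < t / 2 by lra.
have [B1 B2 B3 B4 B5] := node_bounds N0.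
have [d1 d10 h1] := theta1_punct t0.
have [d2 d20 h2] := theta1_punct t2.
have [d3 d30 h3] := theta1_punct th.
have [d4 d40 h4] := theta0_punct t2.
have [d5 d50 h5] : punct (fun x => theta_s N x (0 +i* t)).
  by rewrite /theta_s; case: (odd N); [exact: theta3_punct|exact: theta0_punct].
pose d := Num.min d1 (Num.min d2 (Num.min d3 (Num.min d4 d5))).
have d0 : 0 < d by rewrite !lt_min d10 d20 d30 d40 d50.
pose K := (4 * (N * N) + 1)%N.
pose e := d / K%:R; have K0 : 0 < K%:R :> R by rewrite ltr0n /K addn1.
have e0 : 0 < e by rewrite divr_gt0.
have small k : (0 < k < K)%N -> 0 < `|k%:R * e| < d.
  move=> /andP[k0 kK]; rewrite normrM !gtr0_norm ?ltr0n// mulr_gt0 ?ltr0n//=.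
  by rewrite /e mulrCA gtr_pMr// ltr_pdivrMr// mul1r ltr_nat.
have H (d' : R) (g : C -> C) : d <= d' ->
    (forall x : R, 0 < `|x| < d' -> g x%:C != 0) ->
    forall k, (0 < k < K)%N -> g (k%:R * e)%:C != 0.
  move=> dd hg k /small /andP[a b]; apply: hg; rewrite a/=; exact: lt_le_trans b dd.
have [D1 [D2 [D3 [D4 D5]]]] : d <= d1 /\ d <= d2 /\ d <= d3 /\ d <= d4 /\ d <= d5.
  by rewrite /d !ge_min !lexx !orbT.
rewrite -/K in B1 B2 B3 B4 B5; clearbody e; clearbody K; clearbody d.
pose z (j : 'I_N) : C := (j.+1%:R * e)%:C.
exists z; rewrite WqE; apply: mulf_neq0.
  have z2 (l : 'I_N) : 2%:R * z l = ((2 * l.+1)%N%:R * e)%:C.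
    by rewrite /z -(rmorph_nat (real_complex R) 2) -rmorphM/= natrM mulrA.
  rewrite /Wsym; case: r; rewrite ?tau2 ?tau_half.
  - have -> : \sum_k z k = ((\sum_(k < N) k.+1)%N%:R * e)%:C.
      by rewrite natr_sum mulr_suml rmorph_sum.
    apply: (H d5 (fun x => theta_s N x (0 +i* t))) ; [exact: D5|exact: h5|].
    have N1 : (\sum_(k < N) k.+1 <= N * N)%N.
      apply: (@leq_trans (\sum_(k < N) N)); last by rewrite sum_nat_const card_ord.
      by apply: leq_sum => k _; exact: ltn_ord.
    have N2 : (0 < \sum_(k < N) k.+1)%N.
      by rewrite (bigD1 (Ordinal N0)).
    by apply: B5; rewrite N1 N2.
  - apply/prodf_neq0 => l _; apply: (H d1 (fun x => theta1 x (0 +i* t))) ; [exact: D1|exact: h1|exact: (B1 l (ltn_ord l))].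
  - apply/prodf_neq0 => l _; rewrite /extra tau2 z2.
    apply: (H d2 (fun x => theta1 x (0 +i* (2 * t)))) ; [exact: D2|exact: h2|exact: (B2 l (ltn_ord l))].
  - apply/prodf_neq0 => l _; rewrite /extra z2.
    apply: (H d1 (fun x => theta1 x (0 +i* t))) ; [exact: D1|exact: h1|exact: (B2 l (ltn_ord l))].
  - apply/prodf_neq0 => l _; rewrite /extra tau_half.
    apply: (H d3 (fun x => theta1 x (0 +i* (t / 2)))) ; [exact: D3|exact: h3|exact: (B1 l (ltn_ord l))].
  - apply/prodf_neq0 => l _; rewrite /extra tau2 z2; apply: mulf_neq0.
      apply: (H d1 (fun x => theta1 x (0 +i* t))) ; [exact: D1|exact: h1|exact: (B1 l (ltn_ord l))].
    apply: (H d4 (fun x => theta0 x (0 +i* (2 * t)))) ; [exact: D4|exact: h4|exact: (B2 l (ltn_ord l))].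
  - by apply/prodf_neq0 => l _; rewrite /extra oner_neq0.
apply/prodf_neq0 => j _; apply/prodf_neq0 => k jk.
have n1 : theta1 (z k - z j) (0 +i* t) != 0.
  have -> : z k - z j = ((k - j)%N%:R * e)%:C.
    by rewrite /z -rmorphB/= -mulrBl -natrB ?subSS// ltnS ltnW.
  apply: (H d1 (fun x => theta1 x (0 +i* t))) ; [exact: D1|exact: h1|].
  by apply: B3; rewrite jk ltn_ord.
have n2 : theta1 (z k + z j) (0 +i* t) != 0.
  have -> : z k + z j = ((k.+1 + j.+1)%N%:R * e)%:C.
    by rewrite /z -rmorphD/= -mulrDl -natrD.
  apply: (H d1 (fun x => theta1 x (0 +i* t))) ; [exact: D1|exact: h1|].
  by apply: B4; rewrite jk ltn_ord.
by rewrite /Wpair; case: r => //; exact: mulf_neq0.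
Qed.

End WNonzero.

(** * Iterated integrals and orthogonality *)

Section IteratedIntegral.
Context {R : realType}.
Local Notation C := (R[i]).
Local Notation mu := (@lebesgue_measure R).
Local Open Scope classical_set_scope.

Lemma mu_itv_co (l : R) : 0 <= l -> mu `[0%R, l[ = l%:E.
Proof.
move=> l0; rewrite lebesgue_measure_itv/= lte_fin; case: ltP => h.
  by rewrite oppr0 adde0.
by congr (_%:E); apply/eqP; rewrite eq_le h l0.
Qed.

Lemma mu_itv_co_fin (l : R) : (mu `[0%R, l[ < +oo)%E.
Proof. by rewrite lebesgue_measure_itv/=; case: ifP => _; rewrite ?ltry ?lte0y// -EFinD ltry. Qed.

Lemma measurable_co (l : R) :
  measurable (`[0, l[ : set (g_sigma_algebraType (R.-ocitv.-measurable))).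
Proof. exact: measurable_itv. Qed.

(** A uniform limit of measurable functions is measurable, and it differs from an integrable one by
    a bounded function on an interval of finite length. *)
Lemma integrable_of_close (l : R) (f : R -> R) :
  (forall e : R, 0 < e -> exists2 g : R -> R, mu.-integrable `[0, l[ (EFin \o g) &
    forall x, `[0, l[%classic x -> `|f x - g x| <= e) ->
  mu.-integrable `[0, l[ (EFin \o f).
Proof.
move=> h; pose D := `[0, l[%classic : set R.
have e0 (n : nat) : 0 < n.+1%:R^-1 :> R by rewrite invr_gt0.
have /choice[g hg] : forall n : nat, exists g : R -> R, mu.-integrable D (EFin \o g) /\
    forall x, D x -> `|f x - g x| <= n.+1%:R^-1.
  by move=> n; have [g g1 g2] := h _ (e0 n); exists g.
have mg n : measurable_fun D (g n) by apply/measurable_EFinP; exact: (measurable_int mu (hg n).1).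
have mf : measurable_fun D f.
  apply: (measurable_fun_cvg mg) => x Dx; apply/cvgrPdist_le => e ep.
  near=> n; apply: (le_trans ((hg n).2 x Dx)).
  rewrite -[e]invrK lef_pV2 ?posrE ?invr_gt0//.
  apply: ltW; apply: (@lt_le_trans _ _ n%:R); last by rewrite ler_nat.
  near: n; exact: nbhs_infty_gtr.
have ib : mu.-integrable D (EFin \o (fun x => f x - g 0%N x)).
  apply: measurable_bounded_integrable; [exact: measurable_itv|exact: mu_itv_co_fin| |].
    by apply: measurable_funB => //; exact: mg.
  exists 1; split => // M M1 x Dx /=.
  apply: (le_trans ((hg 0%N).2 x Dx)); rewrite invr1; exact: ltW.
have := integrableD (measurable_co _) (hg 0%N).1 ib.
apply: eq_integrable => // x Dx /=; rewrite -EFinD; congr (_%:E); ring.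
Unshelve. all: end_near. Qed.

Lemma integrable_cst (l c : R) : mu.-integrable `[0, l[ (EFin \o (fun=> c)).
Proof.
apply: measurable_bounded_integrable => //; first exact: mu_itv_co_fin.
by exists `|c|; split; [exact: num_real|move=> M cM x _; exact: ltW].
Qed.

Lemma Rintegral_close (l e : R) (f g : R -> R) : 0 <= l ->
  mu.-integrable `[0, l[ (EFin \o f) -> mu.-integrable `[0, l[ (EFin \o g) ->
  (forall x, `[0, l[%classic x -> `|f x - g x| <= e) ->
  `|\int[mu]_(x in `[0, l[) f x - \int[mu]_(x in `[0, l[) g x| <= e * l.
Proof.
move=> l0 hf hg fg; rewrite -RintegralB//.
have hfg : mu.-integrable `[0, l[ (EFin \o (fun x => f x - g x)).
  have := integrableB (measurable_co _) hf hg.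
  by apply: eq_integrable.
have hn : mu.-integrable `[0, l[ (EFin \o (fun x => `|f x - g x|)).
  by have := integrable_abse hfg; apply: eq_integrable.
apply: (le_trans (le_normr_Rintegral _ _)) => //.
have hc : mu.-integrable `[0, l[ (EFin \o cst e) by exact: integrable_cst.
apply: (le_trans (le_Rintegral _ hn hc fg)) => //.
rewrite Rintegral_cst//.
by have -> : fine (mu `[0%R, l[) = l by rewrite mu_itv_co.
Qed.

(** The real-valued integral is linear only on integrable functions, so integrability at both stages
    travels with the value. *)
Definition hasI2 (L W : R) (f : R -> R -> R) (s : R) :=
  [/\ forall x, `[0, L[%classic x -> mu.-integrable `[0, W[ (EFin \o f x),
      mu.-integrable `[0, L[ (EFin \o (fun x => \int[mu]_(y in `[0, W[) f x y)%R) &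
      \int[mu]_(x in `[0, L[) (\int[mu]_(y in `[0, W[) f x y)%R = s]%R.

Lemma eq_hasI2 (L W : R) (f g : R -> R -> R) (s : R) :
  (forall x y, f x y = g x y) -> hasI2 L W f s -> hasI2 L W g s.
Proof. by move=> fg; suff -> : f = g by []; apply/funext => x; apply/funext. Qed.

Lemma hasI2D (L W : R) f g s s' : hasI2 L W f s -> hasI2 L W g s' ->
  hasI2 L W (fun x y => f x y + g x y) (s + s').
Proof.
move=> [f1 f2 f3] [g1 g2 g3].
have E x : `[0, L[%classic x -> \int[mu]_(y in `[0, W[) (f x y + g x y) =
    \int[mu]_(y in `[0, W[) f x y + \int[mu]_(y in `[0, W[) g x y.
  by move=> Lx; rewrite RintegralD//; [exact: f1|exact: g1].
split.
- move=> x Lx; have := integrableD (measurable_co _) (f1 x Lx) (g1 x Lx).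
  by apply: eq_integrable.
- have := integrableD (measurable_co _) f2 g2.
  by apply: eq_integrable => // x /set_mem Lx /=; rewrite E.
- rewrite (@eq_Rintegral _ _ _ mu _ (fun x => \int[mu]_(y in `[0, W[) f x y + \int[mu]_(y in `[0, W[) g x y)).
    by rewrite RintegralD// f3 g3.
  by move=> x /set_mem Lx; rewrite E.
Qed.

Lemma hasI2Z (L W : R) c f s : hasI2 L W f s -> hasI2 L W (fun x y => c * f x y) (c * s).
Proof.
move=> [f1 f2 f3].
have E x : `[0, L[%classic x -> \int[mu]_(y in `[0, W[) (c * f x y) =
    c * \int[mu]_(y in `[0, W[) f x y.
  by move=> Lx; rewrite RintegralZl//; exact: f1.
split.
- move=> x Lx; have := integrableZl (measurable_co _) c (f1 x Lx).
  by apply: eq_integrable.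
- have := integrableZl (measurable_co _) c f2.
  by apply: eq_integrable => // x /set_mem Lx /=; rewrite E.
- rewrite (@eq_Rintegral _ _ _ mu _ (fun x => c * \int[mu]_(y in `[0, W[) f x y)).
    by rewrite RintegralZl// f3.
  by move=> x /set_mem Lx; rewrite E.
Qed.

Lemma hasI2_tensor (L W : R) (a b : R -> R) :
  mu.-integrable `[0, L[ (EFin \o a) -> mu.-integrable `[0, W[ (EFin \o b) ->
  hasI2 L W (fun x y => a x * b y)
    (\int[mu]_(x in `[0, L[) a x * \int[mu]_(y in `[0, W[) b y).
Proof.
move=> ha hb.
have E x : \int[mu]_(y in `[0, W[) (a x * b y) = a x * \int[mu]_(y in `[0, W[) b y.
  by rewrite RintegralZl.
split.
- move=> x Lx; have := integrableZl (measurable_co _) (a x) hb.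
  by apply: eq_integrable.
- have := integrableZr (measurable_co _) (\int[mu]_(y in `[0, W[) b y) ha.
  by apply: eq_integrable => // x _ /=; rewrite E.
- by under eq_Rintegral do rewrite E; rewrite RintegralZr.
Qed.

(** One integration preserves uniform closeness and multiplies the error by the length of the
    interval; this is applied twice. *)
Lemma hasI2_lim (L W : R) f s : 0 < L -> 0 < W ->
  (forall e : R, 0 < e -> exists g s', [/\ hasI2 L W g s',
     forall x y, `[0, L[%classic x -> `[0, W[%classic y -> `|f x y - g x y| <= e & `|s' - s| <= e]) ->
  hasI2 L W f s.
Proof.
move=> L0 W0 h.
have f1 x : `[0, L[%classic x -> mu.-integrable `[0, W[ (EFin \o f x).
  move=> Lx; apply: integrable_of_close => e e0.
  have [g [s' [[g1 g2 g3] fg ss]]] := h e e0; exists (g x); first exact: g1.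
  by move=> y Wy; exact: fg.
have f2' g e : (forall x, `[0, L[%classic x -> mu.-integrable `[0, W[ (EFin \o g x)) ->
    (forall x y, `[0, L[%classic x -> `[0, W[%classic y -> `|f x y - g x y| <= e) ->
    forall x, `[0, L[%classic x ->
    `|\int[mu]_(y in `[0, W[) f x y - \int[mu]_(y in `[0, W[) g x y| <= e * W.
  move=> g1 fg x Lx; apply: Rintegral_close; [exact: ltW|exact: f1|exact: g1|].
  by move=> y Wy; exact: fg.
have f2 : mu.-integrable `[0, L[ (EFin \o (fun x => \int[mu]_(y in `[0, W[) f x y)%R).
  apply: integrable_of_close => e e0.
  have eW : 0 < e / W by rewrite divr_gt0.
  have [g [s' [[g1 g2 g3] fg ss]]] := h _ eW.
  exists (fun x => \int[mu]_(y in `[0, W[) g x y)%R => // x Lx.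
  by have := f2' _ _ g1 fg x Lx; rewrite divfK// gt_eqF.
split => //; apply/eqP; rewrite -subr_eq0 -normr_le0; apply/ler_addgt0Pl => e e0.
pose d := e / (W * L + 1); have WL : 0 < W * L + 1 by rewrite ltr_wpDl// mulr_ge0// ltW.
have d0 : 0 < d by rewrite divr_gt0.
have [g [s' [[g1 g2 g3] fg ss]]] := h _ d0.
have := Rintegral_close (ltW L0) f2 g2 (f2' _ _ g1 fg); rewrite g3 => h1.
rewrite addr0; set I := (X in `|X - s|) in h1 *.
apply: (le_trans (ler_distD s' _ _)).
have -> : e = d * W * L + d by rewrite -mulrA -[X in _ + X]mulr1 -mulrDr /d divfK// gt_eqF.
exact: lerD.
Qed.

Definition hasInt2 (L W : R) (F : C -> C) (s : C) :=
  hasI2 L W (fun x y => complex.Re (F (x +i* y))) (complex.Re s) /\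
  hasI2 L W (fun x y => complex.Im (F (x +i* y))) (complex.Im s).

Lemma eq_hasInt2 (L W : R) (F G : C -> C) (s : C) :
  F =1 G -> hasInt2 L W F s -> hasInt2 L W G s.
Proof. by move=> /funext ->. Qed.

Lemma hasInt2D (L W : R) F G s s' : hasInt2 L W F s -> hasInt2 L W G s' ->
  hasInt2 L W (fun z => F z + G z) (s + s').
Proof.
move=> [F1 F2] [G1 G2]; split; rewrite raddfD/=.
  by apply: eq_hasI2 (hasI2D F1 G1) => x y; rewrite raddfD.
by apply: eq_hasI2 (hasI2D F2 G2) => x y; rewrite raddfD.
Qed.

Lemma hasInt2Z (L W : R) c F s : hasInt2 L W F s ->
  hasInt2 L W (fun z => c * F z) (c * s).
Proof.
move=> [F1 F2].
have ReM (u v : C) : complex.Re (u * v) = complex.Re u * complex.Re v + (- complex.Im u) * complex.Im v.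
  by case: u v => [a b] [a' b'] /=; rewrite mulNr.
have ImM (u v : C) : complex.Im (u * v) = complex.Re u * complex.Im v + complex.Im u * complex.Re v.
  by case: u v => [a b] [a' b'] /=.
split; rewrite ?ReM ?ImM.
  by apply: eq_hasI2 (hasI2D (hasI2Z _ F1) (hasI2Z _ F2)) => x y; rewrite ReM.
by apply: eq_hasI2 (hasI2D (hasI2Z _ F2) (hasI2Z _ F1)) => x y; rewrite ImM.
Qed.

Lemma hasInt20 (L W : R) : hasInt2 L W (fun=> 0) 0.
Proof.
have h0 : hasI2 L W (fun _ _ => 0) 0.
  have h := hasI2Z 0 (hasI2_tensor (integrable_cst L 0) (integrable_cst W 0)).
  rewrite -[X in hasI2 _ _ _ X](mul0r (\int[mu]_(x in `[0, L[) 0 * \int[mu]_(y in `[0, W[) 0)).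
  by apply: eq_hasI2 h => x y; rewrite mul0r.
by split.
Qed.

Lemma hasInt2_sum (L W : R) (I : Type) (r : seq I) (F : I -> C -> C) (s : I -> C) :
  (forall i, hasInt2 L W (F i) (s i)) ->
  hasInt2 L W (fun z => \sum_(i <- r) F i z) (\sum_(i <- r) s i).
Proof.
move=> h; elim: r => [|i r ih].
  rewrite big_nil; apply: eq_hasInt2 (hasInt20 L W) => z; by rewrite big_nil.
rewrite big_cons; apply: eq_hasInt2 (hasInt2D (h i) ih) => z; by rewrite big_cons.
Qed.

Lemma hasInt2_lim (L W : R) F s : 0 < L -> 0 < W ->
  (forall e : R, 0 < e -> exists G s', [/\ hasInt2 L W G s',
     forall x y, `[0, L[%classic x -> `[0, W[%classic y -> nm (F (x +i* y) - G (x +i* y)) <= e &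
     nm (s' - s) <= e]) ->
  hasInt2 L W F s.
Proof.
move=> L0 W0 h; split; apply: hasI2_lim => // e e0;
  have [G [s' [[G1 G2] FG ss]]] := h e e0.
- exists (fun x y => complex.Re (G (x +i* y))), (complex.Re s'); split => //.
    by move=> x y Lx Wy; rewrite -raddfB; apply: (le_trans (nm_Re _)); exact: FG.
  by rewrite -raddfB; apply: (le_trans (nm_Re _)).
- exists (fun x y => complex.Im (G (x +i* y))), (complex.Im s'); split => //.
    by move=> x y Lx Wy; rewrite -raddfB; apply: (le_trans (nm_Im _)); exact: FG.
  by rewrite -raddfB; apply: (le_trans (nm_Im _)).
Qed.

End IteratedIntegral.

(** * Integrals of trigonometric and Gaussian functions *)

Section Calculus.
Context {R : realType}.
Local Notation mu := (@lebesgue_measure R).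
Local Open Scope classical_set_scope.

Lemma continuous_integrable_itv (f : R -> R) (a b : R) :
  continuous f -> mu.-integrable `[a, b] (EFin \o f).
Proof.
move=> cf; apply: continuous_compact_integrable; first exact: segment_compact.
exact: continuous_subspaceT.
Qed.

Lemma continuous_integrable_co (f : R -> R) (a b : R) :
  continuous f -> mu.-integrable `[a, b[ (EFin \o f).
Proof.
move=> cf; apply: (integrableS _ _ _ (continuous_integrable_itv a b cf)) => //.
by apply: subset_itvl; rewrite bnd_simp.
Qed.

Lemma Rintegral_co (f : R -> R) (a b : R) : continuous f ->
  \int[mu]_(x in `[a, b[) f x = \int[mu]_(x in `[a, b]) f x.
Proof. by move=> cf; rewrite Rintegral_itv_bndo_bndc//; exact: continuous_integrable_co. Qed.

Lemma derivable_LR (F : R -> R) (a b : R) : (forall x, derivable F x 1) ->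
  derivable_oo_LRcontinuous F a b.
Proof.
move=> dF; have cF : continuous F.
  by move=> x; apply: differentiable_continuous; exact/derivable1_diffP.
split; first by move=> x _; exact: dF.
  by apply: cvg_at_right_filter; exact: cF.
by apply: cvg_at_left_filter; exact: cF.
Qed.

Lemma is_derive_continuous (F f : R -> R) :
  (forall x : R, is_derive x 1 F (f x)) -> continuous F.
Proof.
move=> dF x; apply: differentiable_continuous; apply/derivable1_diffP.
exact: ex_derive.
Qed.

Lemma FTC_simple (f F : R -> R) (a b : R) : a < b -> continuous f ->
  (forall x : R, is_derive x 1 F (f x)) -> \int[mu]_(x in `[a, b]) f x = F b - F a.
Proof.
move=> ab cf dF; rewrite /Rintegral (@continuous_FTC2 _ f F)//.
- exact: continuous_subspaceT.
- by apply: derivable_LR => x; exact: ex_derive.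
- by move=> x _; rewrite derive1E; exact: derive_val.
Qed.

Lemma is_derive_mull (k x : R) : is_derive x 1 (fun y : R => k * y) k.
Proof.
by have := is_deriveZ k (is_derive_id x (1 : R)); rewrite /GRing.scale/= mulr1.
Qed.

Lemma Rint_cos (th l : R) : 0 < l -> th != 0 -> sin (th * l) = 0 ->
  \int[mu]_(x in `[0, l[) cos (th * x) = 0.
Proof.
move=> l0 th0 s0; have cf : continuous (fun x : R => cos (th * x)).
  by move=> x; apply: continuous_comp; [exact: mulrl_continuous|exact: continuous_cos].
have dF (x : R) : is_derive x 1 (fun x : R => th^-1 * sin (th * x)) (cos (th * x)).
  have h := is_deriveZ th^-1 (is_derive1_comp (is_derive_sin (th * x)) (is_derive_mull th x)).
  by apply: (is_derive_eq h); rewrite /GRing.scale/= mulrC mulfK.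
by rewrite Rintegral_co// (FTC_simple l0 cf dF) s0 !mulr0 sin0 mulr0 subrr.
Qed.

Lemma Rint_sin (th l : R) : 0 < l -> th != 0 -> cos (th * l) = 1 ->
  \int[mu]_(x in `[0, l[) sin (th * x) = 0.
Proof.
move=> l0 th0 s0; have cf : continuous (fun x : R => sin (th * x)).
  by move=> x; apply: continuous_comp; [exact: mulrl_continuous|exact: continuous_sin].
have dF (x : R) : is_derive x 1 (fun x : R => - th^-1 * cos (th * x)) (sin (th * x)).
  have h := is_deriveZ (- th^-1) (is_derive1_comp (is_derive_cos (th * x)) (is_derive_mull th x)).
  by apply: (is_derive_eq h); rewrite /GRing.scale/= !mulNr mulrN opprK mulrC mulfK.
by rewrite Rintegral_co// (FTC_simple l0 cf dF) s0 !mulr0 cos0 subrr.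
Qed.

Local Notation gI c d := (\int[mu]_(x in `[c, d]) gauss_fun x).

Lemma gauss_glue (c d e : R) : c <= d -> d <= e -> gI c e = gI c d + gI d e.
Proof.
move=> cd de.
have := @Rintegral_itvB R gauss_fun (BLeft c) (BRight e) d.
rewrite -(@Rintegral_itv_obnd_cbnd R d).
  move=> <-; rewrite ?bnd_simp//; first by rewrite addrC subrK.
  exact: continuous_integrable_itv (@continuous_gauss_fun R).
apply: (integrableS _ _ _ (continuous_integrable_itv d e (@continuous_gauss_fun R))) => //.
by apply: subset_itvr; rewrite bnd_simp.
Qed.

Lemma gauss_subst (b c l : R) : 0 < b -> 0 <= l ->
  \int[mu]_(y in `[0, l[) expR (- (b ^+ 2) * (y + c) ^+ 2) = b^-1 * gI (b * c) (b * (l + c)).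
Proof.
move=> b0 l0.
pose F (y : R) := b * (y + c).
have dF (y : R) : is_derive y 1 F b.
  have h := is_deriveZ b (is_deriveD (is_derive_id y (1 : R)) (is_derive_cst c y (1 : R))).
  by apply: (is_derive_eq h); rewrite /GRing.scale/= addr0 mulr1.
have cf : continuous (fun y : R => gauss_fun (b * (y + c))).
  move=> y; apply: (@continuous_comp _ _ _ F gauss_fun); last exact: continuous_gauss_fun.
  exact: (is_derive_continuous dF).
have F'E : F^`() = cst b by apply/funext => y; rewrite derive1E; exact: derive_val.
have E y : expR (- (b ^+ 2) * (y + c) ^+ 2) = gauss_fun (b * (y + c)).
  by rewrite /gauss_fun exprMn mulNr.
under eq_Rintegral do rewrite E.
rewrite Rintegral_co//.
have := @integration_by_substitution_increasing R F gauss_fun 0 l l0.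
rewrite F'E => H.
have -> : gI (b * c) (b * (l + c)) = \int[mu]_(x in `[0, l]) (gauss_fun (b * (x + c)) * b).
  have -> : b * c = F 0 by rewrite /F add0r.
  rewrite -/(F l) /Rintegral H//.
  - by move=> x y _ _ xy; rewrite /F ltr_pM2l// ltrD2r.
  - by move=> x _; exact: cst_continuous.
  - exact: is_cvg_cst.
  - exact: is_cvg_cst.
  - by apply: derivable_LR => x; exact: ex_derive.
  - by apply: continuous_subspaceT; exact: continuous_gauss_fun.
rewrite RintegralZr//; last exact: continuous_integrable_itv.
by rewrite mulrC mulfK// gt_eqF.
Qed.

Lemma gauss_half_cvg : gI 0 x @[x --> +oo] --> (Num.sqrt pi / 2 : R).
Proof.
have : Num.sqrt ((gI 0 x) ^+ 2) @[x --> +oo] --> (Num.sqrt (pi / 4) : R).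
  apply: continuous_cvg; first exact: sqrt_continuous.
  exact: (@gauss_integral_proof.cvg_integral0_gauss_sqr R).
rewrite sqrtrM ?pi_ge0// sqrtrV// (_ : 4 = 2 ^+ 2); last by rewrite expr2 -natrM.
rewrite sqrtr_sqr ger0_norm//.
rewrite (_ : (fun x => Num.sqrt _) = (fun x => gI 0 x))//.
apply/funext => r; rewrite sqrtr_sqr// ger0_norm//.
exact: gauss_integral_proof.integral0_gauss_ge0.
Qed.

Lemma gauss_sym (c : R) : c <= 0 -> gI c 0 = gI 0 (- c).
Proof.
move=> c0; have c0' : 0 <= - c by rewrite oppr_ge0.
have := @integration_by_substitution_oppr R gauss_fun 0 (- c) c0'.
rewrite opprK oppr0 => H; rewrite /Rintegral H; last first.
  by apply: continuous_subspaceT; exact: continuous_gauss_fun.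
congr fine; apply: eq_integral => x _ /=; by rewrite /gauss_fun sqrrN.
Qed.

Lemma gauss_total (e : R) : 0 < e -> exists2 T : R, 0 <= T &
  forall c d, c <= - T -> T <= d -> `|gI c d - Num.sqrt pi| <= e.
Proof.
move=> e0; have e2 : 0 < e / 2 by rewrite divr_gt0.
have /cvgrPdist_le /(_ _ e2) [M [_ hM]] := gauss_half_cvg.
exists (`|M| + 1) => [|c d cT Td]; first by rewrite addr_ge0.
have MM := ler_norm M; have M0 := normr_ge0 M.
have c0 : c <= 0 by lra.
have d0 : 0 <= d by lra.
rewrite (gauss_glue c0 d0) gauss_sym//.
have h1 : `|Num.sqrt pi / 2 - gI 0 d| <= e / 2 by apply: hM; lra.
have h2 : `|Num.sqrt pi / 2 - gI 0 (- c)| <= e / 2 by apply: hM; lra.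
move: h1 h2; rewrite !ler_norml; set u := gI 0 d; set v := gI 0 (- c).
move=> /andP[a1 a2] /andP[b1 b2]; apply/andP; split; lra.
Qed.

(** The translates of [0, l) by s + il are adjacent, so their integrals glue together. The 2K + 1
    windows reach from s - Kl to s + (K + 1)l, whence the asymmetric ends. *)
Lemma gauss_zsum (b l s : R) (K : nat) : 0 < b -> 0 < l ->
  \sum_(i <- zrange K) \int[mu]_(y in `[0, l[) expR (- (b ^+ 2) * (y + (s + i%:~R * l)) ^+ 2)
  = b^-1 * gI (b * (s - K%:R * l)) (b * (s + K.+1%:R * l)).
Proof.
move=> b0 l0.
pose J (i : int) := gI (b * (s + i%:~R * l)) (b * (s + (i + 1)%:~R * l)).
have E (i : int) : \int[mu]_(y in `[0, l[) expR (- (b ^+ 2) * (y + (s + i%:~R * l)) ^+ 2) = b^-1 * J i.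
  rewrite gauss_subst ?ltW// /J; have -> // : l + (s + i%:~R * l) = s + (i + 1)%:~R * l.
  rewrite intrD; ring.
under eq_bigr do rewrite E; rewrite -mulr_sumr; congr (_ * _).
have mono (u v : R) : u <= v -> b * (s + u * l) <= b * (s + v * l).
  by move=> uv; rewrite ler_pM2l// lerD2l ler_pM2r.
rewrite big_zrange; elim: K => [|K ih].
  by rewrite big_ord0 addr0 /J mulr0z mulr0n !mul0r subr0 addr0 add0r.
rewrite big_ord_recr/= addrA ih /J.
have n1 : - K%:R = (- K%:Z)%:~R :> R by rewrite mulrNz.
have n2 : - K.+1%:R = (- K.+1%:Z)%:~R :> R by rewrite mulrNz.
have n3 : (- Posz K.+1 + 1)%:~R = - K%:R :> R by rewrite n1; congr (_%:~R); lia.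
have n4 : (Posz K.+1 + 1)%:~R = K.+2%:R :> R by rewrite -[RHS]/((Posz K.+2)%:~R); congr (_%:~R); lia.
have n5 : (Posz K.+1)%:~R = K.+1%:R :> R by [].
rewrite n3 n4 n5 -n2.
have -> : s - K%:R * l = s + (- K%:R) * l by rewrite mulNr.
have -> : s - K.+1%:R * l = s + (- K.+1%:R) * l by rewrite mulNr.
have lo : b * (s + - K.+1%:R * l) <= b * (s + - K%:R * l).
  by apply: mono; rewrite lerN2 ler_nat.
have mid : b * (s + - K%:R * l) <= b * (s + K.+1%:R * l).
  by apply: mono; rewrite (@le_trans _ _ 0)// oppr_le0.
have hi : b * (s + K.+1%:R * l) <= b * (s + K.+2%:R * l).
  by apply: mono; rewrite ler_nat.
rewrite (gauss_glue lo (le_trans mid hi)) (gauss_glue mid hi).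
by rewrite addrA [LHS]addrC addrA.
Qed.

Lemma gauss_zsum_cvg (b l s e : R) : 0 < b -> 0 < l -> 0 < e -> exists K0 : nat,
  forall K, (K0 <= K)%N ->
  `|\sum_(i <- zrange K) \int[mu]_(y in `[0, l[) expR (- (b ^+ 2) * (y + (s + i%:~R * l)) ^+ 2)
    - b^-1 * Num.sqrt pi| <= e.
Proof.
move=> b0 l0 e0; have eb : 0 < e * b by rewrite mulr_gt0.
have [T T0 hT] := gauss_total eb.
(* From this K on, both ends of the tiled interval, scaled by b, lie beyond -T and T. *)
pose X := (T / b + `|s|) / l.
exists (Num.truncn X).+1 => K hK.
have XK : X <= K%:R.
  apply: ltW; apply: (@lt_le_trans _ _ (Num.truncn X).+1%:R); last by rewrite ler_nat.
  exact: truncnS_gt.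
rewrite gauss_zsum// -mulrBr normrM gtr0_norm ?invr_gt0// mulrC ler_pdivrMr//.
have TX : T / b + `|s| <= K%:R * l by rewrite -ler_pdivrMr.
have Tb : T <= b * (K%:R * l - `|s|).
  by rewrite mulrC -ler_pdivrMr// lerBrDr.
have s1 := ler_norm s; have s2 : - s <= `|s| by rewrite -normrN ler_norm.
apply: hT.
  rewrite lerNr; apply: (le_trans Tb); rewrite -mulrN ler_pM2l//; lra.
apply: (le_trans Tb); rewrite ler_pM2l// -natr1 mulrDl; lra.
Qed.

End Calculus.

(** * Inner products of theta series for the Gaussian weight *)

Section ThetaInner.
Context {R : realType}.
Local Notation C := (R[i]).
Local Notation mu := (@lebesgue_measure R).
Local Notation pii := (PI R * iC R).
Implicit Types (k n kap : int).

Lemma cos_sin_2pi n : cos (n%:~R * (2 * pi) : R) = 1 /\ sin (n%:~R * (2 * pi) : R) = 0.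
Proof.
have h : expC (n%:~R * (2 * pii)) = 1 :> C.
  by rewrite expCMz -[2]/(2%:R) expCMn expC_pii sqrrN expr1n exp1rz.
have E : n%:~R * (2 * pii) = 0 +i* (n%:~R * (2 * pi)) :> C.
  rewrite piiE -(rmorph_int (real_complex R)) -(rmorph_nat (real_complex R) 2).
  by apply/eqP; rewrite eq_complex /= !mul0r !mulr0 ?subr0 ?addr0 ?mulr0 ?subrr !eqxx.
move: h; rewrite E -cexpE /cexp /= expR0 mul1r => /eqP; rewrite eq_complex /=.
by move=> /andP[/eqP -> /eqP ->].
Qed.

Variables (L W : R) (p : nat) (m : C).
Hypotheses (L0 : 0 < L) (W0 : 0 < W) (p0 : (0 < p)%N) (m0 : complex.Re m = 0).
Let t := W / L.
Let t0 : 0 < t. Proof. by rewrite divr_gt0. Qed.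
Let a := 2 * pi * p%:R / (L * W).

Definition wt (z : C) : C := (expR (- a * complex.Im z ^+ 2))%:C.

Definition eeint k k' : C :=
  if k == k' then (L * \int[mu]_(y in `[0, W[) expR (- a * y ^+ 2 - 2 * pi * k%:~R * y / L))%:C
  else 0.

(** As k - k' is even, the angle (k - k') pi x/L makes a whole number of turns on [0, L), so the
    x-integral vanishes unless k = k'. *)
Lemma eeint_hasInt2 k k' (u : int) : k - k' = 2 * u ->
  hasInt2 L W (fun z => wt z * (ee k (z / L%:C) * conjc (ee k' (z / L%:C)))) (eeint k k').
Proof.
move=> ku.
pose b (y : R) := expR (- a * y ^+ 2 - (k + k')%:~R * pi * y / L).
pose th : R := (k - k')%:~R * pi / L.
have Ln0 : L != 0 by rewrite gt_eqF.
have zL x y : (x +i* y) / L%:C = (x / L) +i* (y / L).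
  apply: (mulIf (x := L%:C)); first by rewrite eq_complex /= negb_and Ln0.
  rewrite divfK; last by rewrite eq_complex /= negb_and Ln0.
  by apply/eqP; rewrite eq_complex /= !mulr0 subr0 add0r !divfK ?eqxx.
have eeE k1 x y : k1%:~R * pii * (x +i* y) = (- (k1%:~R * pi * y)) +i* (k1%:~R * pi * x) :> C.
  rewrite piiE -(rmorph_int (real_complex R)).
  by apply/eqP; rewrite eq_complex /=; apply/andP; split; apply/eqP; ring.
have FE x y : wt (x +i* y) * (ee k ((x +i* y) / L%:C) * conjc (ee k' ((x +i* y) / L%:C))) =
    (cos (th * x) * b y) +i* (sin (th * x) * b y).
  rewrite /wt -[complex.Im (x +i* y)]/y -expC_real zL /ee !eeE expC_conj -!expCD -cexpE /cexp /= /b.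
  have -> : - a * y ^+ 2 + (- (k%:~R * pi * (y / L)) - k'%:~R * pi * (y / L)) =
      - a * y ^+ 2 - (k + k')%:~R * pi * y / L by rewrite intrD; ring.
  have -> : 0 + (k%:~R * pi * (x / L) - k'%:~R * pi * (x / L)) = th * x.
    by rewrite /th intrD mulrNz; ring.
  by apply/eqP; rewrite eq_complex /= !mul0r subr0 addr0 ![expR _ * _]mulrC !eqxx.
have cb : continuous b.
  rewrite /b => y; apply: (@continuous_comp _ _ _
    (fun y : R => - a * y ^+ 2 - (k + k')%:~R * pi * y / L) expR); last exact: continuous_expR.
  apply: cvgB; first by apply: cvgM; [exact: cvg_cst|exact: exprn_continuous].
  by apply: cvgM; [apply: cvgM; [exact: cvg_cst|exact: cvg_id]|exact: cvg_cst].
have ic : mu.-integrable `[0, L[ (EFin \o (fun x : R => cos (th * x))).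
  apply: continuous_integrable_co.
  apply: (@is_derive_continuous _ _ (fun x => - sin (th * x) * th)) => x.
  exact: is_derive1_comp (is_derive_cos (th * x)) (is_derive_mull th x).
have is_ : mu.-integrable `[0, L[ (EFin \o (fun x : R => sin (th * x))).
  apply: continuous_integrable_co.
  apply: (@is_derive_continuous _ _ (fun x => cos (th * x) * th)) => x.
  exact: is_derive1_comp (is_derive_sin (th * x)) (is_derive_mull th x).
have ib : mu.-integrable `[0, W[ (EFin \o b) by exact: continuous_integrable_co.
have h1 := hasI2_tensor ic ib; have h2 := hasI2_tensor is_ ib.
have thL : th * L = u%:~R * (2 * pi).
  by rewrite /th divfK// ku intrM; ring.
have [cu su] := cos_sin_2pi u; rewrite -thL in cu su.
rewrite /eeint; case: eqP => [kk|kk].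
  have th00 : th = 0 by rewrite /th kk subrr mul0r mul0r.
  have bE : \int[mu]_(y in `[0, W[) expR (- a * y ^+ 2 - 2 * pi * k%:~R * y / L) =
      \int[mu]_(y in `[0, W[) b y.
    by apply: eq_Rintegral => y _; rewrite /b -kk intrD; congr expR; ring.
  have cE : \int[mu]_(x in `[0, L[) cos (th * x) = L.
    rewrite (@eq_Rintegral _ _ _ mu _ (fun=> 1)); last by move=> x _; rewrite th00 mul0r cos0.
    rewrite Rintegral_cst//.
    by have -> : fine (mu `[0%R, L[) = L; rewrite ?mul1r// mu_itv_co// ltW.
  rewrite cE in h1; split => /=.
    by rewrite bE; apply: eq_hasI2 h1 => x y; rewrite FE.
  have h3 := hasI2Z 0 h2; rewrite mul0r in h3.
  by apply: eq_hasI2 h3 => x y; rewrite FE /= th00 !mul0r sin0 mul0r.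
have thn0 : th != 0.
  apply: mulf_neq0; last by rewrite invr_eq0.
  by apply: mulf_neq0; [rewrite intr_eq0 subr_eq0; apply/eqP|rewrite gt_eqF// pi_gt0].
rewrite Rint_cos// mul0r in h1; rewrite Rint_sin// mul0r in h2.
by split; [apply: eq_hasI2 h1|apply: eq_hasI2 h2] => x y; rewrite FE.
Qed.

Definition gam kap n : C :=
  expC (n%:~R * m + lq t * (kap + (2 * p)%:Z * n)%:~R ^+ 2 / (4 * p)%:R).

Definition G kap (z : C) : C := Th t p m kap (z / L%:C).

Definition strip (z : C) := 0 <= complex.Im z <= W.

Lemma Im_divL (z : C) : complex.Im (z / L%:C) = complex.Im z / L.
Proof. by rewrite -fmorphV/= Im_mulr. Qed.

(** On the strip the modulus e^{-k pi y/L} of a mode is monotone in y = Im z, so the sum of its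
    values at y = 0 and y = W is a majorant independent of z, and the Weierstrass test applies. *)
Lemma Th_uniform kap : exists M : R, 0 <= M /\ forall e : R, 0 < e ->
  exists K0, forall K, (K0 <= K)%N -> forall z, strip z ->
   [/\ nm (\sum_(n <- zrange K) Thterm t p m kap (z / L%:C) n - G kap z) <= e,
     nm (G kap z) <= M & nm (\sum_(n <- zrange K) Thterm t p m kap (z / L%:C) n) <= M].
Proof.
pose bd (n : int) : R := nm (Thterm t p m kap 0 n) + nm (Thterm t p m kap (0 +i* t) n).
have [M1 hM1] := asum_Th m kap 0 t0 p0.
have [M2 hM2] := asum_Th m kap (0 +i* t) t0 p0.
have bd0 n : 0 <= bd n by rewrite addr_ge0// nm_ge0.
have hbd (B : seq int) : uniq B -> \sum_(n <- B) bd n <= M1 + M2.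
  by move=> uB; rewrite big_split; apply: lerD; [exact: hM1|exact: hM2].
have M0 : 0 <= M1 + M2 by have := hbd [::] isT; rewrite big_nil.
have ab : asum (fun n => (bd n)%:C : C).
  exists (M1 + M2) => B uB; apply: le_trans (hbd B uB).
  by apply: ler_sum => n _; rewrite nm_real ger0_norm.
have le_bd z : strip z -> forall n, nm (Thterm t p m kap (z / L%:C) n) <= nm ((bd n)%:C : C).
  move=> /andP[y0 yW] n; rewrite nm_real ger0_norm// /bd /Thterm !nmM -mulrDr.
  rewrite ler_wpM2l ?nm_ge0//; set k := kap + _.
  have nmee (x : C) : nm (ee k x) = expR (- (k%:~R * pi * complex.Im x)).
    rewrite /ee nm_expC -mulrA Re_intM piiE; congr expR; case: x => x1 x2 /=; ring.
  rewrite !nmee Im_divL /= mulr0 oppr0 expR0.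
  have yt : complex.Im z / L <= t by rewrite ler_pM2r// invr_gt0.
  have yL : 0 <= complex.Im z / L by rewrite divr_ge0// ltW.
  have [k0|k0] := leP 0 (k%:~R * pi : R).
    apply: (@le_trans _ _ 1); last by rewrite lerDl expR_ge0.
    by rewrite -[X in _ <= X]expR0 ler_expR oppr_le0 mulr_ge0.
  apply: (@le_trans _ _ (expR (- (k%:~R * pi * t)))); last by rewrite lerDr.
  by rewrite ler_expR lerN2 ler_nM2l.
have hs z : strip z -> hasSum (Thterm t p m kap (z / L%:C)) (G kap z).
  by move=> _; exact: hasSum_Th.
have unif := hasSum_uniform ab le_bd hs.
have bdT z (B : seq int) : strip z -> uniq B -> nm (\sum_(n <- B) Thterm t p m kap (z / L%:C) n) <= M1 + M2.
  move=> sz uB; apply: (le_trans (nm_sum _ _ _)); apply: le_trans (hbd B uB).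
  apply: ler_sum => n _; have := le_bd z sz n.
  by rewrite nm_real ger0_norm.
exists (M1 + M2); split => // e e0.
have [A hA] := unif e e0; have [K0 hK0] := sub_zrange A.
exists K0 => K hK z sz; split.
- by apply: (hA _ (zrange_uniq K)) => // i iA; apply: zrangeS hK _ _; exact: hK0.
- apply/ler_addgt0Pr => d d0.
  have [A' hA'] := unif d d0; have := hA' (undup A') (undup_uniq _).
  move=> /(_ _)/wrap[i|/(_ z sz) h]; first by rewrite mem_undup.
  have := nm_triangle (\sum_(n <- undup A') Thterm t p m kap (z / L%:C) n) (G kap z) 0.
  rewrite !subr0 nm_distC => /le_trans; apply; rewrite addrC; apply: lerD => //.
  exact: bdT (undup_uniq _).
- exact: bdT (zrange_uniq K).
Qed.

Lemma a_gt0 : 0 < a.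
Proof. by rewrite /a divr_gt0// ?mulr_gt0 ?pi_gt0 ?ltr0n. Qed.

(** The truncated series converge uniformly on the strip and the weight is at most 1, so only the
    limit of the finite double sums has to be found. *)
Lemma inner_lim kap kap' (u : int) S : kap - kap' = 2 * u ->
  (forall e : R, 0 < e -> exists K0, forall K, (K0 <= K)%N ->
    nm (\sum_(n <- zrange K) \sum_(n' <- zrange K) gam kap n * conjc (gam kap' n') *
      eeint (kap + (2 * p)%:Z * n) (kap' + (2 * p)%:Z * n') - S) <= e) ->
  hasInt2 L W (fun z => wt z * (G kap z * conjc (G kap' z))) S.
Proof.
move=> ku hS; apply: hasInt2_lim => // e e0.
have [M [M0 hM]] := Th_uniform kap; have [M' [M0' hM']] := Th_uniform kap'.
pose d := e / (M + M' + 1); have MM : 0 < M + M' + 1 by rewrite ltr_wpDl// addr_ge0.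
have d0 : 0 < d by rewrite divr_gt0.
have [K1 hK1] := hS e e0; have [K2 hK2] := hM d d0; have [K3 hK3] := hM' d d0.
pose K := (K1 + K2 + K3)%N.
have l1 : (K1 <= K)%N by rewrite /K -addnA leq_addr.
have l2 : (K2 <= K)%N by rewrite /K addnAC leq_addl.
have l3 : (K3 <= K)%N by rewrite /K leq_addl.
pose T kp z := \sum_(n <- zrange K) Thterm t p m kp (z / L%:C) n.
exists (fun z => wt z * (T kap z * conjc (T kap' z))), (\sum_(n <- zrange K) \sum_(n' <- zrange K) gam kap n * conjc (gam kap' n') *
      eeint (kap + (2 * p)%:Z * n) (kap' + (2 * p)%:Z * n')).
split; last exact: hK1.
- have term n n' : hasInt2 L W (fun z => gam kap n * conjc (gam kap' n') *
     (wt z * (ee (kap + (2 * p)%:Z * n) (z / L%:C) * conjc (ee (kap' + (2 * p)%:Z * n') (z / L%:C)))))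
     (gam kap n * conjc (gam kap' n') * eeint (kap + (2 * p)%:Z * n) (kap' + (2 * p)%:Z * n')).
    apply: hasInt2Z; apply: (@eeint_hasInt2 _ _ (u + p%:Z * (n - n'))).
    have -> : (2 * p)%:Z = 2 * p%:Z by lia.
    by rewrite !mulrDr -ku; ring.
  apply: eq_hasInt2 (hasInt2_sum (zrange K) (fun n => hasInt2_sum (zrange K) (term n))) => z /=.
  rewrite /T rmorph_sum/= mulr_suml mulr_sumr; apply: eq_bigr => n _.
  rewrite mulr_sumr mulr_sumr; apply: eq_bigr => n' _.
  rewrite /Thterm -/(gam kap n) -/(gam kap' n') rmorphM/=; ring.
- move=> x y Lx /=; rewrite in_itv/= => /andP[y0' yW]; set z := x +i* y.
  have sz : strip z by rewrite /strip /z /= y0' ltW.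
  have [a1 a2 a3] := hK2 K l2 z sz; have [b1 b2 b3] := hK3 K l3 z sz.
  rewrite -/(T kap z) in a1 a3; rewrite -/(T kap' z) in b1 b3.
  have -> : wt z * (G kap z * conjc (G kap' z)) - wt z * (T kap z * conjc (T kap' z)) =
     wt z * ((G kap z - T kap z) * conjc (G kap' z) + T kap z * conjc (G kap' z - T kap' z)).
    rewrite rmorphB/=; ring.
  have w1 : nm (wt z) <= 1.
    rewrite /wt nm_real ger0_norm ?expR_ge0// -[X in _ <= X]expR0 ler_expR mulNr oppr_le0.
    by rewrite mulr_ge0 ?sqr_ge0// ltW// a_gt0.
  rewrite nmM; apply: (@le_trans _ _ (1 * (d * M' + M * d))).
    apply: ler_pM; rewrite ?nm_ge0//; apply: (le_trans (nmD _ _)).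
    by apply: lerD; rewrite nmM nm_conj; apply: ler_pM; rewrite ?nm_ge0// nm_distC.
  rewrite mul1r mulrC -mulrDl addrC /d mulrCA ger_pMr// ler_pdivrMr// mul1r; lra.
Qed.

(** Different classes modulo 2p share no frequency, so every term of the double sum vanishes. *)
Lemma inner_diff kap kap' (u : int) : kap - kap' = 2 * u ->
  (forall j : int, kap - kap' != (2 * p)%:Z * j) ->
  hasInt2 L W (fun z => wt z * (G kap z * conjc (G kap' z))) 0.
Proof.
move=> ku kj; apply: (inner_lim ku) => e e0; exists 0%N => K _.
rewrite big1 ?subr0 ?nm0 ?ltW// => n _; rewrite big1// => n' _.
rewrite /eeint; case: eqP => [E|_]; last by rewrite mulr0.
have := kj (n' - n); rewrite mulrBr => /eqP; case; lia.
Qed.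

Lemma zconj (z : C) : z * conjc z = (nm z ^+ 2)%:C.
Proof. by rewrite -sqr_normc nmE rmorphXn. Qed.

(** Only the diagonal survives. By completing the square, the mode k = kap + 2pn contributes the
    integral of exp(-a (y + kW/(2p))^2) over [0, W). The shift kW/(2p) grows by exactly W with n, so
    the windows tile the line. *)
Lemma inner_same kap :
  hasInt2 L W (fun z => wt z * (G kap z * conjc (G kap z)))
    (L * ((Num.sqrt a)^-1 * Num.sqrt pi))%:C.
Proof.
have a0 := a_gt0.
pose b := Num.sqrt a; have b0 : 0 < b by rewrite sqrtr_gt0.
have b2 : b ^+ 2 = a by rewrite sqr_sqrtr// ltW.
have u0 : kap - kap = 2 * 0 by rewrite subrr mulr0.
apply: (inner_lim u0) => e e0.
have eL : 0 < e / L by rewrite divr_gt0.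
pose s : R := kap%:~R * W / (2 * p%:R).
have pn0 : p%:R != 0 :> R by rewrite pnatr_eq0 -lt0n.
have Ln0 : L != 0 by rewrite gt_eqF.
have Wn0 : W != 0 by rewrite gt_eqF.
have [K0 hK0] := gauss_zsum_cvg s b0 W0 eL; exists K0 => K hK.
have diag n : \sum_(n' <- zrange K) gam kap n * conjc (gam kap n') *
      eeint (kap + (2 * p)%:Z * n) (kap + (2 * p)%:Z * n') =
    (if n \in zrange K then gam kap n * conjc (gam kap n) *
      eeint (kap + (2 * p)%:Z * n) (kap + (2 * p)%:Z * n) else 0).
  have off n' : n' != n -> gam kap n * conjc (gam kap n') *
      eeint (kap + (2 * p)%:Z * n) (kap + (2 * p)%:Z * n') = 0.
    move=> nn; rewrite /eeint; case: eqP => [E|_]; last by rewrite mulr0.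
    by move/eqP: nn; case; nia.
  case: ifP => nK; last by rewrite big1_seq// => n' /= n'K; rewrite off//; apply: contraTneq n'K => ->; rewrite nK.
  rewrite (bigD1_seq n)//=; last exact: zrange_uniq.
  by rewrite big1 ?addr0// => n' nn; exact: off.
have val n : gam kap n * conjc (gam kap n) * eeint (kap + (2 * p)%:Z * n) (kap + (2 * p)%:Z * n) =
    (L * \int[mu]_(y in `[0, W[) expR (- (b ^+ 2) * (y + (s + n%:~R * W)) ^+ 2))%:C.
  rewrite zconj /eeint eqxx -rmorphM/=; congr (_%:C).
  set k := kap + (2 * p)%:Z * n.
  have nmg : nm (gam kap n) ^+ 2 = expR (- (pi * t) * k%:~R ^+ 2 / (2 * p%:R)).
    rewrite /gam nm_expC -expRM_natl; congr expR.
    rewrite raddfD/= Re_intM m0 mulr0 add0r -/k /lq.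
    have -> : (- (pi * t))%:C * k%:~R ^+ 2 / (4 * p)%:R = (- (pi * t) * k%:~R ^+ 2 / (4 * p%:R))%:C :> C.
      rewrite rmorphM/= rmorphM/= rmorphXn/= fmorphV/= rmorphM/= rmorph_int !rmorph_nat natrM.
      by [].
    by rewrite /=; field.
  rewrite nmg mulrCA; congr (_ * _).
  rewrite -RintegralZl//; last first.
    apply: continuous_integrable_co => y; apply: (@continuous_comp _ _ _
      (fun y : R => - a * y ^+ 2 - 2 * pi * k%:~R * y / L) expR); last exact: continuous_expR.
    apply: cvgB; first by apply: cvgM; [exact: cvg_cst|exact: exprn_continuous].
    by apply: cvgM; [apply: cvgM; [exact: cvg_cst|exact: cvg_id]|exact: cvg_cst].
  apply: eq_Rintegral => y _; rewrite -expRD; congr expR.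
  have -> : s + n%:~R * W = k%:~R * W / (2 * p%:R).
    rewrite /s /k intrD intrM PoszM intrM /=; field.
    by rewrite pn0.
  rewrite b2 /a /t; field.
  by rewrite Ln0 Wn0 pn0.
under eq_bigr do rewrite diag val.
rewrite -big_mkcond/= -big_seq -rmorph_sum/= -rmorphB/= nm_real.
rewrite -mulr_sumr -mulrBr normrM (gtr0_norm L0) mulrC -ler_pdivlMr//.
exact: hK0.
Qed.

End ThetaInner.

(** * Orthogonality and norms of the functions M_j *)

Section Orthogonality.
Context {R : realType}.
Local Notation C := (R[i]).
Local Notation pii := (PI R * iC R).
Variables (L W : R) (r : rsys) (N : nat).
Hypotheses (L0 : 0 < L) (W0 : 0 < W) (v : valid r N).
Local Notation p := (calN r N).
Local Notation t := (W / L).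
Let t0 : 0 < t. Proof. by rewrite divr_gt0. Qed.
Let p0 : (0 < p)%N. Proof. exact: calN_gt0. Qed.
Local Notation GG kap := (G L W p (@mR R r) kap).
Let m0 : complex.Re (@mR R r) = 0.
Proof. by rewrite /mR; case: r; rewrite ?piiE. Qed.

(** The integer factor of h_j. It is 4 where kap and -kap agree modulo 2p, so that [Mb] is twice one
    series, and 2 where they give two orthogonal series; in type A there is a single series. *)
Definition nuR (j : nat) : nat := match r with
  | RA => 1 | RC | RCv | RBC => 2 | RB | RBv => if j.+1 == 1%N then 4 else 2
  | RD => if (j.+1 == 1%N) || (j.+1 == N) then 4 else 2 end.

Definition gauss_norm : R := L * ((Num.sqrt (2 * pi * p%:R / (L * W)))^-1 * Num.sqrt pi).

Lemma MbG j z : Mb r N t j (z / L%:C) = GG (kapR r N j) z + @sgR R r * GG (- kapR r N j) z.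
Proof. by rewrite /Mb Th_neg//; exact: mR_N. Qed.

Lemma conj_sg (A B : C) : conjc (A + sgR r * B) = conjc A + sgR r * conjc B.
Proof.
rewrite rmorphD rmorphM /=; congr (_ + _ * _).
by rewrite /sgR; case: r; rewrite ?rmorph0 ?rmorph1 ?rmorphN1.
Qed.

Lemma GG_shift kap z : GG (kap + (2 * p)%:Z) z = expC (- @mR R r) * GG kap z.
Proof. exact: Th_shift. Qed.

Lemma not_multiple (d q : int) : 0 < q -> - q < d < q -> d != 0 -> forall j : int, d != q * j.
Proof.
move=> q0 /andP[d1 d2] d0 j; apply/eqP => E.
have [j0|[j1|j1]] : j = 0 \/ 1 <= j \/ 1 <= - j by lia.
- by move: d0; rewrite E j0 mulr0 eqxx.
- by move: d2; rewrite E gtr_pMr// ltNge j1.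
- by move: d1; rewrite E -[q * j]opprK -mulrN ltrN2 gtr_pMr// ltNge j1.
Qed.

(** For distinct frequencies in [-p, 0] the sum and the difference are nonzero and strictly between
    -2p and 2p, so the frequencies stay distinct modulo 2p under changes of sign. *)
Lemma kap_bounds j : (j < N)%N -> r <> RA -> - p%:Z <= kapR r N j <= 0.
Proof.
case: v => N0 ND; rewrite /kapR; move: (ND); case: r => //= ND' jN _; try lia.
Qed.

Lemma inner0 kap kap' (u : int) : kap - kap' = 2 * u -> - (2 * p)%:Z < kap - kap' < (2 * p)%:Z ->
  kap - kap' != 0 -> hasInt2 L W (fun z => wt L W p z * (GG kap z * conjc (GG kap' z))) 0.
Proof.
move=> ku kb kn; apply: (inner_diff _ L0 W0 p0 ku).
by apply: not_multiple => //; have := p0; lia.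
Qed.

Lemma innerH kap : hasInt2 L W (fun z => wt L W p z * (GG kap z * conjc (GG kap z))) gauss_norm%:C.
Proof. exact: inner_same. Qed.

Lemma Mb_inner_same j : (j < N)%N ->
  hasInt2 L W (fun z => wt L W p z * (Mb r N t j (z / L%:C) * conjc (Mb r N t j (z / L%:C))))
   ((nuR j)%:R * gauss_norm%:C).
Proof.
move=> jN; set kap := kapR r N j.
have [rA|rA] := pselect (r = RA).
  have -> : (nuR j)%:R * gauss_norm%:C = gauss_norm%:C :> C by rewrite /nuR rA mul1r.
  apply: eq_hasInt2 (innerH kap) => z; rewrite MbG.
  have -> : @sgR R r = 0 by rewrite rA.
  by rewrite mul0r addr0.
have s2 : @sgR R r * @sgR R r = 1 by move: rA; case: r => //= _; rewrite ?mul1r ?mulrNN ?mul1r.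
have kb := kap_bounds jN rA; rewrite -/kap in kb.
have four (w : C) : (forall z, Mb r N t j (z / L%:C) = w * GG kap z) -> w * conjc w = 4%:R -> nuR j = 4%N ->
    hasInt2 L W (fun z => wt L W p z * (Mb r N t j (z / L%:C) * conjc (Mb r N t j (z / L%:C))))
   ((nuR j)%:R * gauss_norm%:C).
  move=> hw w4 ->; rewrite -w4; apply: eq_hasInt2 (hasInt2Z (w * conjc w) (innerH kap)) => z.
  by rewrite hw rmorphM/=; ring.
(* The frequency 0 occurs only for the last function of D_N, where both halves of [Mb] coincide. *)
have [k0|kn0] := eqVneq kap 0.
  have rD : r = RD /\ j.+1 = N.
    case: v => N0 ND; move: k0 jN rA ND; rewrite /kap /kapR; case: r => //= k0 jN _ ND; try (exfalso; lia).
    by split => //; lia.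
  apply: (four 2%:R); last by rewrite /nuR rD.1 rD.2 eqxx orbT.
    move=> z; rewrite MbG -/kap k0 oppr0 rD.1 /=; ring.
  by rewrite conjc_nat -natrM.
(* The frequency -p occurs only for the first function of B_N, B_N^vee and D_N. As p and -p differ
   by 2p and [sgR] compensates the multiplier, the halves coincide again. *)
have [kp|knp] := eqVneq kap (- p%:Z).
  have j0 : j = 0%N /\ @sgR R r * expC (- @mR R r) = 1 /\ r <> RC /\ r <> RCv /\ r <> RBC.
    case: v => N0 ND; move: kp jN rA ND; rewrite /kap /kapR; case: r => //= kp jN _ ND; try (exfalso; lia).
    - by rewrite expCN expC_pii invrN invr1 mulrNN mulr1; do !split => //; lia.
    - by rewrite expCN expC_pii invrN invr1 mulrNN mulr1; do !split => //; lia.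
    - by have := ND erefl; rewrite oppr0 expC0 mulr1; do !split => //; lia.
  case: j0 => j0 [s1 [r1 [r2 r3]]].
  apply: (four 2%:R); last by rewrite /nuR j0; move: rA r1 r2 r3; case: r.
    move=> z; rewrite MbG -/kap kp opprK.
    have -> : GG p%:Z z = GG (- p%:Z + (2 * p)%:Z) z by congr (GG _ z); lia.
    by rewrite GG_shift mulrA s1 mul1r; ring.
  by rewrite conjc_nat -natrM.
have nu2 : nuR j = 2%N.
  case: v => N0 ND; move: kn0 knp jN rA ND; rewrite /kap /kapR /nuR; case: r => //= kn0 knp jN _ ND.
  - by case: ifP => // /eqP; lia.
  - by case: ifP => // /eqP; lia.
  - have := ND erefl => N2; case: ifP => // /orP[/eqP|/eqP]; lia.
have e1 : kap - (- kap) = 2 * kap by ring.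
have e2 : - kap - kap = 2 * (- kap) by ring.
have i1 := @inner0 kap (- kap) _ e1.
have i2 := @inner0 (- kap) kap _ e2.
have {}i1 : hasInt2 L W (fun z => wt L W p z * (GG kap z * conjc (GG (- kap) z))) 0.
  by apply: i1; lia.
have {}i2 : hasInt2 L W (fun z => wt L W p z * (GG (- kap) z * conjc (GG kap z))) 0.
  by apply: i2; lia.
have := hasInt2D (hasInt2D (innerH kap) (innerH (- kap))) (hasInt2D (hasInt2Z (@sgR R r) i1) (hasInt2Z (@sgR R r) i2)).
have -> : gauss_norm%:C + gauss_norm%:C + (@sgR R r * 0 + @sgR R r * 0) = (nuR j)%:R * gauss_norm%:C by rewrite nu2; ring.
apply: eq_hasInt2 => z; rewrite MbG -/kap conj_sg.
have E (w A B A' B' s : C) : s * s = 1 -> w * (A * A') + w * (B * B') +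
    (s * (w * (A * B')) + s * (w * (B * A'))) = w * ((A + s * B) * (A' + s * B')).
  by move=> ss; rewrite -[w * (B * B')]mul1r -ss; ring.
exact: E.
Qed.

Lemma Mb_inner_diff j k : (j < N)%N -> (k < N)%N -> j != k ->
  hasInt2 L W (fun z => wt L W p z * (Mb r N t j (z / L%:C) * conjc (Mb r N t k (z / L%:C)))) 0.
Proof.
move=> jN kN jk; set a := kapR r N j; set b := kapR r N k.
have ab : a - b = 2 * (j%:Z - k%:Z) by rewrite /a /b /kapR; lia.
have ba : - a - - b = 2 * (k%:Z - j%:Z) by rewrite /a /b /kapR; lia.
have ab0 : a - b != 0 by rewrite ab; apply: contra jk => /eqP; move=> ?; apply/eqP; lia.
have abp : - (2 * p)%:Z < a - b < (2 * p)%:Z.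
  case: v => N0 ND; rewrite ab; move: ND; case: r => //= ND; try lia.

have i1 : hasInt2 L W (fun z => wt L W p z * (GG a z * conjc (GG b z))) 0.
  exact: inner0 ab abp ab0.
have [rA|rA] := pselect (r = RA).
  apply: eq_hasInt2 i1 => z; rewrite !MbG.
  have -> : @sgR R r = 0 by rewrite rA.
  by rewrite !mul0r !addr0.
have ha := kap_bounds jN rA; have hb := kap_bounds kN rA; rewrite -/a in ha; rewrite -/b in hb.
have i2 : hasInt2 L W (fun z => wt L W p z * (GG (- a) z * conjc (GG (- b) z))) 0.
  by apply: inner0 ba _ _; lia.
have apb : a - - b = 2 * (kap0 r N + j%:Z + k%:Z) by rewrite /a /b /kapR; lia.
have apb' : - a - b = 2 * (- (kap0 r N + j%:Z + k%:Z)) by rewrite /a /b /kapR; lia.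
have ij : a != b by rewrite -subr_eq0.
have i3 : hasInt2 L W (fun z => wt L W p z * (GG a z * conjc (GG (- b) z))) 0.
  by apply: inner0 apb _ _; lia.
have i4 : hasInt2 L W (fun z => wt L W p z * (GG (- a) z * conjc (GG b z))) 0.
  by apply: inner0 apb' _ _; lia.
have := hasInt2D (hasInt2D i1 (hasInt2Z (@sgR R r * @sgR R r) i2)) (hasInt2D (hasInt2Z (@sgR R r) i3) (hasInt2Z (@sgR R r) i4)).
rewrite !mulr0 !addr0; apply: eq_hasInt2 => z; rewrite !MbG -/a -/b conj_sg; ring.
Qed.

End Orthogonality.

(** * Determinantal structure *)

Section Bordered.
Local Open Scope ring_scope.

(** The Schur complement without division: a block triangular matrix made from [\adj A] clears the
    last column, and nonzero determinants are cancelled at the end. *)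
Lemma det_bordered_domain (F : idomainType) (m : nat) (A : 'M[F]_m) (u : 'cV[F]_m) (v : 'rV[F]_m) (d : 'M[F]_1) :
  \det A != 0 ->
  \det (block_mx A u v d) = d 0 0 * \det A - (v *m \adj A *m u) 0 0.
Proof.
move=> dA.
have adjn0 : \det (\adj A) != 0.
  have := congr1 determinant (mul_mx_adj A); rewrite det_mulmx det_scalar => E.
  by apply/eqP => h; move: E; rewrite h mulr0 => /esym/eqP; rewrite expf_eq0 (negPf dA) andbF.
have E : block_mx A u v d *m block_mx (\adj A) (- (\adj A *m u)) 0 (\det A)%:M =
    block_mx (\det A)%:M 0 (v *m \adj A) (\det A *: d - v *m \adj A *m u).
  rewrite mulmx_block !mulmx0 !addr0 mul_mx_adj mulmxN mulmxA mul_mx_adj mul_scalar_mx mul_mx_scalar addNr.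
  by rewrite mulmxN mulmxA mul_mx_scalar addrC.
have := congr1 determinant E; rewrite det_mulmx det_ublock det_lblock det_scalar1 det_scalar.
have := congr1 determinant (mul_mx_adj A); rewrite det_mulmx det_scalar => <-.
rewrite [X in _ = _ * X]det_mx11 !mxE [\det A * \det (\adj A)]mulrC [LHS]mulrC.
by move=> /(mulfI (mulf_neq0 adjn0 dA)) ->; rewrite [\det A * _]mulrC.
Qed.

Local Notation ev := (horner_eval 0).

(** A may be singular, as kernel matrices are at coinciding points. It is deformed to X + A, written
    [char_poly_mx (- A)], whose determinant is monic in X; then X is set to 0. *)
Lemma det_bordered (F : fieldType) (m : nat) (A : 'M[F]_m) (u : 'cV[F]_m) (v : 'rV[F]_m) (d : 'M[F]_1) :
  \det (block_mx A u v d) = d 0 0 * \det A - (v *m \adj A *m u) 0 0.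
Proof.
pose A' := char_poly_mx (- A).
have evC k l (B : 'M[F]_(k, l)) : map_mx ev (map_mx polyC B) = B.
  by apply/matrixP => i j; rewrite !mxE /horner_eval hornerC.
have evA : map_mx ev A' = A.
  apply/matrixP => i j; rewrite !mxE /horner_eval hornerD hornerN hornerC opprK.
  by rewrite hornerMn hornerX mul0rn add0r.
have dA' : \det A' != 0 by rewrite monic_neq0// char_poly_monic.
have := det_bordered_domain (map_mx polyC u) (map_mx polyC v) (map_mx polyC d) dA'.
move=> /(congr1 ev); rewrite rmorphB rmorphM /= -!det_map_mx map_block_mx !evC evA => ->.
congr (_ * _ - _); first by rewrite mxE /horner_eval hornerC.
have -> (B : 'M[{poly F}]_1) : ev (B 0 0) = (map_mx ev B) 0 0 by rewrite mxE.
by rewrite !map_mxM map_mx_adj !evC evA.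
Qed.

End Bordered.

Section Determinantal.
Context {R : realType}.
Local Notation C := (R[i]).
Local Notation mu := (@lebesgue_measure R).
Variables (L W : R) (N : nat) (phi : 'I_N -> C -> C) (h : 'I_N -> C).
Hypotheses (h_neq0 : forall j, h j != 0) (h_real : forall j, conjc (h j) = h j).
Hypothesis phi_orth : forall j k,
  hasInt2 L W (fun w => phi j w * conjc (phi k w)) (if j == k then h j else 0).

Definition Kphi (z w : C) : C := \sum_j (h j)^-1 * (phi j z * conjc (phi j w)).

Definition Kmx (m : nat) (z : nat -> C) : 'M[C]_m := \matrix_(i < m, j < m) Kphi (z i) (z j).

Definition Kdet (m : nat) (z : nat -> C) : C := \det (Kmx m z).

Lemma Kphi_conj z w : conjc (Kphi z w) = Kphi w z.
Proof.
rewrite /Kphi rmorph_sum; apply: eq_bigr => j _ /=.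
by rewrite !rmorphM/= fmorphV/= h_real conjcK [conjc _ * phi j w]mulrC.
Qed.

Lemma Kdet_real m z : (complex.Re (Kdet m z))%:C = Kdet m z.
Proof.
have E : conjc (Kdet m z) = Kdet m z.
  rewrite /Kdet -det_map_mx -[RHS]det_tr; congr (\det _).
  by apply/matrixP => i j; rewrite !mxE /= Kphi_conj.
by rewrite ReJ_add E -mulr2n -[_ *+ 2]mulr_natr mulfK ?pnatr_eq0.
Qed.

Lemma Kphi_trace : hasInt2 L W (fun w => Kphi w w) N%:R.
Proof.
have -> : N%:R = \sum_(j < N) (h j)^-1 * h j :> C.
  by under eq_bigr do rewrite mulVf//; rewrite sumr_const card_ord.
apply: hasInt2_sum => j; apply: hasInt2Z.
by have := phi_orth j j; rewrite eqxx.
Qed.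

(** The reproducing property: orthogonality reduces the double sum to its diagonal. *)
Lemma Kphi_repr a b : hasInt2 L W (fun w => Kphi a w * Kphi w b) (Kphi a b).
Proof.
have term j k : hasInt2 L W
    (fun w => (h j)^-1 * (h k)^-1 * phi j a * conjc (phi k b) * (phi k w * conjc (phi j w)))
    ((h j)^-1 * (h k)^-1 * phi j a * conjc (phi k b) * (if k == j then h k else 0)).
  by apply: hasInt2Z.
have := hasInt2_sum (index_enum 'I_N) (fun j => hasInt2_sum (index_enum 'I_N) (term j)).
have -> : \sum_j \sum_k (h j)^-1 * (h k)^-1 * phi j a * conjc (phi k b) * (if k == j then h k else 0) = Kphi a b.
  apply: eq_bigr => j _; rewrite (bigD1 j)//= big1 ?addr0 => [|k /negPf ->]; last by rewrite mulr0.
  by rewrite eqxx; field.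
apply: eq_hasInt2 => w; rewrite /Kphi mulr_suml; apply: eq_bigr => j _.
rewrite mulr_sumr; apply: eq_bigr => k _; ring.
Qed.

(** Border expansion in the new variable: the corner integrates to the trace N, and by the
    reproducing property the rest becomes the trace of adj(K) K, which is m det K. *)
Lemma Kdet_step m z :
  hasInt2 L W (fun w => Kdet m.+1 (upd z m w)) ((N%:R - m%:R) * Kdet m z).
Proof.
have updm w : upd z m w m = w by rewrite /upd eqxx.
have updl w (i : 'I_m) : upd z m w i = z i by rewrite /upd ltn_eqF.
have E w : Kdet m.+1 (upd z m w) = Kphi w w * Kdet m z -
    \sum_j \sum_i \adj (Kmx m z) j i * (Kphi (z i) w * Kphi w (z j)).
  have -> : Kdet m.+1 (upd z m w) = Kdet (m + 1) (upd z m w) by rewrite addn1.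
  have -> : Kdet (m + 1) (upd z m w) = \det (block_mx (Kmx m z)
     (\col_i Kphi (z i) w) (\row_j Kphi w (z j)) (Kphi w w)%:M).
    congr (\det _); apply/matrixP => i j; rewrite mxE.
    case: (splitP i) => i' ii; case: (splitP j) => j' jj.
    - have -> : i = lshift 1 i' by apply: ord_inj.
      have -> : j = lshift 1 j' by apply: ord_inj.
      by rewrite block_mxEul mxE /= !updl.
    - have -> : i = lshift 1 i' by apply: ord_inj.
      have -> : j = rshift m j' by apply: ord_inj.
      by rewrite block_mxEur mxE /= (ord1 j') addn0 updl updm.
    - have -> : i = rshift m i' by apply: ord_inj.
      have -> : j = lshift 1 j' by apply: ord_inj.
      by rewrite block_mxEdl mxE /= (ord1 i') addn0 updl updm.
    - have -> : i = rshift m i' by apply: ord_inj.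
      have -> : j = rshift m j' by apply: ord_inj.
      by rewrite block_mxEdr mxE /= (ord1 i') (ord1 j') addn0 updm eqxx mulr1n.
  rewrite det_bordered !mxE eqxx mulr1n; congr (_ - _).
  rewrite exchange_big/=; apply: eq_bigr => i _; rewrite !mxE mulr_suml.
  by apply: eq_bigr => j _; rewrite !mxE; ring.
have int1 : hasInt2 L W (fun w => Kdet m z * Kphi w w) (Kdet m z * N%:R).
  exact: hasInt2Z Kphi_trace.
have term j i : hasInt2 L W (fun w => \adj (Kmx m z) j i * (Kphi (z i) w * Kphi w (z j)))
    (\adj (Kmx m z) j i * Kmx m z i j).
  by rewrite [Kmx m z i j]mxE; apply: hasInt2Z; exact: Kphi_repr.
have int2 := hasInt2_sum (index_enum 'I_m) (fun j => hasInt2_sum (index_enum 'I_m) (term j)).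
have := hasInt2D int1 (hasInt2Z (-1) int2).
have -> : Kdet m z * N%:R + -1 * \sum_j \sum_i \adj (Kmx m z) j i * Kmx m z i j =
    (N%:R - m%:R) * Kdet m z.
  have -> : \sum_j \sum_i \adj (Kmx m z) j i * Kmx m z i j = \tr (\adj (Kmx m z) *m Kmx m z).
    by apply: eq_bigr => j _; rewrite mxE.
  by rewrite mul_adj_mx mxtrace_scalar -mulr_natl -/(Kdet m z); ring.
by apply: eq_hasInt2 => w; rewrite E mulN1r [X in X - _]mulrC.
Qed.

Lemma intLam_Kdet (c : R) (k m : nat) (z : nat -> C) : (m + k = N)%N ->
  intLam L W k m (fun z => c * complex.Re (Kdet N z)) z = c * k`!%:R * complex.Re (Kdet m z).
Proof.
elim: k m z => [|k ih] m z mk /=; first by rewrite -mk addn0 fact0 mulr1.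
have mk' : (m.+1 + k = N)%N by rewrite addSnnS.
have [[_ _ H] _] := hasInt2Z (c * k`!%:R)%:C (Kdet_step m z).
transitivity (\int[mu]_(x in `[0, L[) \int[mu]_(y in `[0, W[)
    complex.Re ((c * k`!%:R)%:C * Kdet m.+1 (upd z m (x +i* y)))).
  apply: eq_Rintegral => x _; apply: eq_Rintegral => y _.
  by rewrite ih// [X in _ = complex.Re X]mulrC Re_mulr mulrC.
rewrite H; have -> : N%:R - m%:R = (k.+1%:R : R)%:C :> C.
  by rewrite rmorph_nat -mk natrD addrAC subrr add0r.
rewrite -Kdet_real -!rmorphM/= factS natrM; ring.
Qed.

End Determinantal.

(** * The point process: density, correlation functions and periodicity *)

Section Process.
Context {R : realType}.
Local Notation C := (R[i]).
Local Notation pii := (PI R * iC R).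
Variables (L W : R) (r : rsys) (N : nat).
Hypotheses (L0 : 0 < L) (W0 : 0 < W) (v : valid r N).
Local Notation p := (calN r N).
Local Notation t := (W / L).
Let t0 : 0 < t. Proof. by rewrite divr_gt0. Qed.
Let p0 : (0 < p)%N. Proof. exact: calN_gt0. Qed.
Let Ln0 : L != 0. Proof. by rewrite gt_eqF. Qed.
Let Wn0 : W != 0. Proof. by rewrite gt_eqF. Qed.
Let pn0 : p%:R != 0 :> R. Proof. by rewrite pnatr_eq0 -lt0n. Qed.

Definition Mcoef (j : nat) : C :=
  cM r * expC (- (lq t * (Jf R r j.+1)%:C ^+ 2 / p%:R)).

Lemma Mcoef_neq0 j : Mcoef j != 0.
Proof.
rewrite mulf_neq0 ?expC_neq0// /cM; case: (r); rewrite ?oner_neq0//;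
by rewrite /iC eq_complex /= negb_and oner_neq0 orbT.
Qed.

Definition sqrt_wt (z : C) : R := expR (- pi * p%:R * complex.Im z ^+ 2 / (L * W)).

Lemma sqrt_wt_sqr z : (sqrt_wt z)%:C * (sqrt_wt z)%:C = wt L W p z.
Proof.
rewrite -rmorphM/= -expRD /wt; congr ((expR _)%:C); field.
by rewrite Ln0 Wn0.
Qed.

(** M_j with half of the Gaussian weight absorbed, so that orthogonality holds for plain Lebesgue
    measure on the fundamental domain. *)
Definition phiR (j : 'I_N) (z : C) : C := (sqrt_wt z)%:C * (Mcoef j * Mb r N t j (z / L%:C)).

Definition hR (j : 'I_N) : C := Mcoef j * conjc (Mcoef j) * ((nuR r N j)%:R * (gauss_norm L W r N)%:C).

Lemma gauss_normE : gauss_norm L W r N = L * W / Num.sqrt (2 * p%:R * (W / L)).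
Proof.
have q0 : 0 < 2 * p%:R / (L * W) by rewrite divr_gt0 ?mulr_gt0 ?ltr0n.
rewrite /gauss_norm.
have -> : 2 * pi * p%:R / (L * W) = pi * (2 * p%:R / (L * W)) by ring.
have -> : 2 * p%:R * (W / L) = W ^+ 2 * (2 * p%:R / (L * W)).
  by field; rewrite Ln0 Wn0.
rewrite (sqrtrM _ (pi_ge0 R)) (sqrtrM _ (sqr_ge0 W)) sqrtr_sqr gtr0_norm//.
have s1 : Num.sqrt pi != 0 :> R by rewrite gt_eqF// sqrtr_gt0 pi_gt0.
have s2 : Num.sqrt (2 * p%:R / (L * W)) != 0 by rewrite gt_eqF// sqrtr_gt0.
by field; rewrite s1 s2 Wn0.
Qed.

Lemma gauss_norm_gt0 : 0 < gauss_norm L W r N.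
Proof.
rewrite gauss_normE divr_gt0 ?mulr_gt0// sqrtr_gt0 !mulr_gt0// ?ltr0n// invr_gt0//.
Qed.

(** The exponential in [hf] is the squared modulus of [Mcoef]; the other factors are the squared
    norm of [Mb]. *)
Lemma hRE (j : 'I_N) : hf r N L W j.+1 = hR j.
Proof.
rewrite /hf /hR cexpE gauss_normE /tauLW /=.
have -> : Mcoef j * conjc (Mcoef j) = expC (- (2%:R * (0 +i* (W / L)) * PI R * iC R * ((Jf R r j.+1) ^+ 2)%:C / (p%:R)%:C)).
  set J := Jf R r j.+1.
  have -> : - (2%:R * (0 +i* (W / L)) * PI R * iC R * (J ^+ 2)%:C / (p%:R)%:C) =
      (2 * (pi * t * J ^+ 2 / p%:R))%:C.
    have -> : - (2%:R * (0 +i* (W / L)) * PI R * iC R * (J ^+ 2)%:C / (p%:R)%:C) =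
       - (2%:R * (pii * (0 +i* (W / L))) * (J ^+ 2)%:C / (p%:R)%:C) by ring.
    rewrite lqE /lq -(rmorph_nat (real_complex R) 2) -!rmorphM/= -fmorphV -rmorphM/= -rmorphN/=.
    by congr (_%:C); ring.
  rewrite zconj expC_real /Mcoef nmM exprMn nm_expC -/J.
  have -> : nm (cM r : C) ^+ 2 = 1.
    rewrite /cM; case: (r); rewrite ?nm1 ?expr1n//;
    by rewrite /iC /nm normc_def/= expr0n/= add0r expr1n sqrtr1 expr1n.
  rewrite mul1r -expRM_natl; congr ((expR (_ * _))%:C).
  rewrite /lq -(rmorph_nat (real_complex R)) -rmorphXn -fmorphV -!rmorphM/= !mulNr opprK.
  by [].
rewrite mulrC; congr (_ * (_ * _)).
by rewrite /nuR; case: (r) => //; case: ifP.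
Qed.

Lemma hR_neq0 j : hR j != 0.
Proof.
rewrite /hR; apply: mulf_neq0; first by apply: mulf_neq0; rewrite ?conjc_eq0 Mcoef_neq0.
apply: mulf_neq0.
  by rewrite pnatr_eq0 /nuR; case: (r) => //; case: ifP.
by rewrite eq_complex /= negb_and gt_eqF ?gauss_norm_gt0.
Qed.

Lemma nuR_gt0 j : (0 < nuR r N j)%N.
Proof. by rewrite /nuR; case: (r) => //; case: ifP. Qed.

Lemma hR_realE j : hR j = (nm (Mcoef j) ^+ 2 * ((nuR r N j)%:R * gauss_norm L W r N))%:C.
Proof. by rewrite /hR zconj -(rmorph_nat (real_complex R)) -!rmorphM. Qed.

Lemma hR_real j : conjc (hR j) = hR j.
Proof.
by rewrite hR_realE conjc_real.
Qed.

Lemma phiR_orth (j k : 'I_N) :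
  hasInt2 L W (fun w => phiR j w * conjc (phiR k w)) (if j == k then hR j else 0).
Proof.
have E w : Mcoef j * conjc (Mcoef k) * (wt L W p w * (Mb r N t j (w / L%:C) * conjc (Mb r N t k (w / L%:C))))
    = phiR j w * conjc (phiR k w).
  have cE (x y u : C) : conjc (x * (y * u)) = conjc x * (conjc y * conjc u).
    by rewrite !rmorphM.
  by rewrite /phiR cE conjc_real -sqrt_wt_sqr; ring.
apply: (eq_hasInt2 E); case: eqVneq => [<-|jk].
  exact: hasInt2Z (Mb_inner_same L0 W0 v (ltn_ord j)).
rewrite -[X in hasInt2 _ _ _ X](mulr0 (Mcoef j * conjc (Mcoef k))); apply: hasInt2Z.
by apply: Mb_inner_diff; rewrite ?ltn_ord.
Qed.

Local Notation K := (Kphi phiR hR).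
Local Notation KD := (Kdet phiR hR).

Lemma KfE z w : Kf r N L W z w = K z w.
Proof.
rewrite /Kf /Kphi big_add1 /= big_mkord mulr_sumr; apply: eq_bigr => j _.
rewrite hRE !MfE// -/(Mcoef j).
have -> : - pi * p%:R * (complex.Im z ^+ 2 + complex.Im w ^+ 2) / (L * W) =
  - pi * p%:R * complex.Im z ^+ 2 / (L * W) + - pi * p%:R * complex.Im w ^+ 2 / (L * W).
  by rewrite mulrDr mulrDl.
rewrite expRD rmorphM/= -/(sqrt_wt z) -/(sqrt_wt w) /phiR.
have cE (x y u : C) : conjc (x * (y * u)) = conjc x * (conjc y * conjc u).
  by rewrite !rmorphM.
by rewrite cE conjc_real [in LHS]rmorphM/=; ring.
Qed.

Definition Mdet (z : 'I_N -> C) : C := \det (\matrix_(i < N, j < N) Mb r N t j (z i / L%:C)).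

(** At full size the kernel matrix is a product P D P^* of square matrices, so its determinant is
    |det P|^2 divided by the product of the h_j. *)
Lemma KD_Mdet (z : nat -> C) :
  KD N z = (\prod_(j < N) ((hR j)^-1 * (nm (Mcoef j) ^+ 2)%:C)) *
   (expR (- (2 * pi * p%:R / (L * W)) * \sum_(j < N) complex.Im (z j) ^+ 2))%:C *
   (nm (Mdet (fun j => z j)) ^+ 2)%:C.
Proof.
pose P : 'M[C]_N := \matrix_(i < N, j < N) phiR j (z i).
pose D : 'M[C]_N := diag_mx (\row_j (hR j)^-1).
have -> : KD N z = \det (P *m D *m (map_mx (@conjc R) P)^T).
  congr (\det _); apply/matrixP => i j; rewrite !mxE; apply: eq_bigr => k _.
  rewrite mul_mx_diag !mxE; ring.
have detP : \det P = (\prod_(i < N) (sqrt_wt (z i))%:C) * (\prod_(j < N) Mcoef j) * Mdet (fun j => z j).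
  have -> : P = diag_mx (\row_i (sqrt_wt (z i))%:C) *m
      (\matrix_(i < N, j < N) Mb r N t j (z i / L%:C)) *m diag_mx (\row_j Mcoef j).
    apply/matrixP => i j; rewrite mul_mx_diag mxE mul_diag_mx !mxE /phiR; ring.
  rewrite !det_mulmx !det_diag; under eq_bigr do rewrite mxE.
  under [X in _ * _ * X = _]eq_bigr do rewrite mxE.
  by rewrite -/(Mdet (fun j => z j)); ring.
rewrite !det_mulmx det_tr det_map_mx det_diag.
under eq_bigr do rewrite mxE.
have -> : \det P * \prod_j (hR j)^-1 * conjc (\det P) = \prod_j (hR j)^-1 * (nm (\det P) ^+ 2)%:C.
  by rewrite -zconj; ring.
rewrite detP !nmM !exprMn [in RHS]big_split/=.
have nmprod (f : 'I_N -> C) : (nm (\prod_j f j) ^+ 2)%:C = \prod_j (nm (f j) ^+ 2)%:C.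
  rewrite -rmorph_prod/=; congr (_%:C); rewrite prodrXl; congr (_ ^+ 2).
  by apply: (big_morph nm (fun x y => nmM x y) nm1).
have cM3 (x y u : R) : (x * y * u)%:C = x%:C * y%:C * u%:C :> C by rewrite !rmorphM.
rewrite cM3 !nmprod.
have -> : \prod_(i < N) (nm (sqrt_wt (z i))%:C ^+ 2)%:C =
   (expR (- (2 * pi * p%:R / (L * W)) * \sum_(j < N) complex.Im (z j) ^+ 2))%:C.
  rewrite -rmorph_prod/=; congr (_%:C); rewrite mulr_sumr expR_sum.
  apply: eq_bigr => i _; rewrite nm_real ger0_norm ?expR_ge0// -expRM_natl; congr expR.
  by field; rewrite Ln0 Wn0.
ring.
Qed.

Lemma intLam_KD (c : R) (k m : nat) z : (m + k = N)%N ->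
  intLam L W k m (fun z => c * complex.Re (KD N z)) z = c * k`!%:R * complex.Re (KD m z).
Proof. exact: (intLam_Kdet hR_neq0 hR_real phiR_orth). Qed.

Lemma KD0 z : KD 0 z = 1.
Proof. by rewrite /Kdet det_mx00. Qed.

(* Otherwise the kernel determinant of size N vanishes, but it integrates to N!. *)
Lemma Mdet_neq0 : exists x : 'I_N -> C, Mdet x != 0.
Proof.
apply: contrapT => nx.
have M0 x : Mdet x = 0.
  by apply/eqP; apply: contrapT => h; apply: nx; exists x; apply/negP.
have z0 z : KD N z = 0 by rewrite KD_Mdet M0 nm0 expr0n/= mulr0.
have := @intLam_KD 1 N 0 (fun=> 0) (add0n N).
have := @intLam_KD 0 N 0 (fun=> 0) (add0n N).
have -> : (fun z => 0 * complex.Re (KD N z)) = (fun z => 1 * complex.Re (KD N z)) :> ((nat -> C) -> R).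
  by apply/funext => z; rewrite z0 /= !mulr0.
move=> ->; rewrite KD0 /= !mul0r mul1r mulr1 => /esym/eqP.
by rewrite pnatr_eq0 gtn_eqF// fact_gt0.
Qed.

(** Both sides are constants times the Gaussian weight and the squared modulus of [Mdet], by
    [Wq_det] on the left and [KD_Mdet] on the right; a point where W is nonzero forces [c0] to be
    nonzero. *)
Lemma QfE : exists2 c : R, 0 < c & forall z, Qf r N L W z = c * complex.Re (KD N z).
Proof.
have [x hx] := Mdet_neq0.
have [c0 hc0] := Wq_det t0 v hx.
have [y hy] := Wq_neq0 r t0 v.1.
have c00 : c0 != 0 by apply: contraNneq hy => c00; rewrite hc0 c00 mul0r.
have cabsE (w : C) : cabs2 w = nm w ^+ 2.
  by rewrite /cabs2 /nm normc_def/= sqr_sqrtr// addr_ge0 ?sqr_ge0.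
pose A : R := \prod_(j < N) (complex.Re (hR j) / nm (Mcoef j) ^+ 2).
have hRr j : (complex.Re (hR j))%:C = hR j.
  by rewrite ReJ_add hR_real -mulr2n -[_ *+ 2]mulr_natr mulfK ?pnatr_eq0.
have hpos j : 0 < complex.Re (hR j) / nm (Mcoef j) ^+ 2.
  have n0 : 0 < nm (Mcoef j) ^+ 2 by rewrite exprn_gt0// lt_def nm_eq0 Mcoef_neq0 nm_ge0.
  rewrite divr_gt0// hR_realE /=.
  apply: mulr_gt0 => //; apply: mulr_gt0; first by rewrite ltr0n nuR_gt0.
  exact: gauss_norm_gt0.
exists (A * nm c0 ^+ 2).
  rewrite mulr_gt0 ?prodr_gt0// exprn_gt0// lt_def nm_eq0 c00 nm_ge0//.
move=> z.
have WqE' : Wq r N (fun j => z j / L%:C) (0 +i* t) = c0 * Mdet (fun j => z j).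
  have -> : Wq r N (fun j => z j / L%:C) (0 +i* t) = Wq r N (extz (fun j : 'I_N => z j / L%:C)) (0 +i* t).
    exact: Wq_extz.
  by rewrite hc0.
have -> : Qf r N L W z = expR (- (2 * pi * p%:R / (L * W)) * \sum_(j < N) complex.Im (z j) ^+ 2) *
    nm (Wq r N (fun j => z j / L%:C) (0 +i* t)) ^+ 2.
  rewrite /Qf /Wq; case: (r); rewrite -?cabsE//; congr (_ * _).
  by rewrite !cabsE nmM exprMn.
rewrite WqE' nmM exprMn KD_Mdet.
have -> : \prod_(j < N) ((hR j)^-1 * (nm (Mcoef j) ^+ 2)%:C) = (A^-1)%:C.
  rewrite -prodfV rmorph_prod/=; apply: eq_bigr => j _.
  by rewrite invf_div [RHS]rmorphM/= [in RHS]fmorphV/= hRr mulrC.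
rewrite -!rmorphM/=; have A0 : A != 0 by rewrite gt_eqF// prodr_gt0.
by field.
Qed.

(** The kernel determinant integrates to N! over all variables, so Z is the constant c of [QfE] and
    cancels. The factor 1 matches the form of [intLam_KD]. *)
Lemma pfE : pf r N L W = (fun z => 1 * complex.Re (KD N z)).
Proof.
have [c c0 hc] := QfE; apply/funext => z; rewrite /pf /Zf.
have -> : Qf r N L W = (fun z => c * complex.Re (KD N z)) by apply/funext.
have fn : (N`!%:R : R) != 0 by rewrite pnatr_eq0 gtn_eqF// fact_gt0.
rewrite intLam_KD ?add0n// KD0 /=.
have cn : c != 0 by rewrite gt_eqF.
by field; rewrite cn fn.
Qed.

Lemma rhoE (N' : nat) (z : 'I_N' -> C) : (N' <= N)%N ->
  rho r N L W z = complex.Re (KD N' (extz z)).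
Proof.
move=> NN; rewrite /rho pfE intLam_KD ?subnKC// mul1r mulKf//.
Qed.

Lemma rho_det (N' : nat) (z : 'I_N' -> C) : (N' <= N)%N ->
  (rho r N L W z)%:C = \det (\matrix_(j < N', k < N') Kf r N L W (z j) (z k)).
Proof.
move=> NN; rewrite rhoE// Kdet_real//; last exact: hR_real.
by congr (\det _); apply/matrixP => i j; rewrite !mxE KfE !extzE.
Qed.

(** The phases conjugate the kernel matrix by a diagonal unitary matrix. *)
Lemma KD_phase (m : nat) (z z' : nat -> C) (e : nat -> C) :
  (forall i, (i < m)%N -> e i * conjc (e i) = 1) ->
  (forall i, (i < m)%N -> forall j, phiR j (z' i) = e i * phiR j (z i)) -> KD m z' = KD m z.
Proof.
move=> he hz.
have -> : KD m z' = \det (diag_mx (\row_i e i) *m Kmx phiR hR m z *m diag_mx (\row_i conjc (e i))).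
  congr (\det _); apply/matrixP => i j; rewrite mul_mx_diag mxE mul_diag_mx !mxE.
  rewrite /Kphi mulr_sumr mulr_suml; apply: eq_bigr => k _.
  by rewrite !hz// [conjc (_ * _)]rmorphM/=; ring.
rewrite !det_mulmx !det_diag -/(KD m z) mulrAC -big_split/=.
rewrite big1 ?mul1r// => i _; rewrite !mxE; exact: he.
Qed.

Lemma kapR_sign j : (-1) ^ (kapR r N j) = (-1) ^ (kap0 r N) :> C.
Proof.
rewrite /kapR expfzDr ?oppr_eq0 ?oner_eq0// PoszM -exprz_exp.
by rewrite -[(-1) ^ 2]/((-1) ^+ 2) sqrrN expr1n exp1rz mulr1.
Qed.

Lemma MbE j x : Mb r N t j x = Th t p (mR r) (kapR r N j) x + sgR r * Th t p (mR r) (- kapR r N j) x.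
Proof. by rewrite /Mb Th_neg//; exact: mR_N. Qed.

(** All frequencies of all M_j have the parity of [kap0 r N], so one sign serves every j. *)
Lemma phiR_addL (j : 'I_N) z : phiR j (z + L%:C) = (-1) ^ (kap0 r N) * phiR j z.
Proof.
have Lc : L%:C != 0 :> C by rewrite eq_complex /= negb_and Ln0.
rewrite /phiR mulrDl divff// !MbE !Th_add1//.
have -> : sqrt_wt (z + L%:C) = sqrt_wt z by case: z => a b; rewrite /sqrt_wt /= addr0.
have -> : (-1) ^ (- kapR r N j) = (-1) ^ (kap0 r N) :> C.
  by rewrite -exprz_inv invrN invr1 kapR_sign.
by rewrite kapR_sign; ring.
Qed.

(** Completing the square moves the frequency k to k + 2p. The resulting factor depends on x but not
    on [kap], so it is common to all M_j. *)
Lemma Th_add_tau kap x : Th t p (mR r) kap (x + (0 +i* t)) =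
  expC (- (lq t * p%:R) - mR r) * ee (- (2 * p)%:Z) x * Th t p (mR r) kap x.
Proof.
apply: hasSum_unique (hasSumZ _ (hasSum_Th (mR r) kap x t0 p0)).
have inj1 : injective (fun n : int => n + 1) by move=> ? ? /addIr.
apply: (hasSum_reindex inj1) => [n _|]; first by exists (n - 1); rewrite subrK.
apply: eq_hasSum (hasSum_Th (mR r) kap (x + (0 +i* t)) t0 p0) => n.
rewrite /Thterm /= ee_addx.
have -> : ee (kap + (2 * p)%:Z * n) (0 +i* t) = expC (lq t * (kap + (2 * p)%:Z * n)%:~R).
  by rewrite /ee -mulrA lqE mulrC.
have pc : p%:R != 0 :> C by rewrite pnatr_eq0 -lt0n.
have -> : kap + (2 * p)%:Z * (n + 1) = (kap + (2 * p)%:Z * n) + (2 * p)%:Z by ring.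
set k := kap + _; rewrite (eeD k (2 * p)%:Z).
have eN : ee (- (2 * p)%:Z) x * ee (2 * p)%:Z x = 1 by rewrite -eeD addNr /ee mul0r mul0r expC0.
have -> : n%:~R * mR r + lq t * k%:~R ^+ 2 / (4 * p)%:R = - (lq t * k%:~R) +
   (- (lq t * p%:R) - mR r + ((n + 1)%:~R * mR r + lq t * (k + (2 * p)%:Z)%:~R ^+ 2 / (4 * p)%:R)).
  have fl (n' k' a q P : C) : P != 0 -> n' * a + q * k' ^+ 2 / (4 * P) =
      - (q * k') + (- (q * P) - a + ((n' + 1) * a + q * (k' + 2 * P) ^+ 2 / (4 * P))).
    by move=> P0; field.
  by rewrite natrM (fl _ _ _ _ _ pc) !intrD -[((2 * p)%:Z)%:~R]/((2 * p)%:R) natrM.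
rewrite !expCD.
have cancel (F E A B D D' K G H : C) : F * E = 1 -> G * H = 1 ->
    F * (A * B * (D * D')) * (K * E) = A * B * G * (D * D' * (K * H)).
  move=> e1 e2.
  have -> : F * (A * B * (D * D')) * (K * E) = (F * E) * (A * B * (D * D')) * K by ring.
  have -> : A * B * G * (D * D' * (K * H)) = (G * H) * (A * B * (D * D')) * K by ring.
  by rewrite e1 e2.
by apply: cancel => //; rewrite -expCD addNr expC0.
Qed.

Definition phaseW (z : C) : C :=
  (sqrt_wt (z + (0 +i* W)) / sqrt_wt z)%:C *
  (expC (- (lq t * p%:R) - mR r) * ee (- (2 * p)%:Z) (z / L%:C)).

Lemma phiR_addW (j : 'I_N) z : phiR j (z + (0 +i* W)) = phaseW z * phiR j z.
Proof.
have h0 : sqrt_wt z != 0 by rewrite gt_eqF// expR_gt0.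
have E : (z + (0 +i* W)) / L%:C = z / L%:C + (0 +i* t).
  rewrite mulrDl; congr (_ + _); rewrite -fmorphV; apply/eqP.
  by rewrite eq_complex/= !mul0r !mulr0 subr0 add0r !eqxx.
rewrite /phiR /phaseW E !MbE !Th_add_tau.
have -> : (sqrt_wt (z + (0 +i* W)))%:C = (sqrt_wt (z + (0 +i* W)) / sqrt_wt z)%:C * (sqrt_wt z)%:C.
  by rewrite -rmorphM/= divfK.
by ring.
Qed.

(** The growth of the quasi-periodicity factor is undone exactly by the ratio of the Gaussian
    weights at Im z + W and Im z. *)
Lemma phaseW_unit z : phaseW z * conjc (phaseW z) = 1.
Proof.
rewrite zconj -[RHS](rmorph1 (real_complex R)); congr (_%:C).
suff -> : nm (phaseW z) = 1 by rewrite expr1n.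
rewrite /phaseW !nmM nm_real /ee !nm_expC.
have -> : complex.Re (- (lq t * p%:R) - mR r) = pi * t * p%:R.
  have m0 : complex.Re (mR r : C) = 0 by rewrite /mR; case: (r); rewrite ?piiE.
  by rewrite raddfB/= m0 subr0 -(rmorph_nat (real_complex R)) -rmorphM -rmorphN/= mulNr opprK.
have -> : complex.Re ((- (2 * p)%:Z)%:~R * pii * (z / L%:C)) = 2 * p%:R * pi * (complex.Im z / L).
  have zE : complex.Re (pii * (z / L%:C)) = - (pi * (complex.Im z / L)).
    have -> u : complex.Re (pii * u) = - (pi * complex.Im u).
      by rewrite piiE; case: u => x y /=; rewrite mul0r sub0r.
    by rewrite -fmorphV Im_mulr.
  by rewrite -[X in complex.Re X]mulrA Re_intM zE mulrNz -[((2 * p)%:Z)%:~R]/((2 * p)%:R) natrM; ring.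
rewrite ger0_norm ?divr_ge0 ?expR_ge0// /sqrt_wt -expRN -!expRD -[RHS]expR0; congr expR.
have -> : complex.Im (z + (0 +i* W)) = complex.Im z + W by case: z.
by field; rewrite Ln0 Wn0.
Qed.

Lemma extz_upd (N' : nat) (z : 'I_N' -> C) (j : 'I_N') (c : C) (i : nat) : (i < N')%N ->
  extz (fun k => if k == j then z k + c else z k) i = if i == j then extz z i + c else extz z i.
Proof.
move=> iN; have E y : extz y i = y (Ordinal iN) := extzE y (Ordinal iN).
by rewrite !E.
Qed.

Lemma rho_periodic (N' : nat) (z : 'I_N' -> C) (j : 'I_N') (c e : C) : (N' <= N)%N ->
  e * conjc e = 1 -> (forall k, phiR k (z j + c) = e * phiR k (z j)) ->
  rho r N L W (fun k => if k == j then z k + c else z k) = rho r N L W z.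
Proof.
move=> NN e1 he; rewrite !rhoE//; congr complex.Re.
(* Only the translated variable acquires the phase [e]. *)
apply: (@KD_phase _ _ _ (fun i => if i == j then e else 1)) => i iN.
  by case: ifP => // _; rewrite conjc1 mulr1.
move=> k; rewrite extz_upd//; case: eqP => [->|_]; last by rewrite mul1r.
by rewrite extzE.
Qed.

End Process.

Theorem theorem3p2 (R : realType) (L W : R) (r : rsys) (N : nat) :
  0 < L -> 0 < W -> (1 <= N)%N -> (r = RD -> (2 <= N)%N) ->
  forall (N' : nat), (1 <= N')%N -> (N' <= N)%N ->
  (forall z : 'I_N' -> R[i],
     (rho r N L W z)%:C =
       \det (\matrix_(j < N', k < N') Kf r N L W (z j) (z k))) /\
  (forall (z : 'I_N' -> R[i]) (j : 'I_N'),
     rho r N L W (fun k => if k == j then z k + L%:C else z k) = rho r N L W z /\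
     rho r N L W (fun k => if k == j then z k + (0 +i* W) else z k) = rho r N L W z).
Proof.
move=> L0 W0 N0 ND N' _ NN; have v : valid r N by split.
split=> [z|z j]; first exact: rho_det.
split.
  apply: (rho_periodic L0 W0 v NN _ (fun k => phiR_addL L0 W0 v k (z j))).
  by rewrite zconj signz_expC nm_expC Re_intM piiE mulr0 expR0 expr1n.
apply: (rho_periodic L0 W0 v (e := phaseW L W r N (z j)) NN) => [|k].
  exact: phaseW_unit.
exact: phiR_addW.
Qed.
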